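(* Consider the combinatorial causal bandit problem with budget $K$ and horizon $T$ on a binary linear model (BLM) $G=(\boldsymbol U\cup\boldsymbol X\cup\{Y\},E)$ with hidden variables of the admissible form described in the context, and let $G'$ be the transformed Markovian BLM, with $n$ nodes and maximum in-degree $D=\max_{X\in\boldsymbol X\cup\{Y\}}|\mathrm{Pa}'(X)|$. Then the regret (with respect to $G$) of the algorithm BLM-LR run on $G'$ satisfies $$R(T)=O\left(n^2\sqrt{DT}\,\log T\right),$$ i.e. there is an absolute constant $C$ with $R(T)\le C\,n^2\sqrt{DT}\log T$ for all $T\ge2$.
   Context: **BLM with hidden variables.** $G=(\boldsymbol U\cup\boldsymbol X\cup\{Y\},E)$ is a finite DAG with $\{0,1\}$-valued variables; $\boldsymbol U=\{U_0,U_1,\dots\}$ are hidden, $\boldsymbol X\cup\{Y\}$ observed; $Y$ has no outgoing edges; $U_0\equiv1$ has only outgoing edges (modelling self-activation). For every node $X\neq U_0$ with parents $\mathrm{Pa}(X)$: $P(X=1\mid \mathrm{Pa}(X)=\mathrm{pa}(X))=\boldsymbol\theta^*_X\cdot \mathrm{pa}(X)+\varepsilon_X\in[0,1]$, with unknown $\boldsymbol\theta^*_X\in[0,1]^{|\mathrm{Pa}(X)|}$ and zero-mean sub-Gaussian noises $\varepsilon_X$, mutually independent over nodes and rounds. $\theta^*_{Z,X}$ is the weight of edge $(Z,X)$. Arbitrary edges involving hidden nodes are allowed, except that the following is excluded: a hidden node $U_s$ with $s>0$ has a directed path to an observed $X_i$ and a directed path to an observed descendant $X_j$ of $X_i$,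 with all nodes of both paths hidden except the end points $X_i$, $X_j$. $do(\boldsymbol S=\boldsymbol s)$ forces $\boldsymbol S$ to values $\boldsymbol s$; $do(\boldsymbol S)$ means $do(\boldsymbol S=\boldsymbol 1)$. **Transformed model $G'$.** $G'=(\{X_1\}\cup\boldsymbol X\cup\{Y\},E')$, with $X_1\notin\boldsymbol X\cup\{Y\}$ a new node constantly equal to $1$. A hidden path from observed $X_i$ to observed $X_j$ in $G$ is a directed path all of whose intermediate nodes (if any) are hidden; $\theta^*_P$ is the product of the weights on path $P$. If the set $\mathcal P^u_{X_i,X_j}$ of hidden paths is nonempty, $E'$ contains $(X_i,X_j)$ with weight $\theta^{*\prime}_{X_i,X_j}=\sum_{P\in\mathcal P^u_{X_i,X_j}}\theta^*_P$. For each $X_i\in\boldsymbol X\cup\{Y\}$, $E'$ contains $(X_1,X_i)$ with weight $\theta^{*\prime}_{X_1,X_i}=\Pr\{X_i=1\mid do(\boldsymbol X\cup\{Y\}\setminus\{X_i\}=\boldsymbol0)\}$ (probability in $G$). The noise variables are carried over; $G'$ is a BLM without hidden variables. $\mathrm{Pa}'(X)$ denotes parents in $G'$. $\sigma'(\boldsymbol S,\boldsymbol\theta)$ is the expectation of $Y$ under $do(\boldsymbol S)$ in $G'$ when its parameters are $\boldsymbol\theta$, where, in topological order, a non-intervened $X$ is set to $1$ iff $\boldsymbol\theta_X\cdot \mathrm{Pa}'(X)+\varepsilon_X\ge\gamma_X$ with $\gamma_X$ i.i.d. uniform on $[0,1]$. **Problem.** In each round $t=1,\dots,T$ the agent chooses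 $\boldsymbol S_t\subseteq\boldsymbol X$, $|\boldsymbol S_t|\le K$, plays $do(\boldsymbol S_t)$ in $G$, and observes all values of $\boldsymbol X\cup\{Y\}$. The observed graph structure is known; the parameters are not. $R(T)=\mathbb E[\sum_{t=1}^T(\mathbb E[Y\mid do(\boldsymbol S^* )]-\mathbb E[Y\mid do(\boldsymbol S_t)])]$, where $\boldsymbol S^*$ maximizes $\mathbb E[Y\mid do(\boldsymbol S)]$ over $\boldsymbol S\subseteq\boldsymbol X$, $|\boldsymbol S|=K$. **Algorithm BLM-LR on $G'$.** $\|\boldsymbol x\|_M=\sqrt{\boldsymbol x^\top M\boldsymbol x}$. For each $X\in\boldsymbol X\cup\{Y\}$ put $M_{0,X}=\mathbf I$, $\boldsymbol b_{0,X}=\boldsymbol0$, $\hat{\boldsymbol\theta}_{0,X}=\boldsymbol0$ (dimension $|\mathrm{Pa}'(X)|$); $\delta=\frac1{n\sqrt T}$; $\rho_t=\sqrt{n\log(1+tn)+2\log\frac1\delta}+\sqrt n$. In round $t=1,\dots,T$: let $\mathcal C_{t,X}=\{\boldsymbol\theta'_X\in[0,1]^{|\mathrm{Pa}'(X)|}:\|\boldsymbol\theta'_X-\hat{\boldsymbol\theta}_{t-1,X}\|_{M_{t-1,X}}\le\rho_{t-1}\}$; choose $(\boldsymbol S_t,\tilde{\boldsymbol\theta}_t)$ maximizing $\sigma'(\boldsymbol S,\boldsymbol\theta')$ over $\boldsymbol S\subseteq\boldsymbol X$, $|\boldsymbol S|\le K$, $\boldsymbol\theta'_X\in\mathcal C_{t,X}$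 for all $X$; play $do(\boldsymbol S_t)$; for each $X\notin\boldsymbol S_t$, with $\boldsymbol V_{t,X}$ the observed values of $\mathrm{Pa}'(X)$ and $X^t$ the observed value of $X$, set $M_{t,X}=M_{t-1,X}+\boldsymbol V_{t,X}\boldsymbol V_{t,X}^\top$, $\boldsymbol b_{t,X}=\boldsymbol b_{t-1,X}+X^t\boldsymbol V_{t,X}$, $\hat{\boldsymbol\theta}_{t,X}=M_{t,X}^{-1}\boldsymbol b_{t,X}$ (no update for $X\in\boldsymbol S_t$). *)

(* Defs.v *)
From mathcomp Require Export all_boot all_order all_algebra.
From mathcomp Require Export all_classical all_reals all_analysis.

Set Implicit Arguments.
Unset Strict Implicit.
Unset Printing Implicit Defensive.
Import Order.TTheory GRing.Theory Num.Theory.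
Import numFieldNormedType.Exports.
Local Open Scope classical_set_scope.
Local Open Scope ring_scope.

Section independence.
Context {d : measure_display} {T : measurableType d} {R : realType}.
Variable P : probability T R.

Definition mutually_independent (I : choiceType) (Z : I -> T -> R) : Prop :=
  forall (J : seq I) (B : I -> set R), uniq J ->
    (forall i, measurable (B i)) ->
    P (\bigcap_(i in [set` J]) (Z i @^-1` B i))
    = (\prod_(i <- J) P (Z i @^-1` B i))%E.

End independence.

Section binary_linear_model.
Context {R : realType} {V : finType}.

(* [weight z v] is only meaningful on edges [edge z v]; [root] is the node
   that is constantly 1. *)
Record blm := Blm {
  edge : rel V;
  weight : V -> V -> R;
  root : V
}.

Definition acyclic (e : rel V) : Prop :=
  forall x y, e x y -> ~~ connect e y x.

(* An intervention: [Some b] forces the node to [b], [None] leaves it free. *)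
Definition intervention := V -> option bool.

Definition lin_pred (G : blm) (x : {ffun V -> bool}) (v : V) : R :=
  \sum_(z | edge G z v) weight G z v * (x z)%:R.

Definition update (G : blm) (iv : intervention) (e g : V -> R)
    (x : {ffun V -> bool}) : {ffun V -> bool} :=
  [ffun v => if iv v is Some b then b
             else (v == root G) || (g v <= lin_pred G x v + e v)].

(* The solution of the structural equations with noises [e] and thresholds
   [g]: on an acyclic graph, after #|V| simultaneous updates every node has
   been recomputed from the final values of its parents. *)
Definition solve (G : blm) (iv : intervention) (e g : V -> R)
    : {ffun V -> bool} :=
  iter #|V| (update G iv e g) [ffun=> false].

Definition path_weight (G : blm) : V -> seq V -> R :=
  fix pw x s := if s is y :: s' then weight G x y * pw y s' else 1.

Context {d : measure_display} {Omega : measurableType d}.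
Variable P : probability Omega R.

Definition mean (G : blm) (iv : intervention) (e g : V -> Omega -> R) (y : V)
    : R :=
  fine ('E_P[fun w => (solve G iv (e ^~ w) (g ^~ w) y)%:R])%E.

(* Conditionally on the noises, a node [v] whose parents have values [x] is 1
   with probability [lin_pred G x v + eps v]: this is realized by comparison
   with a threshold [gam v], uniform on [0, 1]. The noises (and thresholds) of
   the successive rounds are independent copies of each other. The range
   condition is for assignments [x] giving the constant node its value 1. The
   values of [eps t] and [gam t] at the root are never used. *)
Record blm_noise (G : blm) (eps gam : nat -> V -> {RV P >-> R}) : Prop := {
  noise_indep : @mutually_independent _ _ _ P ((nat * V) + (nat * V))%type
    (fun i => match i with
              | inl (t, v) => eps t v
              | inr (t, v) => gam t v
              end);
  noise_ident : forall t v (B : set R), measurable B ->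
    distribution P (eps t v) B = distribution P (eps 0%N v) B;
  noise_mean0 : forall t v, v != root G -> ('E_P[eps t v] = 0)%E;
  noise_subgaussian : forall v, v != root G ->
    exists2 s : R, 0 < s &
      forall t l, ('M_P (eps t v) l <= (expR (l ^+ 2 * s ^+ 2 / 2))%:E)%E;
  noise_range : forall t v (x : {ffun V -> bool}), v != root G ->
    x (root G) ->
    {ae P, forall w, 0 <= lin_pred G x v + eps t v w <= 1};
  threshold_unif : forall t v (B : set R), measurable B ->
    distribution P (gam t v) B = uniform_prob (@ltr01 R) B
}.

End binary_linear_model.
Arguments blm : clear implicits.

Section hidden_variables.
Context {R : realType} {H X : finType}.

(* [inl u]: hidden; [inr (Some x)]: observed, in the set X; [inr None]: Y. *)
Local Notation node := (H + option X)%type.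
(* Nodes of the transformed model: [None] is the new constant node X_1 and
   [Some o] is the observed node [inr o]. *)
Local Notation node' := (option (option X)).

(* The internal nodes of the path from [x] to [inr b] are those of [p]. *)
Definition hidden_path (e : rel node) (x : node) (p : seq H) (b : option X)
    : bool :=
  path e x (rcons (map inl p) (inr b)).

Record admissible (G : blm R node) (u0 : H) : Prop := {
  adm_root : root G = inl u0;
  adm_acyclic : acyclic (edge G);
  adm_weight : forall z v, edge G z v -> 0 <= weight G z v <= 1;
  adm_Y_sink : forall v, ~~ edge G (inr None) v;
  adm_U0_source : forall v, ~~ edge G v (inl u0);
  adm_confounding : forall (s : H) (i j : option X), s != u0 ->
    i != j -> connect (edge G) (inr i) (inr j) ->
    ~ ((exists p, hidden_path (edge G) (inl s) p i) /\
       (exists q, hidden_path (edge G) (inl s) q j))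
}.

Definition do_obs (S : {set X}) : intervention (V := node) :=
  fun v => if v is inr (Some x) then if x \in S then Some true else None
           else None.

Definition do_obs' (S : {set X}) : intervention (V := node') :=
  fun v => if v is Some (Some x) then if x \in S then Some true else None
           else None.

Definition do_others0 (o : option X) : intervention (V := node) :=
  fun v => if v is inr o' then if o' == o then None else Some false
           else None.

(* On an acyclic graph, the hidden parts of hidden paths are repetition-free,
   so that sequences of length at most #|H| cover all of them. *)
Definition edge' (G : blm R node) : rel node' := fun z v =>
  match z, v with
  | None, Some _ => true
  | Some i, Some j =>
      [exists p : #|H|.-bseq H, hidden_path (edge G) (inr i) p j]
  | _, None => false
  end.

Context {d : measure_display} {Omega : measurableType d}.
Variable P : probability Omega R.

(* [e] and [g] are the noises and thresholds of one round. *)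
Definition weight' (G : blm R node) (e g : node -> Omega -> R)
    (z v : node') : R :=
  match z, v with
  | None, Some j =>
      fine (P [set w | solve G (do_others0 j) (e ^~ w) (g ^~ w) (inr j)])
  | Some i, Some j =>
      \sum_(p : #|H|.-bseq H | hidden_path (edge G) (inr i) p j)
        path_weight G (inr i) (rcons (map inl p) (inr j))
  | _, None => 0
  end.

Definition transformed (G : blm R node) (e g : node -> Omega -> R)
    : blm R node' :=
  {| edge := edge' G; weight := weight' G e g; root := None |}.

(* Noises carried over to the transformed model (the value at the constant
   node is irrelevant). *)
Definition carry (e : node -> Omega -> R) (v : node') : Omega -> R :=
  if v is Some o then e (inr o) else fun=> 0.

Definition reward (G : blm R node) (e g : node -> Omega -> R) (S : {set X})
    : R :=
  mean P G (do_obs S) e g (inr None).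

Definition sigma' (G' : blm R node') (e g : node -> Omega -> R)
    (S : {set X}) (th : node' -> node' -> R) : R :=
  mean P {| edge := edge G'; weight := th; root := root G' |}
    (do_obs' S) (carry e) (carry g) (Some None).

Definition is_optimal (G : blm R node) (e g : node -> Omega -> R) (K : nat)
    (S : {set X}) : Prop :=
  #|S| = K /\ forall S' : {set X}, #|S'| = K ->
    reward G e g S' <= reward G e g S.

End hidden_variables.

Section BLM_LR.
Context {R : realType} {X : finType}.
Local Notation node' := (option (option X)).
Variable G' : blm R node'.

Definition parents' (o : option X) : {set node'} :=
  [set z | edge G' z (Some o)].

Definition nb_nodes : nat := #|{: node'}|.

Definition max_in_degree : nat := (\max_(o : option X) #|parents' o|)%N.

(* Restriction of a weight assignment to the vector of weights of the edges
   entering [o]. *)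
Definition par_weights (th : node' -> node' -> R) (o : option X)
    : 'cV[R]_(#|parents' o|) :=
  \col_k th (enum_val k) (Some o).

Definition par_values (x : {ffun option X -> bool}) (o : option X)
    : 'cV[R]_(#|parents' o|) :=
  \col_k (if enum_val k is Some o' then x o' else true)%:R.

(* Past rounds, most recent first: the set intervened on and the observed
   values of all observed nodes. *)
Definition history := seq ({set X} * {ffun option X -> bool}).

Fixpoint gram (h : history) (o : option X) : 'M[R]_(#|parents' o|) :=
  if h is (A, x) :: h' then
    if o \in Some @: A then gram h' o
    else gram h' o + par_values x o *m (par_values x o)^T
  else 1%:M.

Fixpoint bvec (h : history) (o : option X) : 'cV[R]_(#|parents' o|) :=
  if h is (A, x) :: h' then
    if o \in Some @: A then bvec h' o
    else bvec h' o + (x o)%:R *: par_values x o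
  else 0.

Definition theta_hat (h : history) (o : option X) : 'cV[R]_(#|parents' o|) :=
  invmx (gram h o) *m bvec h o.

Definition mnorm (m : nat) (M : 'M[R]_m) (v : 'cV[R]_m) : R :=
  Num.sqrt ((v^T *m M *m v) ord0 ord0).

Definition delta (T : nat) : R := (nb_nodes%:R * Num.sqrt T%:R)^-1.

Definition rho (T t : nat) : R :=
  let n : R := nb_nodes%:R in
  Num.sqrt (n * ln (1 + t%:R * n) + 2 * ln (delta T)^-1) + Num.sqrt n.

(* The confidence region of round [(size h).+1]. *)
Definition conf_region (T : nat) (h : history) (o : option X)
    : set 'cV[R]_(#|parents' o|) :=
  [set th : 'cV[R]_(#|parents' o|) |
    (forall k, 0 <= th k ord0 <= 1) /\
    mnorm (gram h o) (th - theta_hat h o) <= rho T (size h)].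

Definition candidate (K T : nat) (h : history)
    (c : {set X} * (node' -> node' -> R)) : Prop :=
  (#|c.1| <= K)%N /\ forall o, conf_region T h (par_weights c.2 o).

Definition policy := history -> {set X} * (node' -> node' -> R).

Context {H : finType} {d : measure_display} {Omega : measurableType d}.
Variable P : probability Omega R.

(* [pol] is an arbitrary rule for choosing a maximizer; when some confidence
   region is empty (so that there is no candidate), it is only required to
   respect the budget. *)
Definition BLM_LR (e g : H + option X -> Omega -> R) (K T : nat)
    (pol : policy) : Prop :=
  forall h : history, (#|(pol h).1| <= K)%N /\
    ((exists c, candidate K T h c) ->
     candidate K T h (pol h) /\
     forall c, candidate K T h c ->
       sigma' P G' e g c.1 c.2 <= sigma' P G' e g (pol h).1 (pol h).2).

End BLM_LR.
Arguments history : clear implicits.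
Arguments policy : clear implicits.

Section regret.
Context {R : realType} {H X : finType}.
Context {d : measure_display} {Omega : measurableType d}.
Variable P : probability Omega R.
Local Notation node := (H + option X)%type.
Variables (G : blm R node) (eps gam : nat -> node -> {RV P >-> R}).

(* Round [t >= 1] uses the noises [eps t] and [gam t]; those of index 0 are
   a generic copy, never played, through which the expectations and
   probabilities attached to the model are expressed. *)
Definition observe (t : nat) (w : Omega) (S : {set X})
    : {ffun option X -> bool} :=
  [ffun o => solve G (do_obs S) (fun v => eps t v w) (fun v => gam t v w)
               (inr o)].

Fixpoint run (pol : policy R X) (w : Omega) (t : nat) : history X :=
  if t is t'.+1 then
    let h := run pol w t' in
    let S := (pol h).1 in
    (S, observe t w S) :: h
  else [::].

Definition regret (pol : policy R X) (Sopt : {set X}) (T : nat) : \bar R :=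
  ('E_P[fun w => (\sum_(t < T)
     (reward P G (eps 0%N) (gam 0%N) Sopt
      - reward P G (eps 0%N) (gam 0%N) (pol (run pol w t)).1))%R])%E.

End regret.

(* Main.v *)
(* In general the law of the observed variables differs in G and G': siblings
   may be correlated through hidden nodes in G. Only a one-sided comparison
   holds, and it suffices. Let theta0 be the true weights of G' and
   delta = theta - theta0.

   (1) sigma'(S, theta) is at most E_G[Y | do(S)] plus the sum over
   non-intervened o of E_G |delta_o . Pa'(o)|. The observed nodes are
   eliminated one by one from the law of G', starting from the last one,
   while a potential - an increasing function of the observed values with
   increasing increments - replaces Y. In G, since the confounding
   configuration is excluded, the observed ancestors of o are independent of
   the noises of o and of the hidden nodes leading to it (its cone), so that
   E[o g] = E[(theta0_o . Pa'(o)) g] when g is a function of the parents of o,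
   and, by Harris' inequality over the cone, E[o g] >= E[(theta0_o . Pa'(o)) g]
   for every increasing g.

   (2) E_G[Y | do(S)] is at most sigma'(S, theta0), because the means satisfy
   the same linear recursion in both models.

   By (1) and (2), when all confidence regions contain the true weights, the
   optimistic choice has regret at most the sum of the widths
   E |delta_o . Pa'(o)|, to which the usual analysis of linear bandits applies:
   the method of mixtures for the confidence regions, the growth of log det M
   for the sum of the widths. *)
Require Import Defs.
From mathcomp Require Import ring lra measurable_realfun.
Import Order.TTheory GRing.Theory Num.Theory.
Import numFieldNormedType.Exports.
Set Implicit Arguments.
Unset Strict Implicit.
Unset Printing Implicit Defensive.
Local Open Scope ring_scope.

(** * Finite products and threshold networks *)

(** The confidence regions contain weights for which predictor plus noise leaves [0, 1], so the
    network with weights theta need not be a linear model: its firing probabilities are only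
    bounded, by the larger of the predictor and a base rate. This makes the potential nonlinear,
    since eliminating a node composes it with a maximum and a truncation at 1. Two properties must
    survive each elimination. Increments must stay increasing, or Harris' inequality, which stands
    in for the Markov property in G, would not apply to the next node. Slopes must be brought back
    to at most 1, or the error at a node would be weighted by a sum over directed paths to Y; since
    Y is at most 1, steep coordinates can be rescaled at no cost. A node responds to only finitely
    many configurations, so each noise can be replaced by a finite rank. All laws become finite
    product laws, the run an iterated finite sum, and conditioning an average over a block of
    coordinates. The choice delta = 1 / (n sqrt T) makes the cost of a failure of the confidence
    regions, T n delta, equal to sqrt T. *)

Section product_expectation.
Context {R : realFieldType} {V F : finType}.
Variable pi : V -> F -> R.

Definition wt (r : {ffun V -> F}) : R := \prod_v pi v (r v).

Definition Ex (phi : {ffun V -> F} -> R) : R := \sum_r wt r * phi r.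

Definition mix (C : {set V}) (s r : {ffun V -> F}) : {ffun V -> F} :=
  [ffun v => if v \in C then s v else r v].

(* Conditional expectation given the coordinates outside [C]. *)
Definition avg (C : {set V}) (phi : {ffun V -> F} -> R) r : R :=
  Ex (fun s => phi (mix C s r)).

Definition indep_of (C : {set V}) (T : Type) (phi : {ffun V -> F} -> T) : Prop :=
  forall s r, phi (mix C s r) = phi r.

Lemma eq_Ex phi psi : phi =1 psi -> Ex phi = Ex psi.
Proof. by move=> h; apply: eq_bigr => r _; rewrite h. Qed.

Lemma ExD phi psi : Ex (fun r => phi r + psi r) = Ex phi + Ex psi.
Proof. by rewrite /Ex -big_split; apply: eq_bigr => r _; rewrite mulrDr. Qed.

Lemma ExZ c phi : Ex (fun r => c * phi r) = c * Ex phi.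
Proof. by rewrite /Ex mulr_sumr; apply: eq_bigr => r _; rewrite mulrCA. Qed.

Lemma ExZr c phi : Ex (fun r => phi r * c) = Ex phi * c.
Proof. by rewrite mulrC -ExZ; apply: eq_Ex => r; rewrite mulrC. Qed.

Lemma Ex_sum (I : finType) (A : pred I) (phi : I -> {ffun V -> F} -> R) :
  Ex (fun r => \sum_(i | A i) phi i r) = \sum_(i | A i) Ex (phi i).
Proof.
rewrite /Ex exchange_big /=; apply: eq_bigr => r _; by rewrite mulr_sumr.
Qed.

Lemma wt_mix C s r : wt (mix C s r) * wt (mix C r s) = wt r * wt s.
Proof.
rewrite /wt -!big_split; apply: eq_bigr => v _; rewrite !ffunE.
by case: ifP => //= _; rewrite mulrC.
Qed.

Lemma mixK C s r : mix C (mix C r s) (mix C s r) = r.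
Proof. by apply/ffunP => v; rewrite !ffunE; case: ifP => // ->. Qed.

Hypothesis pi_ge0 : forall v b, 0 <= pi v b.
Hypothesis pi_sum1 : forall v, \sum_b pi v b = 1.

Lemma wt_ge0 r : 0 <= wt r.
Proof. by apply: prodr_ge0 => v _. Qed.

Lemma wt_sum1 : \sum_r wt r = 1.
Proof.
rewrite /wt -(bigA_distr_bigA (fun v b => pi v b)).
by rewrite big1// => v _; exact: pi_sum1.
Qed.

Lemma le_Ex phi psi : (forall r, phi r <= psi r) -> Ex phi <= Ex psi.
Proof. by move=> h; apply: ler_sum => r _; rewrite ler_wpM2l ?wt_ge0. Qed.

Lemma Ex_cst c : Ex (fun=> c) = c.
Proof. by rewrite /Ex -mulr_suml wt_sum1 mul1r. Qed.

Lemma Ex_marginal v (f : F -> R) : Ex (fun r => f (r v)) = \sum_b pi v b * f b.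
Proof.
rewrite /Ex.
transitivity (\sum_(r : {ffun V -> F})
    \prod_u (pi u (r u) * (if u == v then f (r u) else 1))).
  apply: eq_bigr => r _; rewrite big_split /=; congr (_ * _).
  by rewrite (bigD1 v)//= eqxx big1 ?mulr1// => u /negbTE->.
rewrite -(bigA_distr_bigA (fun u b => pi u b * (if u == v then f b else 1))).
rewrite (bigD1 v)//= [X in _ * X]big1 ?mulr1; last first.
  by move=> u /negbTE uv; under eq_bigr do rewrite uv mulr1; exact: pi_sum1.
by apply: eq_bigr => b _; rewrite eqxx.
Qed.

(** Exchanging the coordinates in [C] between two independent samples is an involution that
    preserves the product weight, so a sample with [C] redrawn keeps its law. *)
Lemma Ex_avg C phi : Ex (avg C phi) = Ex phi.
Proof.
rewrite /avg {1}/Ex.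
transitivity (\sum_(p : {ffun V -> F} * {ffun V -> F}) wt p.1 * wt p.2 * phi (mix C p.2 p.1)).
  rewrite -(pair_bigA _ (fun r s => wt r * wt s * phi (mix C s r))) /=.
  by apply: eq_bigr => r _; rewrite mulr_sumr; apply: eq_bigr => s _; rewrite mulrA.
pose h (p : {ffun V -> F} * {ffun V -> F}) := (mix C p.2 p.1, mix C p.1 p.2).
have hK : cancel h h by case=> r s; rewrite /h /= !mixK.
rewrite (reindex h) /=; last by exists h => p _; exact: hK.
transitivity (\sum_(p : {ffun V -> F} * {ffun V -> F}) wt p.1 * wt p.2 * phi p.1).
  by apply: eq_bigr => -[r s] _ /=; rewrite mixK wt_mix.
rewrite -(pair_bigA _ (fun r s => wt r * wt s * phi r)) /=.
apply: eq_bigr => r _; rewrite -mulr_suml -mulr_sumr wt_sum1 mulr1.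
by [].
Qed.

Lemma avg_mulr C phi f r : indep_of C f ->
  avg C (fun r => phi r * f r) r = avg C phi r * f r.
Proof.
move=> fC; rewrite /avg -ExZr; apply: eq_Ex => s; by rewrite fC.
Qed.

Lemma avg_id C f r : indep_of C f -> avg C f r = f r.
Proof. by move=> fC; rewrite /avg (eq_Ex (fun s => fC s r)) Ex_cst. Qed.

Lemma avg_avg1 (C : {set V}) u phi r : u \in C -> avg C (avg [set u] phi) r = avg C phi r.
Proof.
move=> uC; rewrite {1 3}/avg -(Ex_avg [set u] (fun s => phi (mix C s r))).
apply: eq_Ex => s; apply: eq_Ex => t; congr (phi _); apply/ffunP => v.
by rewrite !ffunE !inE; case: eqP => // ->; rewrite uC.
Qed.

Lemma avgU1 (C : {set V}) u phi r : u \notin C ->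
  avg (u |: C) phi r = avg [set u] (avg C phi) r.
Proof.
move=> uC; rewrite {1}/avg -(Ex_avg [set u]) /avg /Ex.
under eq_bigr do rewrite mulr_sumr.
rewrite exchange_big /=; apply: eq_bigr => t _; rewrite mulr_sumr.
apply: eq_bigr => s _; rewrite mulrCA; congr (_ * (_ * phi _)).
apply/ffunP => v; rewrite !ffunE !inE.
by case: eqP => [->|_] /=; rewrite ?(negbTE uC).
Qed.

End product_expectation.

(** * Harris' inequality for finite product laws *)

Section harris.
Context {R : realFieldType} {V : finType} {N : nat}.
Variable pi : V -> 'I_N -> R.
Hypothesis pi_ge0 : forall v b, 0 <= pi v b.
Hypothesis pi_sum1 : forall v, \sum_b pi v b = 1.

(** Decreasing functions are the relevant class because a node fires when its noise lies below its
    rank ([net_step]). *)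
Definition antitone (phi : {ffun V -> 'I_N} -> R) : Prop :=
  forall r s : {ffun V -> 'I_N}, (forall v, (r v <= s v)%N) -> phi s <= phi r.

(** Symmetrization: twice the covariance is the mean of [(f a - f b) * (g a - g b)] over two
    independent samples, and both factors have the same sign. *)
Lemma chebyshev_sum (p : 'I_N -> R) (f g : 'I_N -> R) :
  (forall b, 0 <= p b) -> \sum_b p b = 1 ->
  (forall a b : 'I_N, (a <= b)%N -> f b <= f a) ->
  (forall a b : 'I_N, (a <= b)%N -> g b <= g a) ->
  (\sum_b p b * f b) * (\sum_b p b * g b) <= \sum_b p b * (f b * g b).
Proof.
move=> p0 p1 mf mg.
have : 0 <= \sum_a \sum_b p a * p b * ((f a - f b) * (g a - g b)).
  apply: sumr_ge0 => a _; apply: sumr_ge0 => b _.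
  apply: mulr_ge0; first exact: mulr_ge0.
  have [ab|/ltnW ba] := leqP a b.
    by apply: mulr_ge0; rewrite subr_ge0 ?mf ?mg.
  by apply: mulr_le0; rewrite subr_le0 ?mf ?mg.
have -> : \sum_a \sum_b p a * p b * ((f a - f b) * (g a - g b))
    = (\sum_b p b * (f b * g b) - (\sum_b p b * f b) * (\sum_b p b * g b)) *+ 2.
  transitivity (\sum_a \sum_b (p a * (f a * g a) * p b + p a * (p b * (f b * g b))
      - (p a * f a) * (p b * g b) - (p a * g a) * (p b * f b))).
    apply: eq_bigr => a _; apply: eq_bigr => b _.
    by ring.
  under eq_bigr do rewrite !big_split /= -!mulr_sumr !sumrN -!mulr_sumr p1 mulr1.
  rewrite !big_split /= -!mulr_suml !sumrN -!mulr_suml p1.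
  by ring.
by rewrite pmulrn_lge0// subr_ge0.
Qed.

Lemma avg1E u (phi : {ffun V -> 'I_N} -> R) r :
  avg pi [set u] phi r = \sum_b pi u b * phi [ffun v => if v == u then b else r v].
Proof.
rewrite -(Ex_marginal pi_sum1 u (fun b => phi [ffun v => if v == u then b else r v])).
apply: eq_Ex => s; congr (phi _); apply/ffunP => v; rewrite !ffunE inE.
by case: eqP => // ->.
Qed.

Lemma antitone_avg C phi : antitone phi -> antitone (avg pi C phi).
Proof.
move=> aphi r s rs; apply: le_Ex => // t; apply: aphi => v.
by rewrite !ffunE; case: ifP.
Qed.

(** Induction on [C]: after one coordinate [u] is split off, the induction hypothesis holds for each
    value of [u], and the conditional means are again antitone, so Chebyshev's inequality handles
    [u]. *)
Lemma harris_avg C phi psi r : antitone phi -> antitone psi ->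
  avg pi C phi r * avg pi C psi r <= avg pi C (fun r => phi r * psi r) r.
Proof.
move=> aphi apsi; have [m] := ubnP #|C|; elim: m C r => // m IH C r ltCm.
have [->|[u uC]] := set_0Vmem C.
  have id0 (f : {ffun V -> 'I_N} -> R) : indep_of (@finset.set0 V) f.
    by move=> s t; congr (f _); apply/ffunP => v; rewrite ffunE finset.in_set0.
  by rewrite !avg_id.
rewrite -(finset.setD1K uC) !avgU1 ?finset.setD11//.
set C' := C :\ u.
have IHC' t : avg pi C' phi t * avg pi C' psi t <= avg pi C' (fun r => phi r * psi r) t.
  by apply: IH; rewrite -ltnS (leq_trans _ ltCm)// ltnS; apply: proper_card; rewrite finset.properD1.
apply: (@le_trans _ _ (avg pi [set u] (fun t => avg pi C' phi t * avg pi C' psi t) r)).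
  rewrite !avg1E; apply: chebyshev_sum => // a b ab.
    apply: antitone_avg => // v; rewrite !ffunE; by case: ifP.
  apply: antitone_avg => // v; rewrite !ffunE; by case: ifP.
by apply: le_Ex.
Qed.

End harris.

(** * Acyclic threshold networks driven by discrete noises *)

Section threshold_network.
Context {V : finType} {N : nat}.
Variables (e : rel V) (rk : V -> {ffun V -> bool} -> nat).
Hypothesis acyc : acyclic e.
Hypothesis rk_local : forall v (x y : {ffun V -> bool}),
  (forall z, e z v -> x z = y z) -> rk v x = rk v y.

Definition net_step (r : {ffun V -> 'I_N}) (x : {ffun V -> bool}) : {ffun V -> bool} :=
  [ffun v => (r v < rk v x)%N].

Definition net (r : {ffun V -> 'I_N}) : {ffun V -> bool} :=
  iter #|V| (net_step r) [ffun=> false].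

(** A topological height: it strictly increases along directed paths, and since a node counts among
    its own ancestors it runs from 1 to [#|V|]. *)
Definition nb_anc (v : V) : nat := #|[pred z | connect e z v]|.

Lemma nb_anc_lt u v : connect e u v -> u != v -> (nb_anc u < nb_anc v)%N.
Proof.
move=> cuv uv; apply: proper_card; apply/fintype.properP; split.
  by apply/fintype.subsetP => z; rewrite !inE => /connect_trans; exact.
exists v; rewrite !inE ?connect0//.
apply/negP => cvu; case/connectP: cuv => [[|w p] /=].
  by move=> _ vu; rewrite vu eqxx in uv.
move=> /andP[euw pw] lst; have /negP := acyc euw; apply.
by rewrite (connect_trans _ cvu)//; apply/connectP; exists p.
Qed.

Lemma nb_anc_edge u v : e u v -> (nb_anc u < nb_anc v)%N.
Proof.
move=> euv; apply: nb_anc_lt; first exact: connect1.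
by apply/eqP => uv; have := acyc euv; rewrite uv connect0.
Qed.

(** Nodes of height at most [k] are final after [k] updates, and no height exceeds [#|V|]. *)
Lemma net_fix r v : net r v = (r v < rk v (net r))%N.
Proof.
pose x k := iter k (net_step r) [ffun=> false].
have stable k u : (nb_anc u <= k)%N -> x k.+1 u = x k u.
  elim: k u => [|k IH] u.
    by rewrite leqn0 => /eqP/card0_eq/(_ u); rewrite !inE connect0.
  move=> uk; rewrite /x [in LHS]iterS [in RHS]iterS !ffunE.
  congr (_ < _)%N; apply: rk_local => z ezu; apply: IH.
  by rewrite -ltnS (leq_trans (nb_anc_edge ezu)).
rewrite -[LHS](stable #|V|) ?max_card//.
by rewrite /x iterS ffunE.
Qed.

Lemma net_ind (Q : V -> Prop) : (forall v, (forall z, e z v -> Q z) -> Q v) ->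
  forall v, Q v.
Proof.
move=> h v; have [n] := ubnP (nb_anc v); elim: n v => // n IH v vn.
by apply: h => z ezv; apply: IH; rewrite (leq_trans (nb_anc_edge ezv)).
Qed.

Lemma net_dep (r r' : {ffun V -> 'I_N}) v : (forall u, connect e u v -> r u = r' u) ->
  net r v = net r' v.
Proof.
elim/net_ind: v => v IH h; rewrite !net_fix h ?connect0//; congr (_ < _)%N.
apply: rk_local => z ezv; apply: IH => // u uz; apply: h.
exact: connect_trans uz (connect1 ezv).
Qed.

Lemma net_indep (C : {set V}) v :
  (forall u, u \in C -> ~~ connect e u v) -> indep_of C (fun r => net r v).
Proof.
move=> h s r; apply: net_dep => u; rewrite ffunE.
by case: ifP => // /h /negbTE ->.
Qed.

Lemma net_antitone : (forall v (x y : {ffun V -> bool}), (forall z, x z ==> y z) ->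
    (rk v x <= rk v y)%N) ->
  forall r s : {ffun V -> 'I_N}, (forall v, (r v <= s v)%N) ->
  forall v, net s v ==> net r v.
Proof.
move=> rkm r s rs; elim/net_ind => v IH; apply/implyP; rewrite !net_fix => h.
apply: leq_ltn_trans (rs v) (leq_trans h _).
(* The induction hypothesis speaks only of the parents of [v]; the other coordinates are masked by
   locality before monotonicity is used. *)
rewrite (@rk_local v (net s) [ffun z => net s z && e z v]); last first.
  by move=> z ezv; rewrite ffunE ezv andbT.
apply: rkm => z; rewrite ffunE; apply/implyP => /andP[sz ezv].
by have /implyP := IH z ezv; apply.
Qed.

End threshold_network.

(** * Redrawing the noise of a single node *)

Section network_expectation.
Context {R : realFieldType} {V : finType} {N : nat}.
Variables (e : rel V) (rk : V -> {ffun V -> bool} -> nat) (pi : V -> 'I_N -> R).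
Hypothesis acyc : acyclic e.
Hypothesis rk_local : forall v (x y : {ffun V -> bool}),
  (forall z, e z v -> x z = y z) -> rk v x = rk v y.
Hypothesis pi_ge0 : forall v b, 0 <= pi v b.
Hypothesis pi_sum1 : forall v, \sum_b pi v b = 1.
Local Notation net := (net rk).

Definition kernel (v : V) (x : {ffun V -> bool}) : R :=
  \sum_b pi v b * (b < rk v x)%N%:R.

Lemma kernel_ge0 v x : 0 <= kernel v x.
Proof. by apply: sumr_ge0 => b _; rewrite mulr_ge0. Qed.

Lemma kernel_le1 v x : kernel v x <= 1.
Proof.
by rewrite -(pi_sum1 v); apply: ler_sum => b _; rewrite ler_piMr//; case: (_ < _)%N.
Qed.

(** By acyclicity the noise of [v] does not reach its parents, so redrawing it alone leaves their
    values in place. *)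
Lemma avg1_net v r : avg pi [set v] (fun r => (net r v)%:R) r = kernel v (net r).
Proof.
rewrite /avg /kernel -(Ex_marginal pi_sum1); apply: eq_Ex => s.
rewrite (net_fix acyc rk_local) ffunE finset.in_set1 eqxx; congr ((_ < _)%N%:R).
apply: rk_local => z ezv; apply: (net_dep acyc rk_local) => u uz; rewrite ffunE finset.in_set1.
by case: eqP => // uv; have := acyc ezv; rewrite -uv uz.
Qed.

Lemma Ex_net_kernel v (f : {ffun V -> 'I_N} -> R) : indep_of [set v] f ->
  Ex pi (fun r => (net r v)%:R * f r) = Ex pi (fun r => kernel v (net r) * f r).
Proof.
move=> fv; rewrite -(Ex_avg pi_sum1 [set v]); apply: eq_Ex => r.
by rewrite avg_mulr// avg1_net.
Qed.

Lemma avg_net_kernel (C : {set V}) v r : v \in C ->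
  avg pi C (fun r => (net r v)%:R) r = avg pi C (fun r => kernel v (net r)) r.
Proof.
move=> vC; rewrite -(avg_avg1 pi_sum1 _ _ vC); apply: eq_Ex => s; exact: avg1_net.
Qed.

End network_expectation.

(** * Comparison of two networks by a potential *)

Section max_increments.
Context {R : realFieldType}.
Implicit Types a z t : R.

Lemma le_max_shift a z t : 0 <= t -> Num.max a z <= Num.max a (z + t).
Proof. by move=> t0; case: (leP a z); case: (leP a (z + t)); lra. Qed.

Lemma max_shift_le a z t : 0 <= t -> Num.max a (z + t) - Num.max a z <= t.
Proof. by move=> t0; case: (leP a z); case: (leP a (z + t)); lra. Qed.

Lemma max_shift_convex a z z' t : z <= z' -> 0 <= t ->
  Num.max a (z + t) - Num.max a z <= Num.max a (z' + t) - Num.max a z'.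
Proof.
move=> zz t0; case: (leP a z); case: (leP a (z + t)); case: (leP a z');
  case: (leP a (z' + t)); lra.
Qed.

(** Turns the excess over 1 into a maximum with a constant, the form covered by
    [max_shift_convex]. *)
Lemma max0_maxB1 a z : Num.max 0 (Num.max a z - 1) = Num.max (Num.max 1 a) z - 1.
Proof.
rewrite -maxA; have [h|/ltW h] := leP 1 (Num.max a z); first by rewrite max_r ?subr_ge0.
by rewrite max_l ?subrr// subr_le0.
Qed.

Lemma le_min1 z z' : z <= z' -> Num.min 1 z <= Num.min 1 z'.
Proof. by move=> zz; rewrite le_min ge_min lexx /= ge_min zz orbT. Qed.

End max_increments.

(** * Potentials and the elimination of one coordinate *)

Section potential.
Context {R : realFieldType} {I : finType}.
Implicit Types (x y d c : I -> R) (Phi : (I -> R) -> R).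

Definition setc x (k : I) (a : R) : I -> R := fun i => if i == k then a else x i.

(* By [pot_convex] the gain of raising one coordinate is itself increasing,
   as Harris' inequality requires; by [pot_lower] a coordinate of slope above
   1 makes [Phi] exceed 1 as soon as it is set. *)
Record potential (A : {set I}) c Phi : Prop := {
  pot_local : forall x y, (forall i, i \in A -> x i = y i) -> Phi x = Phi y;
  pot_ge0 : forall x d, (forall i, 0 <= x i) -> (forall i, 0 <= d i) ->
    Phi x <= Phi (fun i => x i + d i);
  pot_convex : forall x y d, (forall i, 0 <= x i <= y i) -> (forall i, 0 <= d i) ->
    Phi (fun i => x i + d i) - Phi x <= Phi (fun i => y i + d i) - Phi y;
  pot_lip : forall x d, (forall i, 0 <= x i) -> (forall i, 0 <= d i) ->
    Phi (fun i => x i + d i) - Phi x <= \sum_i c i * d i;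
  pot_lower : forall x, (forall i, 0 <= x i) -> \sum_i c i * x i <= Phi x;
  pot_coef_ge0 : forall i, 0 <= c i }.

Lemma pot_ext A c Phi x y : potential A c Phi -> x =1 y -> Phi x = Phi y.
Proof. by move=> h xy; apply: (pot_local h) => i _. Qed.

Lemma pot_mono A c Phi x y : potential A c Phi -> (forall i, 0 <= x i <= y i) ->
  Phi x <= Phi y.
Proof.
move=> h xy.
have -> : Phi y = Phi (fun i => x i + (y i - x i)).
  by apply: pot_ext h _ => i; rewrite addrC subrK.
by apply: (pot_ge0 h) => i; have /andP[? ?] := xy i; rewrite // subr_ge0.
Qed.

Lemma setcD x d k a : (fun i => setc x k a i + setc d k 0 i) =1 setc (fun i => x i + d i) k a.
Proof. by move=> i; rewrite /setc; case: eqP; rewrite ?addr0. Qed.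

Lemma sum_setc0 c d k :
  \sum_i c i * setc d k 0 i = \sum_i setc c k 0 i * d i.
Proof.
by apply: eq_bigr => i _; rewrite /setc; case: eqP => _; rewrite ?mulr0 ?mul0r.
Qed.

Lemma sum_setc c x k a :
  \sum_i c i * setc x k a i = \sum_i setc c k 0 i * x i + c k * a.
Proof.
rewrite (bigD1 k)//= [in RHS](bigD1 k)//= /setc eqxx mul0r add0r addrC; congr (_ + _).
by apply: eq_bigr => i /negbTE->.
Qed.

Lemma setc_ge0 x k a : (forall i, 0 <= x i) -> 0 <= a -> forall i, 0 <= setc x k a i.
Proof. by move=> x0 a0 i; rewrite /setc; case: ifP. Qed.

Section substitution.
Variables (A : {set I}) (c : I -> R) (Phi : (I -> R) -> R) (k : I).
Hypothesis potP : potential A c Phi.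

Lemma pot_setc_local a x y : (forall i, i \in A :\ k -> x i = y i) ->
  Phi (setc x k a) = Phi (setc y k a).
Proof.
move=> xy; apply: (pot_local potP) => i iA; rewrite /setc.
by case: eqP => // /eqP ik; apply: xy; rewrite finset.in_setD1 ik.
Qed.

Lemma pot_setc_incr a x d : 0 <= a -> (forall i, 0 <= x i) -> (forall i, 0 <= d i) ->
  Phi (setc x k a) <= Phi (setc (fun i => x i + d i) k a).
Proof.
move=> a0 x0 d0; rewrite -(pot_ext potP (setcD x d k a)).
by apply: (pot_ge0 potP); apply: setc_ge0.
Qed.

Lemma pot_setc_convex a x y d : 0 <= a -> (forall i, 0 <= x i <= y i) -> (forall i, 0 <= d i) ->
  Phi (setc (fun i => x i + d i) k a) - Phi (setc x k a)
  <= Phi (setc (fun i => y i + d i) k a) - Phi (setc y k a).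
Proof.
move=> a0 xy d0; rewrite -!(pot_ext potP (setcD _ d k a)).
apply: (pot_convex potP); last exact: setc_ge0.
by move=> i; rewrite /setc; case: ifP => // _; rewrite a0 lexx.
Qed.

Lemma pot_setc_lip a x d : 0 <= a -> (forall i, 0 <= x i) -> (forall i, 0 <= d i) ->
  Phi (setc (fun i => x i + d i) k a) - Phi (setc x k a) <= \sum_i setc c k 0 i * d i.
Proof.
move=> a0 x0 d0; rewrite -(pot_ext potP (setcD _ d k a)) -sum_setc0.
by apply: (pot_lip potP); apply: setc_ge0.
Qed.

Lemma pot_setc_lower a x : 0 <= a -> (forall i, 0 <= x i) ->
  \sum_i setc c k 0 i * x i + c k * a <= Phi (setc x k a).
Proof.
by move=> a0 x0; rewrite -sum_setc; apply: (pot_lower potP); exact: setc_ge0.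
Qed.

Lemma potential_forced : potential (A :\ k) (setc c k 0) (fun x => Phi (setc x k 1)).
Proof.
split.
- by move=> x y; exact: pot_setc_local.
- by move=> x d x0 d0; apply: pot_setc_incr.
- by move=> x y d xy d0; apply: pot_setc_convex.
- by move=> x d x0 d0; apply: pot_setc_lip.
- move=> x x0; apply: le_trans (pot_setc_lower ler01 x0).
  by rewrite lerDl mulr1 (pot_coef_ge0 potP).
- by apply: setc_ge0 => //; exact: pot_coef_ge0 potP.
Qed.

Definition gain x := Phi (setc x k 1) - Phi (setc x k 0).

Let unit_k : I -> R := setc (fun=> 0) k 1.

Let gainE x : gain x = Phi (fun i => setc x k 0 i + unit_k i) - Phi (setc x k 0).
Proof.
rewrite /gain; congr (_ - _); apply: pot_ext potP _ => i.
by rewrite /unit_k /setc; case: eqP => _; rewrite ?add0r ?addr0.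
Qed.

Let unit_k_ge0 i : 0 <= unit_k i.
Proof. by apply: setc_ge0 => // ?. Qed.

Lemma gain_mono x y : (forall i, 0 <= x i <= y i) -> gain x <= gain y.
Proof.
move=> xy; rewrite !gainE; apply: (pot_convex potP) => // i.
by rewrite /setc; case: ifP => //; rewrite lexx.
Qed.

Lemma gain_ge0 x : (forall i, 0 <= x i) -> 0 <= gain x.
Proof. by move=> x0; rewrite gainE subr_ge0; apply: (pot_ge0 potP) => //; exact: setc_ge0. Qed.

Lemma gain_le x : (forall i, 0 <= x i) -> gain x <= c k.
Proof.
move=> x0; rewrite gainE; apply: le_trans (pot_lip potP _ _) _ => //; first exact: setc_ge0.
by rewrite /unit_k sum_setc mulr1 big1 ?add0r// => i _; rewrite mulr0.
Qed.

Variables (a b : R) (th : I -> R).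
Hypothesis b_ge0 : 0 <= b.
Hypothesis th_ge0 : forall i, 0 <= th i.
Hypothesis th_local : forall i, i \notin A :\ k -> th i = 0.

(** An upper bound for a firing probability: [a] will be the base rate of node [k] in the true
    model, and the sum its predictor under candidate weights (see [kernel'_le]). *)
Definition upper_pred x := Num.max a (b + \sum_i th i * x i).

(* [Phi] averaged over the value of coordinate [k], extended beyond
   probability 1 with the largest admissible slope. *)
Definition averaged x := Phi (setc x k 0) + gain x * Num.min 1 (upper_pred x)
  + c k * Num.max 0 (upper_pred x - 1).

(** The factor [Num.min 1] alone has decreasing slope at 1 and would destroy [pot_convex]. Beyond 1
    the excess is given slope [c k], which is at least [gain], so the slope in the firing
    probability never drops. *)
Lemma potential_averaged :
  potential (A :\ k) (fun i => setc c k 0 i + c k * th i) averaged.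
Proof.
have ck0 := pot_coef_ge0 potP k.
have sumD x d : \sum_i th i * (x i + d i) = \sum_i th i * x i + \sum_i th i * d i.
  by rewrite -big_split; apply: eq_bigr => i _; rewrite mulrDr.
have sum_ge0 d : (forall i, 0 <= d i) -> 0 <= \sum_i th i * d i.
  by move=> d0; apply: sumr_ge0 => i _; rewrite mulr_ge0.
have sum_le x y : (forall i, 0 <= x i <= y i) -> \sum_i th i * x i <= \sum_i th i * y i.
  by move=> xy; apply: ler_sum => i _; rewrite ler_wpM2l//; have /andP[] := xy i.
(* The increment splits into the changes of [Phi] at both values of coordinate [k], averaged with
   the new probability, the old gain times the change of probability, and [c k] times the change of
   the excess. *)
have incr x d : (forall i, 0 <= x i) -> (forall i, 0 <= d i) ->
   averaged (fun i => x i + d i) - averaged x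
   = (Phi (setc (fun i => x i + d i) k 0) - Phi (setc x k 0))
        * (1 - Num.min 1 (upper_pred (fun i => x i + d i)))
     + (Phi (setc (fun i => x i + d i) k 1) - Phi (setc x k 1))
        * Num.min 1 (upper_pred (fun i => x i + d i))
     + gain x * (Num.min 1 (upper_pred (fun i => x i + d i)) - Num.min 1 (upper_pred x))
     + c k * (Num.max 0 (upper_pred (fun i => x i + d i) - 1) - Num.max 0 (upper_pred x - 1)).
  by move=> x0 d0; rewrite /averaged /gain; ring.
have u01 x : (forall i, 0 <= x i) -> 0 <= Num.min 1 (upper_pred x) <= 1.
  move=> x0; rewrite ge_min lexx /= andbT le_min ler01 /= le_max addr_ge0 ?orbT//.
  exact: sum_ge0.
have uv x : Num.min 1 (upper_pred x) + Num.max 0 (upper_pred x - 1) = upper_pred x.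
  move: (upper_pred x) => q; have [q1|q1] := leP q 1.
    by rewrite max_l ?addr0// subr_le0.
  by rewrite max_r ?subr_ge0 ?(ltW q1)//; ring.
have addx0 x d : (forall i, 0 <= x i) -> (forall i, 0 <= d i) -> forall i, 0 <= x i + d i.
  by move=> x0 d0 i; rewrite addr_ge0.
have dq x d : (forall i, 0 <= x i) -> (forall i, 0 <= d i) ->
   [/\ Num.min 1 (upper_pred x) <= Num.min 1 (upper_pred (fun i => x i + d i)),
       Num.max 0 (upper_pred x - 1) <= Num.max 0 (upper_pred (fun i => x i + d i) - 1) &
       upper_pred (fun i => x i + d i) - upper_pred x <= \sum_i th i * d i].
  move=> x0 d0; rewrite /upper_pred sumD !max0_maxB1 addrA; have t0 := sum_ge0 d d0.
  split; [exact/le_min1/le_max_shift|rewrite lerD2r; exact: le_max_shift|exact: max_shift_le].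
have dqc x y d : (forall i, 0 <= x i <= y i) -> (forall i, 0 <= d i) ->
   upper_pred (fun i => x i + d i) - upper_pred x
     <= upper_pred (fun i => y i + d i) - upper_pred y /\
   Num.max 0 (upper_pred (fun i => x i + d i) - 1) - Num.max 0 (upper_pred x - 1)
     <= Num.max 0 (upper_pred (fun i => y i + d i) - 1) - Num.max 0 (upper_pred y - 1).
  move=> xy d0; rewrite /upper_pred !sumD !max0_maxB1 !addrA.
  have t0 := sum_ge0 d d0; have st := sum_le x y xy.
  have conv a' := @max_shift_convex _ a' (b + \sum_i th i * x i) (b + \sum_i th i * y i)
    (\sum_i th i * d i).
  split; first by apply: conv => //; rewrite lerD2l.
  rewrite !opprB !addrA !subrK; apply: conv => //; by rewrite lerD2l.
split.
- move=> x y xy; rewrite /averaged /gain /upper_pred.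
  have -> : \sum_i th i * x i = \sum_i th i * y i.
    apply: eq_bigr => i _; have [iA|iA] := boolP (i \in A :\ k); first by rewrite xy.
    by rewrite th_local// !mul0r.
  by rewrite !(pot_setc_local _ xy).
- move=> x d x0 d0; rewrite -subr_ge0 incr//.
  have /andP[u0 u1] := u01 _ (addx0 x d x0 d0); have [h1 h2 _] := dq x d x0 d0.
  apply: addr_ge0; [apply: addr_ge0; [apply: addr_ge0|]|]; apply: mulr_ge0; rewrite ?subr_ge0//.
  - exact: pot_setc_incr.
  - exact: pot_setc_incr.
  - by rewrite -subr_ge0; exact: gain_ge0.
- move=> x y d xy d0.
  have x0 i : 0 <= x i by have /andP[] := xy i.
  have y0 i : 0 <= y i by have /andP[xi xyi] := xy i; exact: le_trans xyi.
  rewrite !incr//.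
  have /andP[ux0 ux1] := u01 _ (addx0 x d x0 d0).
  have /andP[uy0 uy1] := u01 _ (addx0 y d y0 d0).
  have uxy : Num.min 1 (upper_pred (fun i => x i + d i))
      <= Num.min 1 (upper_pred (fun i => y i + d i)).
    have [+ _ _] := dq (fun i => x i + d i) (fun i => y i - x i) (addx0 _ _ x0 d0)
       (fun i => ltac:(by have /andP[? ?] := xy i; rewrite subr_ge0)).
    congr (_ <= Num.min 1 (Num.max a (b + _))).
    by apply: eq_bigr => i _; congr (_ * _); ring.
  have [hq hv] := dqc x y d xy d0.
  have [dux dvx _] := dq x d x0 d0; have [duy dvy _] := dq y d y0 d0.
  have D0 := pot_setc_convex (lexx 0) xy d0.
  have D1 := pot_setc_convex ler01 xy d0.
  have D01 : Phi (setc (fun i => y i + d i) k 0) - Phi (setc y k 0)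
     <= Phi (setc (fun i => y i + d i) k 1) - Phi (setc y k 1).
    have : gain y <= gain (fun i => y i + d i).
      by apply: gain_mono => i; rewrite y0 lerDl d0.
    by rewrite /gain; lra.
  have gx0 := gain_ge0 x0; have gxy := gain_mono xy; have gyc := gain_le y0.
  rewrite -!addrA; rewrite [leLHS]addrA [leRHS]addrA.
  apply: lerD.
    (* Two moves: from [x] to [y] at the same probability, then a raise of the probability, which
       can only help because the increment is larger when coordinate [k] is 1 ([D01]). *)
    apply: (@le_trans _ _ ((Phi (setc (fun i => y i + d i) k 0) - Phi (setc y k 0))
        * (1 - Num.min 1 (upper_pred (fun i => x i + d i)))
     + (Phi (setc (fun i => y i + d i) k 1) - Phi (setc y k 1))
        * Num.min 1 (upper_pred (fun i => x i + d i)))).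
      by apply: lerD; rewrite ler_wpM2r// subr_ge0.
    set w := Num.min 1 (upper_pred (fun i => x i + d i)) in uxy *.
    set w' := Num.min 1 (upper_pred (fun i => y i + d i)) in uxy *.
    have : 0 <= (w' - w) * ((Phi (setc (fun i => y i + d i) k 1) - Phi (setc y k 1))
        - (Phi (setc (fun i => y i + d i) k 0) - Phi (setc y k 0))).
      by rewrite mulr_ge0// subr_ge0.
    lra.
  have {}hq : Num.min 1 (upper_pred (fun i => x i + d i)) + Num.max 0 (upper_pred (fun i => x i + d i) - 1)
      - (Num.min 1 (upper_pred x) + Num.max 0 (upper_pred x - 1))
    <= Num.min 1 (upper_pred (fun i => y i + d i)) + Num.max 0 (upper_pred (fun i => y i + d i) - 1)
      - (Num.min 1 (upper_pred y) + Num.max 0 (upper_pred y - 1)) by rewrite !uv.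
  move: (gain x) (gain y) gx0 gxy gyc => gx gy gx0 gxy gyc.
  set ux := Num.min 1 (upper_pred x) in hq dux *.
  set uy := Num.min 1 (upper_pred y) in hq duy *.
  set ux' := Num.min 1 (upper_pred (fun i => x i + d i)) in hq dux *.
  set uy' := Num.min 1 (upper_pred (fun i => y i + d i)) in hq duy *.
  set vx := Num.max 0 (upper_pred x - 1) in hq hv *.
  set vy := Num.max 0 (upper_pred y - 1) in hq hv *.
  set vx' := Num.max 0 (upper_pred (fun i => x i + d i) - 1) in hq hv *.
  set vy' := Num.max 0 (upper_pred (fun i => y i + d i) - 1) in hq hv *.
  (* The remaining difference is a sum of three nonnegative products: convexity of the predictor
     weighted by [gx], convexity of the excess weighted by [c k - gx], and the growth of the
     gain. *)
  have P1 : 0 <= gx * ((uy' + vy' - (uy + vy)) - (ux' + vx' - (ux + vx))).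
    by rewrite mulr_ge0// subr_ge0.
  have P2 : 0 <= (c k - gx) * ((vy' - vy) - (vx' - vx)).
    by rewrite mulr_ge0// subr_ge0// (le_trans gxy).
  have P3 : 0 <= (gy - gx) * (uy' - uy) by rewrite mulr_ge0// subr_ge0.
  rewrite -subr_ge0.
  have -> : gy * (uy' - uy) + c k * (vy' - vy) - (gx * (ux' - ux) + c k * (vx' - vx))
    = gx * ((uy' + vy' - (uy + vy)) - (ux' + vx' - (ux + vx)))
      + (c k - gx) * ((vy' - vy) - (vx' - vx)) + (gy - gx) * (uy' - uy) by ring.
  by rewrite !addr_ge0.
- move=> x d x0 d0; rewrite incr//.
  have /andP[u0 u1] := u01 _ (addx0 x d x0 d0); have [dux dvx dqx] := dq x d x0 d0.
  have D0 := pot_setc_lip (lexx 0) x0 d0; have D1 := pot_setc_lip ler01 x0 d0.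
  have -> : \sum_i (setc c k 0 i + c k * th i) * d i
      = \sum_i setc c k 0 i * d i + c k * \sum_i th i * d i.
    by rewrite mulr_sumr -big_split; apply: eq_bigr => i _; rewrite mulrDl mulrA.
  rewrite -[leLHS]addrA; apply: lerD.
    set u := Num.min 1 _ in u0 u1 *; set s := \sum_i _ in D0 D1 *.
    rewrite (_ : s = s * (1 - u) + s * u); last by ring.
    by apply: lerD; rewrite ler_wpM2r// subr_ge0.
  apply: le_trans (ler_wpM2l ck0 dqx).
  have -> : upper_pred (fun i => x i + d i) - upper_pred x
    = Num.min 1 (upper_pred (fun i => x i + d i)) + Num.max 0 (upper_pred (fun i => x i + d i) - 1)
      - (Num.min 1 (upper_pred x) + Num.max 0 (upper_pred x - 1)) by rewrite !uv.
  rewrite (_ : c k * (_ + _ - _) = c k * (Num.min 1 (upper_pred (fun i => x i + d i)) - Num.min 1 (upper_pred x))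
     + c k * (Num.max 0 (upper_pred (fun i => x i + d i) - 1) - Num.max 0 (upper_pred x - 1))); last by ring.
  by rewrite lerD2r ler_wpM2r ?subr_ge0// gain_le.
- move=> x x0.
  have -> : \sum_i (setc c k 0 i + c k * th i) * x i
      = \sum_i setc c k 0 i * x i + c k * \sum_i th i * x i.
    by rewrite mulr_sumr -big_split; apply: eq_bigr => i _; rewrite mulrDl mulrA.
  have /andP[u0 u1] := u01 _ x0.
  have L0 := pot_setc_lower (lexx 0) x0; have L1 := pot_setc_lower ler01 x0.
  rewrite mulr0 addr0 in L0; rewrite mulr1 in L1.
  have qs : \sum_i th i * x i <= Num.min 1 (upper_pred x) + Num.max 0 (upper_pred x - 1).
    by rewrite uv /upper_pred le_max lerDr b_ge0 orbT.
  apply: le_trans (lerD (lexx _) (ler_wpM2l ck0 qs)) _.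
  rewrite /averaged /gain.
  set u := Num.min 1 _ in u0 u1 *; set s := \sum_i _ in L0 L1 *.
  have P0 : s * (1 - u) <= Phi (setc x k 0) * (1 - u) by rewrite ler_wpM2r// subr_ge0.
  have P1 : (s + c k) * u <= Phi (setc x k 1) * u by rewrite ler_wpM2r.
  rewrite mulrDr addrA lerD2r.
  rewrite (_ : s + c k * u = s * (1 - u) + (s + c k) * u); last by ring.
  apply: le_trans (lerD P0 P1) _; rewrite le_eqVlt; apply/orP; left; apply/eqP; ring.
- by move=> i; rewrite addr_ge0 ?mulr_ge0// setc_ge0//; exact: pot_coef_ge0 potP.
Qed.
End substitution.
End potential.

(** * Bringing the slopes of a potential back to at most 1 *)

Section capping.
Context {R : realFieldType} {I : finType}.
Variables (A : {set I}) (c : I -> R) (Phi : (I -> R) -> R).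
Hypothesis potP : potential A c Phi.

(* Rescaling makes the slopes at most 1 again, at no cost for [Num.min 1 Phi]
   on 0-1 vectors: if a rescaled coordinate is 1 then both sides reach 1. *)
Definition cap_scale (i : I) : R := if 1 < c i then (c i)^-1 else 1.

Definition capped (x : I -> R) : R := Phi (fun i => cap_scale i * x i).

Lemma cap_scale_ge0 i : 0 <= cap_scale i.
Proof. by rewrite /cap_scale; case: ifP => // h; rewrite invr_ge0 (pot_coef_ge0 potP). Qed.

Lemma cap_scale_le1 i : cap_scale i <= 1.
Proof.
rewrite /cap_scale; case: ifP => // h; rewrite invf_le1 ?(ltW h)//.
exact: lt_trans h.
Qed.

Lemma cap_coef_le1 i : c i * cap_scale i <= 1.
Proof.
rewrite /cap_scale; case: ifPn => [h|]; last by rewrite -leNgt mulr1.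
by rewrite divff// gt_eqF// (lt_trans _ h).
Qed.

Lemma potential_capped : potential A (fun i => c i * cap_scale i) capped.
Proof.
have scale_ge0 (x : I -> R) : (forall i, 0 <= x i) -> forall i, 0 <= cap_scale i * x i.
  by move=> x0 i; rewrite mulr_ge0 ?cap_scale_ge0.
have scaleD (x d : I -> R) :
    capped (fun i => x i + d i) = Phi (fun i => cap_scale i * x i + cap_scale i * d i).
  by apply: pot_ext potP _ => i; rewrite mulrDr.
split.
- by move=> x y xy; apply: (pot_local potP) => i iA; rewrite xy.
- by move=> x d x0 d0; rewrite scaleD; apply: (pot_ge0 potP); exact: scale_ge0.
- move=> x y d xy d0; rewrite !scaleD; apply: (pot_convex potP); last exact: scale_ge0.
  by move=> i; have /andP[? ?] := xy i; rewrite mulr_ge0 ?ler_wpM2l ?cap_scale_ge0.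
- move=> x d x0 d0; rewrite scaleD.
  under eq_bigr do rewrite -mulrA.
  by apply: (pot_lip potP); exact: scale_ge0.
- move=> x x0; under eq_bigr do rewrite -mulrA.
  by apply: (pot_lower potP); exact: scale_ge0.
- by move=> i; rewrite mulr_ge0 ?cap_scale_ge0// (pot_coef_ge0 potP).
Qed.

Lemma capped_le x : (forall i, 0 <= x i) -> capped x <= Phi x.
Proof.
move=> x0; apply: (pot_mono potP) => i.
by rewrite mulr_ge0 ?cap_scale_ge0//= ler_piMl// cap_scale_le1.
Qed.

Lemma min1_capped (x : {ffun I -> bool}) :
  Num.min 1 (Phi (fun i => (x i)%:R)) <= Num.min 1 (capped (fun i => (x i)%:R)).
Proof.
have [/existsP[j /andP[cj xj]]|/existsPn h] := boolP [exists j, (1 < c j) && x j].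
  rewrite [leRHS]min_l ?ge_min ?lexx//.
  have x0 i : (0 : R) <= (x i)%:R by [].
  apply: le_trans (pot_lower potP _); last by move=> i; rewrite mulr_ge0 ?cap_scale_ge0.
  rewrite (bigD1 j)//= xj mulr1 /cap_scale cj divff ?gt_eqF ?(lt_trans _ cj)//.
  rewrite lerDl; apply: sumr_ge0 => i _.
  by rewrite mulr_ge0 ?(pot_coef_ge0 potP)// mulr_ge0// cap_scale_ge0.
apply/le_min1; rewrite le_eqVlt; apply/orP; left; apply/eqP.
apply: pot_ext potP _ => i; rewrite /cap_scale; have := h i.
by case: (1 < c i); case: (x i); rewrite ?mul1r ?mulr0.
Qed.

End capping.

(** * The law [nu] of the true model against the law [mu] of the candidate network *)

Section comparison.
Context {R : realFieldType} {I : finType}.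
Local Notation config := {ffun I -> bool}.

Definition Epmf (nu : config -> R) (f : config -> R) : R := \sum_x nu x * f x.

Lemma le_Epmf nu f g : (forall x, 0 <= nu x) ->
  (forall x, nu x != 0 -> f x <= g x) -> Epmf nu f <= Epmf nu g.
Proof.
move=> nu0 fg; apply: ler_sum => x _.
have [->|nx] := eqVneq (nu x) 0; first by rewrite !mul0r.
by rewrite ler_wpM2l// fg.
Qed.

Lemma EpmfD nu f g : Epmf nu (fun x => f x + g x) = Epmf nu f + Epmf nu g.
Proof. by rewrite /Epmf -big_split; apply: eq_bigr => x _; rewrite mulrDr. Qed.

Lemma eq_Epmf nu f g : (forall x, nu x != 0 -> f x = g x) -> Epmf nu f = Epmf nu g.
Proof.
move=> fg; apply: eq_bigr => x _.
by have [->|nx] := eqVneq (nu x) 0; rewrite ?mul0r// fg.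
Qed.

Lemma Epmf_cst nu c : \sum_x nu x = 1 -> Epmf nu (fun=> c) = c.
Proof. by move=> h; rewrite /Epmf -mulr_suml h mul1r. Qed.

Variables (e : rel I) (S : {set I}) (nu mu : config -> R).
Variables (p : I -> config -> R) (a b : I -> R) (ths th : I -> I -> R).
Hypothesis acyc : acyclic e.
Hypothesis nu_ge0 : forall x, 0 <= nu x.
Hypothesis mu_ge0 : forall x, 0 <= mu x.
Hypothesis nu_sum1 : \sum_x nu x = 1.
Hypothesis mu_sum1 : \sum_x mu x = 1.
Hypothesis nu_S : forall x k, nu x != 0 -> k \in S -> x k.
Hypothesis mu_S : forall x k, mu x != 0 -> k \in S -> x k.
Hypothesis a_ge0 : forall k, 0 <= a k.
Hypothesis b_ge0 : forall k, 0 <= b k.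
Hypothesis th_ge0 : forall k i, 0 <= th k i.
Hypothesis ths_ge0 : forall k i, 0 <= ths k i.
Hypothesis th_edge : forall k i, ~~ e i k -> th k i = 0.
Hypothesis p01 : forall k x, 0 <= p k x <= 1.

Let pth k (x : config) := b k + \sum_i th k i * (x i)%:R.
Let pstar k (x : config) := a k + \sum_i ths k i * (x i)%:R.

Hypothesis p_le : forall k x, k \notin S -> p k x <= Num.max (a k) (pth k x).
Hypothesis pstar_le1 : forall k x, pstar k x <= 1.
Hypothesis nu_incr : forall k (g : config -> R), k \notin S ->
  (forall x y : config, (forall i, x i ==> y i) -> g x <= g y) ->
  Epmf nu (fun x => pstar k x * g x) <= Epmf nu (fun x => (x k)%:R * g x).
Hypothesis mu_markov : forall k (A : {set I}) (f : config -> R), k \notin S ->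
  (forall j, j \in A -> ~~ connect e k j) ->
  (forall x y : config, (forall i, i \in A -> x i = y i) -> f x = f y) ->
  Epmf mu (fun x => (x k)%:R * f x) = Epmf mu (fun x => p k x * f x).

Let vec (x : config) : I -> R := fun i => (x i)%:R.

Let vec_ge0 x i : 0 <= vec x i. Proof. by rewrite /vec. Qed.

Lemma vec_split A c Phi k (x : config) : potential A c Phi ->
  Phi (vec x) = Phi (setc (vec x) k 0) + (x k)%:R * gain Phi k (vec x).
Proof.
move=> potP; rewrite /gain.
have -> : Phi (vec x) = Phi (setc (vec x) k (x k)%:R).
  by apply: pot_ext potP _ => i; rewrite /setc; case: eqP => // ->.
by case: (x k); rewrite ?mul0r ?mul1r ?addr0// addrC subrK.
Qed.

(* The coordinates of [A] are eliminated one by one, each time one that is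
   not an ancestor of the others; the value of [Phi] at each step dominates its
   expectation under [mu] and pays for the passage from [pstar] to [pth]. *)
Lemma potential_bound A c Phi : potential A c Phi -> (forall i, c i <= 1) ->
  (forall k i, k \in A -> e i k -> i \in A) ->
  Epmf mu (fun x => Num.min 1 (Phi (vec x)))
  <= Epmf nu (fun x => Phi (vec x))
     + \sum_(k in A | k \notin S) Epmf nu (fun x => `|pth k x - pstar k x|).
Proof.
have [n] := ubnP #|A|; elim: n A c Phi => // n IH A c Phi ltAn potP c1 closedA.
have [A0|[k0 k0A]] := set_0Vmem A.
  have PhiE x : Phi (vec x) = Phi (fun=> 0).
    by apply: (pot_local potP) => i; rewrite A0 finset.in_set0.
  rewrite big_pred0 ?addr0; last by move=> k; rewrite A0 finset.in_set0.
  rewrite (@eq_Epmf mu _ (fun=> Num.min 1 (Phi (fun=> 0)))) => [|x _]; last by rewrite PhiE.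
  rewrite (@eq_Epmf nu _ (fun=> Phi (fun=> 0))) => [|x _]; last by rewrite PhiE.
  by rewrite !Epmf_cst// ge_min lexx orbT.
(* A node with the most ancestors in [A] cannot be a proper ancestor of another node of [A]. *)
pose k := [arg max_(k > k0 | k \in A) nb_anc e k]%N.
have [kA kmax] : k \in A /\ forall j, j \in A -> (nb_anc e j <= nb_anc e k)%N.
  by rewrite /k; case: arg_maxnP.
have k_last j : j \in A -> j != k -> ~~ connect e k j.
  move=> jA jk; apply/negP => kj; have := kmax j jA.
  by rewrite leqNgt (nb_anc_lt acyc kj)// eq_sym.
have closedA' j i : j \in A :\ k -> e i j -> i \in A :\ k.
  rewrite !finset.in_setD1 => /andP[jk jA] ij; rewrite (closedA _ _ jA ij) andbT.
  apply/eqP => ik; have /negP := k_last j jA jk; apply.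
  by rewrite -ik; exact: connect1.
have ltA'n : (#|A :\ k| < n)%N.
  by rewrite -ltnS (leq_trans _ ltAn)// ltnS; apply: proper_card; rewrite finset.properD1.
have sumE F : \sum_(j in A | j \notin S) F j
    = (if k \in S then 0 else F k) + \sum_(j in A :\ k | j \notin S) F j :> R.
  have [kS|kS] := boolP (k \in S).
    rewrite add0r; apply: eq_bigl => j; rewrite finset.in_setD1.
    by case: eqP => // ->; rewrite kS !andbF.
  rewrite (bigD1 k) ?kA//=; congr (_ + _); apply: eq_bigl => j.
  by rewrite finset.in_setD1; case: (j == k); case: (j \in A); case: (j \in S).
rewrite sumE; have [kS|kS] := boolP (k \in S).
  have forced (x : config) : x k -> Phi (vec x) = Phi (setc (vec x) k 1).
    by move=> xk; rewrite (vec_split k x potP) xk mul1r /gain addrC subrK.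
  rewrite add0r (@eq_Epmf mu _ (fun x => Num.min 1 (Phi (setc (vec x) k 1)))); last first.
    by move=> x mx; rewrite forced// (mu_S mx).
  rewrite (@eq_Epmf nu (fun x => Phi (vec x)) (fun x => Phi (setc (vec x) k 1))); last first.
    by move=> x nx; rewrite forced// (nu_S nx).
  apply: (IH _ _ _ ltA'n (potential_forced k potP)) => // i.
  by rewrite /setc; case: eqP.
have th_local i : i \notin A :\ k -> th k i = 0.
  move=> iA; apply: th_edge; apply: contra iA => ik; rewrite finset.in_setD1.
  rewrite (closedA _ _ kA ik) andbT; apply/eqP => E.
  by have := acyc ik; rewrite E connect0.
have pot' := potential_averaged potP (a k) (b_ge0 k) (th_ge0 k) th_local.
set Phi' := averaged _ _ _ _ _ _ in pot'.
have pot'' := potential_capped pot'.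
set Phi'' := capped _ _ in pot''.
have step1 : Epmf mu (fun x => Num.min 1 (Phi (vec x)))
    <= Epmf mu (fun x => Num.min 1 (Phi'' (vec x))).
  apply: (@le_trans _ _ (Epmf mu (fun x => Num.min 1 (Phi' (vec x))))); last first.
    by apply: le_Epmf => // x _; exact: (min1_capped pot').
  (* Concavity of [Num.min 1]: once the Markov property has replaced [x k] by its probability, the
     mixture of [m0] and [m1] is at most 1 and at most the mixture of the untruncated values, which
     [Phi'] dominates. *)
  pose m0 x := Num.min 1 (Phi (setc (vec x) k 0)).
  pose m1 x := Num.min 1 (Phi (setc (vec x) k 1)).
  rewrite (@eq_Epmf mu _ (fun x => m0 x + (x k)%:R * (m1 x - m0 x))); last first.
    move=> x _; rewrite (vec_split k x potP) /gain /m0 /m1.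
    by case: (x k); rewrite ?mul0r ?addr0// !mul1r addrC subrK addrC subrK.
  rewrite EpmfD (mu_markov (A := A :\ k))//; last 2 first.
  - by move=> j; rewrite finset.in_setD1 => /andP[jk jA]; exact: k_last.
  - move=> x y xy; rewrite /m0 /m1; congr (Num.min 1 _ - Num.min 1 _);
    by apply: (pot_setc_local potP) => i iA; rewrite /vec xy.
  rewrite -EpmfD; apply: le_Epmf => // x _.
  have /andP[p0 p1] := p01 k x.
  have pq : p k x <= Num.min 1 (upper_pred (a k) (b k) (th k) (vec x)).
    by rewrite le_min p1 p_le.
  have g0 := gain_ge0 k potP (vec_ge0 x).
  have -> : m0 x + p k x * (m1 x - m0 x) = (1 - p k x) * m0 x + p k x * m1 x by ring.
  have q0 : 0 <= 1 - p k x by rewrite subr_ge0.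
  rewrite le_min; apply/andP; split.
    have m01 : m0 x <= 1 by rewrite /m0 ge_min lexx.
    have m11 : m1 x <= 1 by rewrite /m1 ge_min lexx.
    apply: le_trans (lerD (ler_wpM2l q0 m01) (ler_wpM2l p0 m11)) _.
    by rewrite !mulr1 subrK.
  have h0 : m0 x <= Phi (setc (vec x) k 0) by rewrite /m0 ge_min lexx orbT.
  have h1 : m1 x <= Phi (setc (vec x) k 1) by rewrite /m1 ge_min lexx orbT.
  apply: le_trans (lerD (ler_wpM2l q0 h0) (ler_wpM2l p0 h1)) _.
  apply: (@le_trans _ _ (Phi (setc (vec x) k 0) + gain Phi k (vec x) * p k x)).
    by rewrite le_eqVlt; apply/orP; left; apply/eqP; rewrite /gain; ring.
  rewrite /Phi' /averaged -addrA lerD2l.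
  apply: (@le_trans _ _ (gain Phi k (vec x) * Num.min 1 (upper_pred (a k) (b k) (th k) (vec x)))).
    exact: ler_wpM2l.
  by rewrite lerDl mulr_ge0 ?(pot_coef_ge0 potP)// le_max lexx.
apply: le_trans step1 _.
apply: le_trans (IH _ _ _ ltA'n pot'' _ closedA') _.
  by move=> i; exact: cap_coef_le1.
rewrite addrA lerD2r.
apply: (@le_trans _ _ (Epmf nu (fun x => Phi' (vec x)))).
  by apply: le_Epmf => // x _; exact: (capped_le pot').
have -> : Epmf nu (fun x => Phi (vec x))
    = Epmf nu (fun x => Phi (setc (vec x) k 0)) + Epmf nu (fun x => (x k)%:R * gain Phi k (vec x)).
  by rewrite -EpmfD; apply: eq_Epmf => x _; exact: (vec_split k x potP).
(* Under [nu] only the one-sided [nu_incr] is at hand; it applies because [gain] is an increasing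
   function of the configuration. *)
apply: (@le_trans _ _ (Epmf nu (fun x => Phi (setc (vec x) k 0))
   + Epmf nu (fun x => pstar k x * gain Phi k (vec x))
   + Epmf nu (fun x => `|pth k x - pstar k x|))); last first.
  rewrite lerD2r lerD2l; apply: nu_incr => // x y xy; apply: (gain_mono k potP) => i.
  by have := xy i; rewrite /vec; case: (x i); case: (y i); rewrite //= ?ler01 ?lexx.
rewrite -!EpmfD; apply: le_Epmf => // x _.
rewrite /Phi' /averaged -[leLHS]addrA -[leRHS]addrA lerD2l.
have g0 := gain_ge0 k potP (vec_ge0 x); have gc := gain_le k potP (vec_ge0 x).
have ck := c1 k; have ps1 := pstar_le1 k x.
set g := gain Phi k (vec x) in g0 gc *.
have aps : a k <= pstar k x.
  by rewrite /pstar lerDl; apply: sumr_ge0 => i _; rewrite mulr_ge0.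
set q := upper_pred _ _ _ _.
have qd : q - pstar k x <= `|pth k x - pstar k x|.
  rewrite /q /upper_pred -/(pth k x); case: (leP (a k) (pth k x)) => _; first exact: ler_norm.
  by apply: (@le_trans _ _ 0) => //; rewrite subr_le0.
have n0 : 0 <= `|pth k x - pstar k x| by [].
(* Here the cap on the slopes is used: the part of [q - pstar k x] below 1 is paid with slope [g],
   the part above 1 with slope [c k], and both slopes are at most 1. *)
have [q1|q1] := leP q 1.
  rewrite max_l ?subr_le0// mulr0 addr0.
  have : g * (q - pstar k x) <= 1 * `|pth k x - pstar k x|.
    have [qp|qp] := leP 0 (q - pstar k x).
      by apply: ler_pM => //; exact: le_trans ck.
    by apply: (le_trans (mulr_ge0_le0 g0 (ltW qp))); rewrite mul1r.
  lra.
rewrite max_r; last by rewrite subr_ge0 ltW.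
have h1 : g * (1 - pstar k x) <= 1 * (1 - pstar k x).
  by rewrite ler_wpM2r ?subr_ge0//; exact: le_trans ck.
have h2 : c k * (q - 1) <= 1 * (q - 1) by rewrite ler_wpM2r// subr_ge0 ltW.
lra.
Qed.

Lemma comparison_bound (Y : I) :
  Epmf mu (fun x => (x Y)%:R) <= Epmf nu (fun x => (x Y)%:R)
     + \sum_(k | k \notin S) Epmf nu (fun x => `|pth k x - pstar k x|).
Proof.
have potY : potential [set: I]%SET (fun i => (i == Y)%:R) (fun x : I -> R => x Y).
  have sumY (d : I -> R) : \sum_i (i == Y)%:R * d i = d Y.
    by rewrite (bigD1 Y)//= eqxx mul1r big1 ?addr0// => i /negbTE->; rewrite mul0r.
  split => //.
  - by move=> x y; apply; rewrite finset.in_setT.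
  - by move=> x d x0 d0; rewrite lerDl.
  - by move=> x y d _ _; rewrite [x Y + _]addrC [y Y + _]addrC !addrK.
  - by move=> x d _ _; rewrite sumY [x Y + _]addrC addrK.
  - by move=> x _; rewrite sumY.
have := potential_bound potY; rewrite /vec => h.
apply: (@le_trans _ _ (Epmf mu (fun x => Num.min 1 (x Y)%:R))).
  by apply: le_Epmf => // x _; rewrite le_min lexx andbT; case: (x Y); rewrite ?ler01 ?lexx.
apply: le_trans (h _ _) _.
- by move=> i; case: eqP; rewrite ?ler01 ?lexx.
- by move=> *; rewrite finset.in_setT.
by rewrite lerD2l; under eq_bigl do rewrite finset.in_setT /=.
Qed.

End comparison.

(** * Self-normalized least squares *)

Section quadratic_forms.
Context {R : realType}.

Definition qf m (M : 'M[R]_m) (u v : 'cV[R]_m) : R := (u^T *m M *m v) ord0 ord0.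

Section fixed_dimension.
Variable m : nat.
Implicit Types (M N : 'M[R]_m) (u v w V : 'cV[R]_m).

Lemma qfDl M u v w : qf M (u + v) w = qf M u w + qf M v w.
Proof. by rewrite /qf linearD /= !mulmxDl mxE. Qed.

Lemma qfDr M u v w : qf M w (u + v) = qf M w u + qf M w v.
Proof. by rewrite /qf mulmxDr mxE. Qed.

Lemma qfZl M c u v : qf M (c *: u) v = c * qf M u v.
Proof. by rewrite /qf linearZ /= -!scalemxAl mxE. Qed.

Lemma qfZr M c u v : qf M u (c *: v) = c * qf M u v.
Proof. by rewrite /qf -scalemxAr mxE. Qed.

Lemma qfNl M u v : qf M (- u) v = - qf M u v.
Proof. by rewrite -scaleN1r qfZl mulN1r. Qed.

Lemma qfNr M u v : qf M u (- v) = - qf M u v.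
Proof. by rewrite -scaleN1r qfZr mulN1r. Qed.

Lemma qfDm M N u v : qf (M + N) u v = qf M u v + qf N u v.
Proof. by rewrite /qf mulmxDr mulmxDl mxE. Qed.

Lemma qfZm c M u v : qf (c *: M) u v = c * qf M u v.
Proof. by rewrite /qf -scalemxAr -scalemxAl mxE. Qed.

Lemma qf_sym M u v : M^T = M -> qf M u v = qf M v u.
Proof.
move=> sM; transitivity ((u^T *m M *m v)^T ord0 ord0); first by rewrite [RHS]mxE.
by rewrite !trmx_mul trmxK sM mulmxA.
Qed.

Lemma qf1E u v : qf 1%:M u v = \sum_i u i ord0 * v i ord0.
Proof. by rewrite /qf mulmx1 mxE; apply: eq_bigr => i _; rewrite mxE. Qed.

Lemma qf_outer V u v : qf (V *m V^T) u v = qf 1%:M u V * qf 1%:M V v.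
Proof. by rewrite /qf !mulmx1 mulmxA -mulmxA mxE big_ord1. Qed.

Lemma qf_mulr M N u v : qf M u (N *m v) = qf (M *m N) u v.
Proof. by rewrite /qf !mulmxA. Qed.

Definition posdef M : Prop := M^T = M /\ forall v, v != 0 -> 0 < qf M v v.

Lemma qf1_gt0 v : v != 0 -> 0 < qf 1%:M v v.
Proof.
move=> v0; rewrite qf1E.
have [i vi] : exists i, v i ord0 != 0.
  apply/existsP; apply: contra_neqT v0 => /existsPn h; apply/matrixP => i j.
  by rewrite mxE !ord1; apply/eqP; rewrite -[_ == _]negbK; exact: h.
rewrite (bigD1 i)//= ltr_wpDr//; first by apply: sumr_ge0 => j _; rewrite -expr2 sqr_ge0.
by rewrite -expr2 exprn_even_gt0.
Qed.

Lemma qf1_ge0 v : 0 <= qf 1%:M v v.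
Proof. by rewrite qf1E; apply: sumr_ge0 => j _; rewrite -expr2 sqr_ge0. Qed.

Lemma posdef1 : posdef 1%:M.
Proof. by split; [rewrite trmx1|exact: qf1_gt0]. Qed.

Lemma posdef_ge0 M v : posdef M -> 0 <= qf M v v.
Proof.
move=> [_ pM]; have [->|/pM/ltW//] := eqVneq v 0.
by rewrite /qf mulmx0 mxE.
Qed.

Lemma posdef_outer M V : posdef M -> posdef (M + V *m V^T).
Proof.
move=> [sM pM]; split; first by rewrite linearD /= trmx_mul trmxK sM.
move=> v v0; rewrite qfDm qf_outer ltr_wpDr ?pM// (qf_sym v) ?trmx1//.
by rewrite -expr2 sqr_ge0.
Qed.

Lemma posdef_unit M : posdef M -> M \in unitmx.
Proof.
move=> [sM pM]; rewrite -row_free_unit -kermx_eq0; apply/eqP/row_matrixP => i.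
rewrite row0; apply/eqP; apply: contraT => v0.
have : row i (kermx M) *m M = 0 by rewrite -row_mul mulmx_ker row0.
move=> h; have := pM (row i (kermx M))^T; rewrite -trmx_eq0 trmxK => /(_ v0).
by rewrite /qf trmxK h mul0mx mxE ltxx.
Qed.

Lemma posdef_inv M : posdef M -> posdef (invmx M).
Proof.
move=> pdM; have uM := posdef_unit pdM; have [sM pM] := pdM.
split; first by rewrite trmx_inv sM.
move=> v v0; pose u := invmx M *m v.
have vE : v = M *m u by rewrite /u mulKVmx.
have u0 : u != 0 by apply: contra_neq v0 => u0; rewrite vE u0 mulmx0.
have -> : qf (invmx M) v v = qf M u u; last exact: pM.
by rewrite /qf vE trmx_mul sM -!mulmxA mulKmx.
Qed.

Lemma qf_cauchy M u v : posdef M -> qf M u v ^+ 2 <= qf M u u * qf M v v.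
Proof.
move=> pM; have [->|v0] := eqVneq v 0.
  by rewrite /qf !mulmx0 !mxE expr0n /= mulr0.
have pv : 0 < qf M v v by case: pM => _; apply.
have := posdef_ge0 (qf M v v *: u - qf M u v *: v) pM.
rewrite !(qfDl, qfDr, qfNl, qfNr, qfZl, qfZr).
rewrite (qf_sym v u (proj1 pM)) => h.
have : 0 <= qf M v v * (qf M u u * qf M v v - qf M u v ^+ 2).
  by apply: le_trans h _; rewrite le_eqVlt; apply/orP; left; apply/eqP; ring.
by rewrite pmulr_rge0// subr_ge0.
Qed.

Lemma qf_cauchy_inv M u v : posdef M ->
  qf 1%:M u v ^+ 2 <= qf M u u * qf (invmx M) v v.
Proof.
move=> pM; have uM := posdef_unit pM.
have -> : qf 1%:M u v = qf M u (invmx M *m v) by rewrite qf_mulr mulmxV.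
have -> : qf (invmx M) v v = qf M (invmx M *m v) (invmx M *m v).
  by rewrite qf_mulr mulmxV// /qf trmx_mul trmx_inv (proj1 pM) mulmx1.
exact: qf_cauchy.
Qed.

Lemma mnormE M v : mnorm M v = Num.sqrt (qf M v v). Proof. by []. Qed.

Lemma mnorm_ge0 M v : 0 <= mnorm M v. Proof. exact: sqrtr_ge0. Qed.

Lemma mnorm_sqr M v : posdef M -> mnorm M v ^+ 2 = qf M v v.
Proof. by move=> pM; rewrite mnormE sqr_sqrtr// posdef_ge0. Qed.

Lemma ler_mnormD M u v : posdef M -> mnorm M (u + v) <= mnorm M u + mnorm M v.
Proof.
move=> pM; rewrite -(@ler_pXn2r _ 2) ?nnegrE ?addr_ge0 ?mnorm_ge0//.
rewrite sqrrD !mnorm_sqr// qfDl !qfDr (qf_sym v u (proj1 pM)).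
have : qf M u v <= mnorm M u * mnorm M v.
  rewrite !mnormE -sqrtrM ?posdef_ge0//; apply: le_trans (ler_norm _) _.
  by rewrite -sqrtr_sqr ler_sqrt ?mulr_ge0 ?posdef_ge0// qf_cauchy.
lra.
Qed.

Lemma mnormN M v : mnorm M (- v) = mnorm M v.
Proof. by rewrite !mnormE qfNl qfNr opprK. Qed.

(** With [y = invmx M *m v], the left side is both the square of [y] for [M] and the product of [v]
    and [y]; Cauchy-Schwarz and [M1] then bound its square by itself times the right side. *)
Lemma posdef_inv_le M v : posdef M -> (forall u, qf 1%:M u u <= qf M u u) ->
  qf (invmx M) v v <= qf 1%:M v v.
Proof.
move=> pM M1; have uM := posdef_unit pM; set y := invmx M *m v.
have E1 : qf (invmx M) v v = qf M y y.
  by rewrite qf_mulr mulmxV// /qf trmx_mul trmx_inv (proj1 pM) mulmx1.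
have E2 : qf (invmx M) v v = qf 1%:M v y by rewrite qf_mulr mul1mx.
have := qf_cauchy v y posdef1; rewrite -E2.
have h1 := M1 y; rewrite -E1 in h1.
have := posdef_ge0 v (posdef_inv pM); rewrite le_eqVlt => /orP[/eqP <- _|a0 h].
  exact: qf1_ge0.
have : qf (invmx M) v v ^+ 2 <= qf 1%:M v v * qf (invmx M) v v.
  by apply: le_trans h _; rewrite ler_wpM2l ?qf1_ge0.
by rewrite expr2 ler_pM2r.
Qed.

Section rank_one_update.
Variables (M : 'M[R]_m) (V : 'cV[R]_m).
Hypothesis pM : posdef M.
Let x := qf (invmx M) V V.

(** The matrix determinant lemma, read off two block triangular factorizations of the bordered
    matrix [B]. *)
Lemma det_rank_one : \det (M + V *m V^T) = \det M * (1 + x).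
Proof.
have uM := posdef_unit pM.
pose B : 'M[R]_(1 + m) := block_mx 1%:M (- V^T) V M.
have B1 : B = block_mx 1%:M 0 V 1%:M *m block_mx 1%:M (- V^T) 0 (M + V *m V^T).
  rewrite mulmx_block !mul1mx ?mul0mx ?mulmx1 ?mulmx0 ?addr0 ?add0r mulmxN.
  by rewrite addrCA addNr addr0.
have B2 : B = block_mx (1%:M + V^T *m invmx M *m V) (- V^T) 0 M *m block_mx 1%:M 0 (invmx M *m V) 1%:M.
  rewrite mulmx_block ?mul0mx ?mulmx1 ?mulmx0 ?add0r ?addr0 mulNmx mulmxA addrK.
  by rewrite mulKVmx.
have : \det B = \det B by [].
rewrite {1}B1 B2 !det_mulmx !det_lblock !det_ublock !det1 !mul1r !mulr1 => ->.
by rewrite mulrC det_mx11 mxE mxE eqxx.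
Qed.

(** The Sherman-Morrison formula, verified by multiplication. *)
Lemma inv_rank_one (x1 : 1 + x != 0) :
  invmx (M + V *m V^T)
  = invmx M - (1 + x)^-1 *: (invmx M *m V *m (invmx M *m V)^T).
Proof.
have uM := posdef_unit pM; have [sM _] := pM.
set N := M + V *m V^T; set K := _ - _.
have uN : N \in unitmx by apply: posdef_unit; exact: posdef_outer.
suff NK : N *m K = 1%:M by rewrite -[LHS]mulmx1 -NK mulKmx.
have VMV : V^T *m (invmx M *m V) = x%:M.
  by rewrite mulmxA; apply/matrixP => i j; rewrite !ord1 [RHS]mxE eqxx mulr1n.
set A := invmx M *m V in K *.
have AT : A^T = V^T *m invmx M by rewrite trmx_mul trmx_inv sM.
have NM : N *m invmx M = 1%:M + V *m A^T by rewrite mulmxDl mulmxV// -mulmxA -AT.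
have NA : N *m A = (1 + x) *: V.
  by rewrite mulmxDl /A mulKVmx// -mulmxA VMV mul_mx_scalar scalerDl scale1r.
by rewrite /K mulmxBr -scalemxAr mulmxA NM NA -scalemxAl scalerA mulVf// scale1r addrK.
Qed.

(** How one observation with residual [eta] changes the self-normalized square; half of the added
    fraction is the exponent treated in [mixture_step]. *)
Lemma qf_inv_rank_one (S : 'cV[R]_m) (eta : R) :
  let s := qf (invmx M) V S in
  qf (invmx (M + V *m V^T)) (S + eta *: V) (S + eta *: V)
  = qf (invmx M) S S + (- s ^+ 2 + 2 * eta * s + eta ^+ 2 * x) / (1 + x).
Proof.
move=> s.
have x0 : 0 <= x by apply: posdef_ge0; exact: posdef_inv.
have x1 : 1 + x != 0 by rewrite gt_eqF// ltr_wpDr.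
rewrite inv_rank_one// qfDm.
have outer c A u : qf (- (c *: (A *m A^T))) u u = - c * qf 1%:M u A ^+ 2.
  rewrite -scaleNr qfZm qf_outer.
  by rewrite (qf_sym A) ?trmx1// expr2.
have SM := qf_sym V S (proj1 (posdef_inv pM)).
rewrite outer qf_mulr mul1mx !qfDl !qfDr !qfZl !qfZr -SM -/s -/x.
by field.
Qed.

End rank_one_update.
End fixed_dimension.

(** Each induction step factors out a Schur complement, which is positive and at most the diagonal
    entry [a], because a nonnegative form is subtracted from it. *)
Lemma det_posdef_le m (M : 'M[R]_m) (c : R) : posdef M -> (forall i, M i i <= c) ->
  0 < \det M <= c ^+ m.
Proof.
elim: m M => [|m IH] M pM Mc; first by rewrite det_mx00 expr0 ltr01 lexx.
have [sM posM] := pM.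
pose N : 'M[R]_(1 + m) := M.
pose M' := drsubmx N; pose w := dlsubmx N; pose a := ulsubmx N.
have NE : N = block_mx a w^T w M'.
  rewrite -[LHS]submxK; congr block_mx.
  by rewrite /w trmx_dlsub [N^T]sM.
have posN (z : 'cV[R]_(1 + m)) : z != 0 -> 0 < qf N z z := posM z.
have pM' : posdef M'.
  split; first by rewrite /M' trmx_drsub [N^T]sM.
  move=> v v0; have := posN (col_mx 0 v).
  have -> : qf N (col_mx 0 v) (col_mx 0 v) = qf M' v v.
    rewrite /qf NE tr_col_mx trmx0 mul_row_block !mul0mx !add0r mul_row_col mulmx0.
    by rewrite add0r.
  by apply; apply: contra_neq v0 => E; rewrite -[v](col_mxKd (0 : 'cV_1)) E linear0.
have uM' := posdef_unit pM'.
have McN (i : 'I_(1 + m)) : N i i <= c := Mc i.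
have M'c i : M' i i <= c by have := McN (rshift 1 i); rewrite NE block_mxEdr.
have /andP[d0 dc] := IH M' pM' M'c.
pose t := a - w^T *m invmx M' *m w.
have detN : \det N = t ord0 ord0 * \det M'.
  have -> : N = block_mx 1%:M (w^T *m invmx M') 0 1%:M *m block_mx t 0 w M'.
    rewrite mulmx_block !mul1mx ?mul0mx ?mulmx0 ?add0r ?addr0 NE /t subrK.
    by rewrite -mulmxA mulVmx// mulmx1.
  by rewrite det_mulmx det_ublock det_lblock !det1 !mul1r det_mx11.
have t0 : 0 < t ord0 ord0.
  (* The Schur complement is the value of the quadratic form at its minimizer among vectors with
     first entry 1. *)
  have := posN (col_mx 1%:M (- (invmx M' *m w))).
  have -> : qf N (col_mx 1%:M (- (invmx M' *m w))) (col_mx 1%:M (- (invmx M' *m w))) = t ord0 ord0.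
    rewrite /qf NE -mulmxA mul_block_col !mulmx1 !mulmxN mulKVmx// subrr tr_col_mx.
    by rewrite mul_row_col mulmx0 addr0 trmx1 mul1mx mulmxA.
  apply; apply/negP => /eqP /(congr1 usubmx); rewrite col_mxKu linear0.
  by move=> /matrixP/(_ ord0 ord0)/eqP; rewrite !mxE /= oner_eq0.
have tc : t ord0 ord0 <= c.
  apply: (@le_trans _ _ (a ord0 ord0)).
    rewrite /t mxE [X in _ + X]mxE gerDl oppr_le0.
    by have := posdef_ge0 w (posdef_inv pM').
  by have := McN (lshift m ord0); rewrite NE block_mxEul.
rewrite -[M]/N detN mulr_gt0//= exprS.
by apply: ler_pM => //; exact: ltW.
Qed.

End quadratic_forms.

(** * Exponential moments and logarithmic inequalities *)

Section scalar_inequalities.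
Context {R : realType}.
Implicit Types x y l p s : R.

Lemma fact_double_ge k : (2 ^ k * k`! <= (k.*2)`!)%N.
Proof.
elim: k => // k IH; rewrite doubleS 2!factS expnS factS mulnA.
rewrite [(2 * 2 ^ k * _)%N]mulnAC -[leqLHS]mulnA.
rewrite (_ : (2 * k.+1)%N = k.*2.+2); last by rewrite mul2n doubleS.
by apply: leq_mul => //; apply: leq_trans IH _; rewrite leq_pmull.
Qed.

(* Termwise comparison of the two power series, since (2k)! >= 2^k k!. *)
Lemma cosh_le l : (expR l + expR (- l)) / 2 <= expR (l ^+ 2 / 2).
Proof.
have cv z : (series (exp_coeff z) @ \oo --> expR z)%classic by exact: is_cvg_series_exp_coeff.
pose a k := (exp_coeff l k + exp_coeff (- l) k) / 2.
have aE n : (series (exp_coeff l) n + series (exp_coeff (- l)) n) / 2 = \sum_(k < n) a k.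
  by rewrite /series /= !big_mkord -big_split mulr_suml.
have twice (q : R) : (q + q) / 2 = q by field.
have a_odd k : a k.*2.+1 = 0.
  by rewrite /a /exp_coeff /= exprNn -signr_odd /= odd_double expr1 mulN1r mulNr subrr mul0r.
have a_even k : 0 <= a k.*2 <= exp_coeff (l ^+ 2 / 2) k.
  have -> : a k.*2 = (l ^+ 2) ^+ k / (k.*2)`!%:R.
    by rewrite /a /exp_coeff /= exprNn -signr_odd odd_double expr0 mul1r -mul2n exprM twice.
  have l2 : 0 <= (l ^+ 2) ^+ k by apply: exprn_ge0; exact: sqr_ge0.
  rewrite divr_ge0//= /exp_coeff /=.
  have -> : (l ^+ 2 / 2) ^+ k = (l ^+ 2) ^+ k / 2 ^+ k by rewrite exprMn exprVn.
  rewrite -mulrA; apply: ler_wpM2l => //.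
  rewrite -invfM lef_pV2 ?posrE ?ltr0n ?fact_gt0 ?mulr_gt0 ?exprn_gt0 ?ltr0n ?fact_gt0//.
  by rewrite -natrX -natrM ler_nat fact_double_ge.
have bound n : \sum_(k < n.*2) a k <= expR (l ^+ 2 / 2).
  apply: (@le_trans _ _ (series (exp_coeff (l ^+ 2 / 2)) n)); last first.
    apply: nondecreasing_cvgn_le; last exact: is_cvg_series_exp_coeff.
    apply/nondecreasing_seqP => m; rewrite /series /= big_nat_recr//= lerDl exp_coeff_ge0//.
    by rewrite divr_ge0 ?sqr_ge0.
  rewrite /series /= big_mkord; elim: n => [|n IH]; first by rewrite !big_ord0.
  rewrite doubleS !big_ord_recr /= a_odd addr0 lerD//.
  by have /andP[] := a_even n.
have a_ge0 k : 0 <= a k.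
  rewrite -(odd_double_half k); case: odd; rewrite ?add1n ?add0n ?a_odd//.
  by have /andP[] := a_even k./2.
rewrite (_ : _ / 2 = limn (fun n => (series (exp_coeff l) n + series (exp_coeff (- l)) n) / 2)).
  apply: limr_le.
    by apply/cvg_ex; exists ((expR l + expR (- l)) / 2); apply: cvgMr_tmp; apply: cvgD; exact: cv.
  near=> n; rewrite aE; apply: le_trans (bound n).
  rewrite -addnn big_split_ord /= lerDl; exact: sumr_ge0.
apply/esym/cvg_lim => //; by apply: cvgMr_tmp; apply: cvgD; exact: cv.
Unshelve. all: by end_near. Qed.

(** Convexity via the tangent at [l * eta]: the weights average [l] and [- l] to [l * eta], so the
    linear terms cancel. *)
Lemma expR_chord l eta : -1 <= eta <= 1 ->
  expR (l * eta) <= (1 + eta) / 2 * expR l + (1 - eta) / 2 * expR (- l).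
Proof.
move=> /andP[e0 e1]; set m := l * eta.
have tangent z : expR m * (1 + (z - m)) <= expR z.
  have -> : expR z = expR m * expR (z - m) by rewrite -expRD addrC subrK.
  by rewrite ler_wpM2l ?expR_ge0 ?expR_ge1Dx.
have t0 : 0 <= (1 + eta) / 2 by lra.
have t1 : 0 <= (1 - eta) / 2 by lra.
apply: le_trans (lerD (ler_wpM2l t0 (tangent l)) (ler_wpM2l t1 (tangent (- l)))).
by rewrite le_eqVlt; apply/orP; left; apply/eqP; rewrite /m; field.
Qed.

(** Both centred values lie in [-1, 1]; their chords average to the hyperbolic cosine of [l] because
    the mean is zero. *)
Lemma bernoulli_subgaussian p l : 0 <= p <= 1 ->
  p * expR (l * (1 - p)) + (1 - p) * expR (- (l * p)) <= expR (l ^+ 2 / 2).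
Proof.
move=> /andP[p0 p1]; apply: le_trans (cosh_le l).
have h1 : -1 <= 1 - p <= 1 by lra.
have h2 : -1 <= - p <= 1 by lra.
have q0 : 0 <= 1 - p by lra.
rewrite -mulrN.
apply: le_trans (lerD (ler_wpM2l p0 (expR_chord l h1)) (ler_wpM2l q0 (expR_chord l h2))) _.
by rewrite le_eqVlt; apply/orP; left; apply/eqP; field.
Qed.

Lemma ln_1D_ge x : 0 <= x -> x / (1 + x) <= ln (1 + x).
Proof.
move=> x0; have x1 : 0 < 1 + x by rewrite ltr_wpDr.
rewrite -[ln _]opprK -lnV ?posrE// lerNr.
have -> : - (x / (1 + x)) = (1 + x)^-1 - 1 by field; rewrite gt_eqF.
have := @le_ln1Dx R ((1 + x)^-1 - 1).
rewrite (_ : 1 + ((1 + x)^-1 - 1) = (1 + x)^-1); last by ring.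
by apply; rewrite ltrBrDl subrr invr_gt0.
Qed.

Lemma ln_1D_ge_half x : 0 <= x <= 1 -> x / 2 <= ln (1 + x).
Proof.
move=> /andP[x0 x1]; apply: le_trans (ln_1D_ge x0).
rewrite ler_wpM2l// lef_pV2 ?posrE//; lra.
Qed.

Lemma ln_1D_ge_1half x : 1 <= x -> 1 / 2 <= ln (1 + x).
Proof.
move=> x1; apply: le_trans (ln_1D_ge_half (_ : 0 <= 1 <= 1)) _; first by rewrite ler01 lexx.
by rewrite ler_ln ?posrE; lra.
Qed.

(* One step of the method of mixtures. With [w = 1 / (1 + x)] the exponent
   is half of [eta ^+ 2 - w * (eta - s) ^+ 2], and it is affine in [eta]
   since [eta ^+ 2 = (1 - 2 * p) * eta + p * (1 - p)] for both values
   [1 - p] and [- p]. *)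
Lemma mixture_step p x s : 0 <= p <= 1 -> 0 <= x ->
  p * expR ((- s ^+ 2 + 2 * (1 - p) * s + (1 - p) ^+ 2 * x) / (1 + x) / 2)
  + (1 - p) * expR ((- s ^+ 2 + 2 * (0 - p) * s + (0 - p) ^+ 2 * x) / (1 + x) / 2)
  <= Num.sqrt (1 + x).
Proof.
move=> p01 x0; have x1 : 0 < 1 + x by rewrite ltr_wpDr.
have /andP[p0 p1] := p01.
pose w := (1 + x)^-1; pose v := x / (1 + x); pose c := (1 - 2 * p) / 2.
have wv : w + v = 1 by rewrite /w /v; field; rewrite gt_eqF.
pose l := w * s + v * c; pose k := - (w * s ^+ 2) / 2 + v * (p * (1 - p)) / 2.
have E1 : (- s ^+ 2 + 2 * (1 - p) * s + (1 - p) ^+ 2 * x) / (1 + x) / 2 = k + l * (1 - p).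
  by rewrite /k /l /c /w /v; field; rewrite gt_eqF.
have E2 : (- s ^+ 2 + 2 * (0 - p) * s + (0 - p) ^+ 2 * x) / (1 + x) / 2 = k - l * p.
  by rewrite /k /l /c /w /v; field; rewrite gt_eqF.
rewrite E1 E2 [expR (k + _)]expRD [expR (k - _)]expRD mulrCA [(1 - p) * _]mulrCA -mulrDr.
apply: le_trans (ler_wpM2l (expR_ge0 k) (bernoulli_subgaussian l p01)) _.
rewrite -expRD.
have v0 : 0 <= v by rewrite divr_ge0// ltW.
have w0 : 0 <= w by rewrite invr_ge0 ltW.
have klv : k + l ^+ 2 / 2 <= v / 8.
  (* Jensen's inequality for the square, with weights [w] and [v] of sum 1. *)
  have conv : l ^+ 2 <= w * s ^+ 2 + v * c ^+ 2.
    rewrite -subr_ge0.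
    have -> : w * s ^+ 2 + v * c ^+ 2 - l ^+ 2 = w * v * (s - c) ^+ 2.
      by rewrite /l (_ : v = 1 - w); [ring|rewrite -wv addrAC subrr add0r].
    by rewrite mulr_ge0 ?sqr_ge0// mulr_ge0.
  have -> : k = - (w * s ^+ 2) / 2 + v / 8 - v * c ^+ 2 / 2 by rewrite /k /c; field.
  lra.
apply: (@le_trans _ _ (expR (ln (1 + x) / 2))).
  rewrite ler_expR; apply: le_trans klv _.
  by have := ln_1D_ge x0; rewrite -/v; lra.
rewrite -[leLHS]ger0_norm ?expR_ge0// -sqrtr_sqr -expRM_natl ler_sqrt; last exact: ltW.
by rewrite mulrCA mulfV// mulr1 lnK.
Qed.

(** Inequality of arithmetic and geometric means. The free parameter [b] replaces Cauchy-Schwarz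
    over the rounds: affine bounds add up round by round, and [b] is tuned only at the end, in
    [regret_rate]. *)
Lemma sqrt2_le_affine (y b : R) : 0 <= y -> 0 < b -> Num.sqrt (2 * y) <= b * y + (2 * b)^-1.
Proof.
move=> y0 b0; rewrite -(@ler_pXn2r _ 2) ?nnegrE ?sqrtr_ge0//; last first.
  have b0' := ltW b0; apply: addr_ge0; first exact: mulr_ge0.
  by rewrite invr_ge0 mulr_ge0.
rewrite sqr_sqrtr ?mulr_ge0// -subr_ge0.
have -> : (b * y + (2 * b)^-1) ^+ 2 - 2 * y = (b * y - (2 * b)^-1) ^+ 2.
  by field; rewrite gt_eqF.
exact: sqr_ge0.
Qed.

End scalar_inequalities.

Lemma sum_ord_le1 (R : numDomainType) m (f : 'I_m -> R) :
  (forall i, f i <= 1) -> \sum_i f i <= m%:R.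
Proof.
move=> f1; apply: le_trans (ler_sum _ (fun i _ => f1 i)) _.
by rewrite sumr_const card_ord.
Qed.

(** * Ridge regression at one node: confidence and widths *)

Section least_squares.
Context {R : realType} {X : finType}.
Local Notation node' := (option (option X)).
Variables (G' : blm R node') (ths : node' -> node' -> R) (o : option X).
Local Notation dim := #|parents' G' o|.
Local Notation V x := (@par_values R X G' x o).
Local Notation M h := (@gram R X G' h o).
Implicit Types (A : {set X}) (h : history X) (x y : {ffun option X -> bool}).

Let theta : 'cV[R]_dim := par_weights G' ths o.

Lemma qf_par_values (th : node' -> node' -> R) x :
  qf 1%:M (par_weights G' th o) (V x)
  = \sum_(z | edge G' z (Some o)) th z (Some o) * (if z is Some i then x i else true)%:R.
Proof.
rewrite qf1E; under eq_bigr do rewrite !mxE.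
rewrite -(big_enum_val (A := mem (parents' G' o))
  (fun z => th z (Some o) * (if z is Some i then x i else true)%:R)).
by apply: eq_bigl => z; rewrite finset.inE.
Qed.

Lemma par_values_local x y : (forall i, edge G' (Some i) (Some o) -> x i = y i) -> V x = V y.
Proof.
move=> xy; apply/matrixP => k j; rewrite !mxE.
have := enum_valP k; rewrite finset.inE.
by case: (enum_val k) => // i /xy ->.
Qed.

Lemma par_values01 x k : 0 <= V x k ord0 <= 1.
Proof. by rewrite mxE ler0n lern1; case: (enum_val k) => [i|] /=; rewrite ?leq_b1. Qed.

Lemma gram_posdef h : posdef (M h).
Proof.
elim: h => [|[A x] h IH] /=; first exact: posdef1.
by case: ifP => // _; exact: posdef_outer.
Qed.

Lemma gram_ge1 h u : qf 1%:M u u <= qf (M h) u u.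
Proof.
elim: h => [|[A x] h IH] //=; case: ifP => // _.
rewrite qfDm qf_outer (qf_sym (V x)) ?trmx1// (le_trans IH)// lerDl -expr2.
exact: sqr_ge0.
Qed.

Lemma gram_diag_le h i : M h i i <= 1 + (size h)%:R.
Proof.
elim: h => [|[A x] h IH] /=; first by rewrite mxE eqxx addr0.
case: ifP => _.
  by apply: le_trans IH _; rewrite lerD2l ler_nat.
rewrite mxE -natr1 addrA lerD//; rewrite mxE big_ord1 [X in _ * X]mxE.
have /andP[v0 v1] := par_values01 x i.
by rewrite -[leRHS]mulr1; apply: ler_pM.
Qed.

Lemma gram_det_le h : 0 < \det (M h) <= (1 + (size h)%:R) ^+ dim.
Proof. by apply: det_posdef_le; [exact: gram_posdef|exact: gram_diag_le]. Qed.

(** The regressors weighted by their centred residuals: the vector martingale behind the confidence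
    regions. *)
Fixpoint noise_vec h : 'cV[R]_dim :=
  if h is (A, x) :: h' then
    if o \in Some @: A then noise_vec h'
    else noise_vec h' + ((x o)%:R - qf 1%:M theta (V x)) *: V x
  else 0.

Lemma bvec_noise h : bvec G' h o = noise_vec h + (M h - 1%:M) *m theta.
Proof.
elim: h => [|[A x] h IH] /=; first by rewrite subrr mul0mx addr0.
case: ifP => // _; rewrite IH.
have -> : M h + V x *m (V x)^T - 1%:M = (M h - 1%:M) + V x *m (V x)^T by rewrite addrAC.
rewrite (mulmxDl (M h - 1%:M)) -(mulmxA (V x)).
have -> : (V x)^T *m theta = (qf 1%:M theta (V x))%:M.
  rewrite (qf_sym theta) ?trmx1//; apply/matrixP => i j.
  by rewrite !ord1 [RHS]mxE eqxx mulr1n /qf mulmx1.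
rewrite mul_mx_scalar scalerBl addrA -!addrA; congr (_ + _).
by rewrite [LHS]addrC; congr (_ + _); rewrite addrCA addNr addr0.
Qed.

(** The error is a noise term plus the bias [invmx (M h) *m theta] of the regularization; as [M h]
    dominates the identity, the bias has norm at most that of [theta]. This is the origin of the
    summand sqrt n in [rho]. *)
Lemma theta_hat_error h : (forall k, 0 <= theta k ord0 <= 1) ->
  mnorm (M h) (theta - theta_hat G' h o)
  <= Num.sqrt (qf (invmx (M h)) (noise_vec h) (noise_vec h)) + Num.sqrt dim%:R.
Proof.
move=> th01; have pM := gram_posdef h; have uM := posdef_unit pM.
have normE v : mnorm (M h) (invmx (M h) *m v) = Num.sqrt (qf (invmx (M h)) v v).
  rewrite mnormE; congr Num.sqrt.
  by rewrite qf_mulr mulmxV// /qf trmx_mul trmx_inv (proj1 pM) mulmx1.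
have -> : theta - theta_hat G' h o = - (invmx (M h) *m noise_vec h) + invmx (M h) *m theta.
  rewrite /theta_hat bvec_noise mulmxDr mulmxBl mulmxBr mulKmx// mul1mx.
  by rewrite opprD addrCA; congr (_ + _); rewrite opprB addrCA subrr addr0.
apply: le_trans (ler_mnormD _ _ pM) _; rewrite mnormN !normE lerD2l.
rewrite ler_sqrt//.
apply: le_trans (posdef_inv_le _ pM (gram_ge1 h)) _.
rewrite qf1E; apply: sum_ord_le1 => k.
by have /andP[t0 t1] := th01 k; rewrite -[leRHS]mulr1; apply: ler_pM.
Qed.

(* The Gaussian mixture, over vectors [l], of the supermartingales
   exp (l . s - l^T (M - 1) l / 2), where [s] is [noise_vec]. *)
Definition mixture h : R :=
  expR (qf (invmx (M h)) (noise_vec h) (noise_vec h) / 2) / Num.sqrt (\det (M h)).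

Lemma mixture_ge0 h : 0 <= mixture h.
Proof. by rewrite divr_ge0 ?expR_ge0 ?sqrtr_ge0. Qed.

Lemma mixture_nil : mixture [::] = 1.
Proof. by rewrite /mixture /= invmx1 det1 sqrtr1 divr1 /qf mulmx0 mxE mul0r expR0. Qed.

Lemma mixture_skip A x h : o \in Some @: A -> mixture ((A, x) :: h) = mixture h.
Proof. by rewrite /mixture /= => ->. Qed.

Lemma mixture_cons A x h : o \notin Some @: A ->
  let xx := qf (invmx (M h)) (V x) (V x) in
  let s := qf (invmx (M h)) (V x) (noise_vec h) in
  let eta := (x o)%:R - qf 1%:M theta (V x) in
  mixture ((A, x) :: h) = mixture h
    * (expR ((- s ^+ 2 + 2 * eta * s + eta ^+ 2 * xx) / (1 + xx) / 2) / Num.sqrt (1 + xx)).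
Proof.
move=> /negbTE oA xx s eta; rewrite /mixture /= oA.
have pM := gram_posdef h; have /andP[d0 _] := gram_det_le h.
rewrite qf_inv_rank_one// det_rank_one// sqrtrM ?ltW// mulrDl expRD invfM.
by rewrite mulrACA.
Qed.

(** The new value depends on [x] only through the parents of [o] and, affinely, through the bit
    [x o]. Replacing that bit by its predictor against functions of the parents is what the
    hypothesis allows, and [mixture_step] bounds the result. *)
Lemma mixture_supermartingale (nu : {ffun option X -> bool} -> R) A h :
  (forall x, 0 <= nu x) -> \sum_x nu x = 1 ->
  (forall x, 0 <= qf 1%:M theta (V x) <= 1) ->
  (o \notin Some @: A -> forall f : {ffun option X -> bool} -> R,
    (forall x y, (forall i, edge G' (Some i) (Some o) -> x i = y i) -> f x = f y) ->
    Epmf nu (fun x => (x o)%:R * f x) = Epmf nu (fun x => qf 1%:M theta (V x) * f x)) ->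
  Epmf nu (fun x => mixture ((A, x) :: h)) <= mixture h.
Proof.
move=> nu0 nu1 p01 nu_mul.
have [oA|oA] := boolP (o \in Some @: A).
  rewrite (@eq_Epmf _ _ nu _ (fun=> mixture h)) ?Epmf_cst// => x _.
  exact: mixture_skip.
pose f (b : R) x : R :=
  let xx := qf (invmx (M h)) (V x) (V x) in
  let s := qf (invmx (M h)) (V x) (noise_vec h) in
  let eta := b - qf 1%:M theta (V x) in
  mixture h * (expR ((- s ^+ 2 + 2 * eta * s + eta ^+ 2 * xx) / (1 + xx) / 2) / Num.sqrt (1 + xx)).
have f_local b x y : (forall i, edge G' (Some i) (Some o) -> x i = y i) -> f b x = f b y.
  by move=> /par_values_local E; rewrite /f E.
rewrite (@eq_Epmf _ _ nu _ (fun x => f 0 x + (x o)%:R * (f 1 x - f 0 x))); last first.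
  move=> x _; rewrite mixture_cons//.
  by rewrite /f; case: (x o); [rewrite mul1r [RHS]subrKC|rewrite mul0r addr0].
rewrite EpmfD (nu_mul oA (fun x => f 1 x - f 0 x)); last first.
  by move=> x y xy; rewrite (f_local 1 x y xy) (f_local 0 x y xy).
rewrite -EpmfD -[leRHS](Epmf_cst _ nu1); apply: le_Epmf => // x _.
set p := qf 1%:M theta (V x).
have -> : f 0 x + p * (f 1 x - f 0 x) = p * f 1 x + (1 - p) * f 0 x by ring.
rewrite /f -/p; set xx := qf (invmx _) (V x) (V x); set s := qf _ _ (noise_vec h).
have xx0 : 0 <= xx by apply/posdef_ge0/posdef_inv/gram_posdef.
have := mixture_step s (p01 x) xx0; rewrite -/p.
set a := expR _; set b := expR _ => step.
have q0 : 0 < Num.sqrt (1 + xx) by rewrite sqrtr_gt0 ltr_wpDr.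
have -> : p * (mixture h * (a / Num.sqrt (1 + xx))) + (1 - p) * (mixture h * (b / Num.sqrt (1 + xx)))
  = mixture h * ((p * a + (1 - p) * b) / Num.sqrt (1 + xx)) by ring.
by rewrite -[leRHS]mulr1 ler_wpM2l ?mixture_ge0// ler_pdivrMr// mul1r.
Qed.

(** In logarithms, [mixture h < c] bounds the self-normalized square of the noise by
    [ln (\det (M h)) + 2 * ln c]. *)
Lemma mixture_lt_conf h (c : R) : 0 < c -> (forall k, 0 <= theta k ord0 <= 1) ->
  mixture h < c ->
  mnorm (M h) (theta - theta_hat G' h o)
  <= Num.sqrt (ln (\det (M h)) + 2 * ln c) + Num.sqrt dim%:R.
Proof.
move=> c0 th01 hc; apply: le_trans (theta_hat_error h th01) _.
have /andP[d0 _] := gram_det_le h; rewrite lerD2r ler_wsqrtr//.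
move: hc; rewrite ltr_pdivrMr ?sqrtr_gt0// => hc.
have : qf (invmx (M h)) (noise_vec h) (noise_vec h) / 2 < ln (c * Num.sqrt (\det (M h))).
  by rewrite -ltr_expR lnK// posrE mulr_gt0// sqrtr_gt0.
rewrite lnM ?posrE ?sqrtr_gt0//.
have : ln (\det (M h)) = 2 * ln (Num.sqrt (\det (M h))).
  by rewrite mulr_natl -lnXn ?sqrtr_gt0// sqr_sqrtr// ltW.
lra.
Qed.

(** Both cases are charged to the growth of [ln (\det M)]. If the leverage [xx] is at most 1, it is
    at most twice [ln (1 + xx)]; otherwise the trivial bound [dim] applies, and [ln (1 + xx)] is at
    least 1/2. *)
Lemma width_step h (D : 'cV[R]_dim) x (rh b : R) :
  0 < b -> 0 <= rh -> (forall k, `|D k ord0| <= 1) -> mnorm (M h) D <= 2 * rh ->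
  `|qf 1%:M D (V x)|
  <= 2 * rh * (b * ln (1 + qf (invmx (M h)) (V x) (V x)) + (2 * b)^-1)
     + 2 * dim%:R * ln (1 + qf (invmx (M h)) (V x) (V x)).
Proof.
move=> b0 rh0 D1 Dr; set xx := qf (invmx _) _ _; set y := ln _.
have pM := gram_posdef h.
have xx0 : 0 <= xx by apply/posdef_ge0/posdef_inv/gram_posdef.
have y0 : 0 <= y by rewrite ln_ge0// lerDl.
have aff0 : 0 <= 2 * rh * (b * y + (2 * b)^-1).
  by rewrite mulr_ge0 ?mulr_ge0// addr_ge0 ?mulr_ge0 ?invr_ge0 ?mulr_ge0 ?(ltW b0).
have [xx1|xx1] := leP xx 1.
  apply: (@le_trans _ _ (2 * rh * (b * y + (2 * b)^-1))); last first.
    by rewrite lerDl !mulr_ge0.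
  apply: (@le_trans _ _ (mnorm (M h) D * Num.sqrt xx)).
    have pI := posdef_inv pM.
    rewrite mnormE -sqrtrM ?posdef_ge0// -sqrtr_sqr ler_sqrt ?mulr_ge0 ?posdef_ge0//.
    exact: qf_cauchy_inv.
  apply: ler_pM => //; rewrite ?sqrtr_ge0 ?mnorm_ge0//.
  apply: le_trans (sqrt2_le_affine y0 b0); rewrite ler_sqrt ?mulr_ge0//.
  by have := @ln_1D_ge_half _ xx; rewrite xx0 xx1 -/y => /(_ isT); lra.
apply: (@le_trans _ _ (2 * dim%:R * y)); last by rewrite lerDr.
apply: (@le_trans _ _ dim%:R).
  rewrite qf1E; apply: le_trans (ler_norm_sum _ _ _) _.
  apply: sum_ord_le1 => k.
  have /andP[v0 v1] := par_values01 x k.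
  by rewrite normrM (ger0_norm v0) -[leRHS]mulr1; apply: ler_pM.
have := ln_1D_ge_1half (ltW xx1); rewrite -/y => h1.
by have : 0 <= dim%:R * (2 * y - 1) :> R; [rewrite mulr_ge0//; lra|lra].
Qed.

Lemma ln_det_cons A x h : o \notin Some @: A ->
  ln (\det (M ((A, x) :: h))) = ln (\det (M h)) + ln (1 + qf (invmx (M h)) (V x) (V x)).
Proof.
move=> /negbTE oA /=; rewrite oA det_rank_one; last exact: gram_posdef.
have /andP[d0 _] := gram_det_le h.
rewrite lnM// posrE ltr_wpDr//; apply/posdef_ge0/posdef_inv/gram_posdef.
Qed.

End least_squares.

(** * Arithmetic of the final rate *)

Section rates.
Context {R : realType}.
Variables (n D T : nat).
Hypotheses (D_gt0 : (0 < D)%N) (D_le : (D <= n)%N) (T_ge2 : (2 <= T)%N).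
Let l : R := ln T%:R.
Let s : R := Num.sqrt (D%:R * T%:R).

Let size_bounds : [/\ 2 <= T%:R :> R, 1 <= n%:R :> R, 1 <= D%:R :> R & D%:R <= n%:R :> R].
Proof. by split; rewrite ?ler1n ?ler_nat ?(leq_trans D_gt0). Qed.

(** Lets additive constants be absorbed into the factor log T. *)
Let ln_horizon_ge : 1 <= 2 * l.
Proof.
have [T2 _ _ _] := size_bounds.
have := @ln_1D_ge R (T%:R - 1); rewrite [1 + _]addrC subrK -/l subr_ge0.
have T0 : 0 < T%:R :> R by lra.
move=> h; have : (T%:R - 1) / T%:R <= l by apply: h; lra.
rewrite ler_pdivrMr// => {}h.
have : 0 <= (2 * l - 1) * T%:R by lra.
by rewrite pmulr_lge0//; lra.
Qed.

Lemma ln_le_mul (k : nat) (x : R) : 0 < x -> x <= T%:R ^+ k -> ln x <= k%:R * l.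
Proof.
have [T2 _ _ _] := size_bounds; move=> x0 xk; rewrite mulr_natl -lnXn; last by lra.
by rewrite ler_ln ?posrE// exprn_gt0//; lra.
Qed.

(** For [n <= T] the two logarithms are at most [3 * l] and [2 * l], so the first root is at most
    that of [9 * n * l]; the second costs another 2 since [2 * l] is at least 1. *)
Lemma rho_le : (n <= T)%N ->
  Num.sqrt (n%:R * ln (1 + T%:R * n%:R) + 2 * ln (n%:R * Num.sqrt T%:R)) + Num.sqrt n%:R
  <= 5 * (Num.sqrt n%:R * Num.sqrt l).
Proof.
have [T2 n1 _ _] := size_bounds; have l2 := ln_horizon_ge.
move=> nT; have nT' : n%:R <= T%:R :> R by rewrite ler_nat.
have T0 : 0 < T%:R :> R by lra.
have a1 : ln (1 + T%:R * n%:R) <= 3 * l.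
  apply: ln_le_mul; first by have := mulr_ge0 (ltW T0) (ler0n R n); lra.
  have : T%:R * n%:R <= T%:R * T%:R :> R by rewrite ler_wpM2l// ltW.
  have : 0 <= T%:R * T%:R * (T%:R - 2) :> R by rewrite !mulr_ge0//; lra.
  have : 0 <= T%:R * (T%:R - 1) :> R by rewrite !mulr_ge0//; lra.
  by rewrite !exprS expr0 mulr1; nra.
have sT : Num.sqrt T%:R <= T%:R :> R.
  rewrite -[leRHS](ger0_norm (ltW T0)) -sqrtr_sqr ler_wsqrtr//.
  by rewrite expr2 ler_peMl//; lra.
have sT0 : 0 < Num.sqrt T%:R :> R by rewrite sqrtr_gt0.
have a2 : ln (n%:R * Num.sqrt T%:R) <= 2 * l.
  apply: ln_le_mul; first by rewrite mulr_gt0//; lra.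
  by rewrite expr2; apply: ler_pM => //; rewrite ltW.
have b1 : Num.sqrt (n%:R * ln (1 + T%:R * n%:R) + 2 * ln (n%:R * Num.sqrt T%:R))
    <= 3 * (Num.sqrt n%:R * Num.sqrt l).
  have -> : 3 * (Num.sqrt n%:R * Num.sqrt l) = Num.sqrt (3 ^+ 2 * (n%:R * l)).
    by rewrite sqrtrM// sqrtr_sqr ger0_norm// sqrtrM.
  rewrite ler_wsqrtr//.
  have : n%:R * ln (1 + T%:R * n%:R) <= n%:R * (3 * l) by rewrite ler_wpM2l.
  have : 0 <= (n%:R - 1) * l by rewrite mulr_ge0//; lra.
  have : 0 <= n%:R * l by rewrite mulr_ge0//; lra.
  lra.
have b2 : Num.sqrt n%:R <= 2 * (Num.sqrt n%:R * Num.sqrt l).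
  rewrite mulrCA ler_peMr// -[leLHS]sqrtr1 -[X in X * _](@ger0_norm R 2)// -sqrtr_sqr -sqrtrM//.
  by rewrite ler_wsqrtr//; lra.
lra.
Qed.

(** The width terms add up to 20 + 4 times [n%:R ^+ 2 * s * l], and sqrt T costs at most 2 more; 100
    is a generous round value. *)
Lemma regret_rate (rho L g : R) :
  ((n <= T)%N -> rho <= 5 * (Num.sqrt n%:R * Num.sqrt l)) ->
  L <= 2 * (D%:R * l) -> 0 <= rho ->
  g <= T%:R ->
  (forall b, 0 < b ->
    g <= n%:R * (2 * rho * (b * L + T%:R / (2 * b)) + 2 * D%:R * L) + Num.sqrt T%:R) ->
  g <= 100 * n%:R ^+ 2 * s * l.
Proof.
have [T2 n1 D1 Dn] := size_bounds; have l2 := ln_horizon_ge.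
move=> rho_le L_le rho0 gT gb.
have T0 : 0 < T%:R :> R by lra.
have s0 : 0 < s by rewrite sqrtr_gt0 mulr_gt0//; lra.
have ss : s * s = D%:R * T%:R by rewrite -expr2 sqr_sqrtr// mulr_ge0.
have sTs : Num.sqrt T%:R <= s by rewrite ler_wsqrtr// ler_peMl.
have nn : 1 <= n%:R ^+ 2 :> R by rewrite expr2; nra.
have base : 0 <= n%:R ^+ 2 * s * (2 * l - 1).
  by rewrite !mulr_ge0 ?sqr_ge0 ?(ltW s0)//; lra.
(* If n > T then sqrt T is at most n, and the trivial bound T is at most [s * n%:R]. *)
have [nT|Tn] := leqP n T; last first.
  have sTn : Num.sqrt T%:R <= n%:R :> R.
    rewrite -[leRHS](@ger0_norm R n%:R)// -sqrtr_sqr ler_wsqrtr//.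
    have : T%:R <= n%:R :> R by rewrite ler_nat ltnW.
    by rewrite expr2; nra.
  have TT : T%:R = Num.sqrt T%:R * Num.sqrt T%:R :> R by rewrite -expr2 sqr_sqrtr// ltW.
  have : T%:R <= s * n%:R by rewrite TT; apply: ler_pM; rewrite ?sqrtr_ge0.
  have : 0 <= s * (n%:R * (n%:R - 1)) by rewrite !mulr_ge0 ?(ltW s0)//; lra.
  by rewrite expr2 in base *; nra.
have {}rho_le := rho_le nT.
set p := Num.sqrt n%:R in rho_le; set q := Num.sqrt l in rho_le.
have l0 : 0 < l by lra.
have q0 : 0 < q by rewrite sqrtr_gt0.
have qq : q * q = l by rewrite -expr2 sqr_sqrtr// ltW.
have p0 : 0 <= p by exact: sqrtr_ge0.
have pn : p <= n%:R.
  rewrite /p -[leRHS](@ger0_norm R n%:R)// -sqrtr_sqr ler_wsqrtr//.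
  by rewrite expr2 ler_peMl.
(* This value of [b] balances the two terms: both [b * L] and [T / (2 * b)] become at most
   [s * q]. *)
have b0 : 0 < T%:R / (2 * (s * q)) by rewrite divr_gt0// !mulr_gt0.
have := gb _ b0.
have e1 : T%:R / (2 * (s * q)) * L <= s * q.
  apply: le_trans (ler_wpM2l (ltW b0) L_le) _.
  rewrite le_eqVlt; apply/orP; left; apply/eqP.
  have -> : T%:R / (2 * (s * q)) * (2 * (D%:R * l)) = (D%:R * T%:R) * l / (s * q).
    by field; rewrite !gt_eqF.
  by rewrite -ss -qq; field; rewrite !gt_eqF.
have e2 : T%:R / (2 * (T%:R / (2 * (s * q)))) = s * q by field; rewrite !gt_eqF.
rewrite e2.
have Ds : D%:R <= s.
  rewrite /s -[leLHS](@ger0_norm R D%:R)// -sqrtr_sqr ler_wsqrtr//.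
  by rewrite expr2 ler_wpM2l// ler_nat (leq_trans D_le).
have e3 : 2 * rho * (T%:R / (2 * (s * q)) * L + s * q) <= 20 * (n%:R * s * l).
  apply: (@le_trans _ _ (2 * (5 * (p * q)) * (2 * (s * q)))).
    apply: (@le_trans _ _ (2 * rho * (2 * (s * q)))).
      by apply: ler_wpM2l; [lra|lra].
    by rewrite ler_wpM2r ?mulr_ge0 ?(ltW s0) ?(ltW q0)//; lra.
  have -> : 2 * (5 * (p * q)) * (2 * (s * q)) = 20 * (p * s * l) by rewrite -qq; ring.
  by rewrite ler_pM2l// !ler_wpM2r// ltW.
have e4 : 2 * D%:R * L <= 4 * (n%:R * s * l).
  have : D%:R * L <= D%:R * (2 * (D%:R * l)) by rewrite ler_wpM2l.
  have : D%:R * D%:R * l <= n%:R * s * l.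
    by rewrite ler_wpM2r ?(ltW l0)//; apply: ler_pM.
  lra.
have : n%:R * (2 * rho * (T%:R / (2 * (s * q)) * L + s * q) + 2 * D%:R * L)
    <= n%:R * (24 * (n%:R * s * l)) by rewrite ler_wpM2l//; lra.
have : s <= n%:R ^+ 2 * s by rewrite ler_peMl// ltW.
have : 0 <= n%:R ^+ 2 * s * l by rewrite !mulr_ge0 ?sqr_ge0 ?(ltW s0) ?(ltW l0).
by rewrite expr2 in base *; lra.
Qed.
End rates.

Local Open Scope classical_set_scope.
Local Open Scope ring_scope.

(** * Reduction to finite probability spaces *)

Section independence_of_pairs.
Context {d : measure_display} {Om : measurableType d} {R : realType}.
Variable P : probability Om R.

Lemma measurable_pairRV (X Y : {RV P >-> R}) :
  measurable_fun setT (fun w => (X w, Y w)).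
Proof. by apply: measurable_fun_pair; exact: measurable_funPT. Qed.

Lemma measurable_pair_event (X Y : {RV P >-> R}) (B : set (R * R)) :
  measurable B -> measurable [set w | B (X w, Y w)].
Proof.
move=> mB; rewrite -[X in measurable X]setTI.
exact: (measurable_pairRV X Y).
Qed.

(** Makes the normalized law of [Z] on the event [Q] a measure, the form in which uniqueness of
    product measures applies. *)
Lemma scaled_law_measure {d'} {S : measurableType d'} (Z : Om -> S)
    (mZ : measurable_fun setT Z) (Q : set Om) (mQ : measurable Q)
    (c : {nonneg R}) :
  exists mm : {measure set S -> \bar R},
    forall A, mm A = (c%:num%:E * P (Z @^-1` A `&` Q))%E.
Proof.
unshelve eexists.
  refine (mscale c (pushforward (mrestr P mQ) Z : {measure set _ -> \bar R})).
  exact: mZ.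
by [].
Qed.

(** Conditionally on [Q] the law of the pair agrees with the product law on rectangles, hence
    everywhere; a null event [Q] is treated apart. *)
Lemma prob_pair_indep_event (X Y : {RV P >-> R}) (Q : set Om) :
  measurable Q ->
  (forall A B : set R, measurable A -> measurable B ->
    P ((X @^-1` A `&` Y @^-1` B) `&` Q)
    = (P (X @^-1` A) * P (Y @^-1` B) * P Q)%E) ->
  forall B : set (R * R), measurable B ->
    P ([set w | B (X w, Y w)] `&` Q)
    = ((distribution P X \x distribution P Y) B * P Q)%E.
Proof.
move=> mQ indepQ B mB.
have [PQ0|PQ0] := eqVneq (P Q) 0%E.
  rewrite PQ0 mule0; apply/eqP; rewrite -measure_le0 -PQ0.
  by rewrite le_measure ?inE//; apply: measurableI => //; exact: measurable_pair_event.
have PQfin : P Q \is a fin_num by exact: fin_num_measure.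
pose c : R := fine (P Q).
have c_gt0 : 0 < c by rewrite fine_gt0// lt0e PQ0 measure_ge0 /= ltey_eq PQfin.
have cinv_ge0 : 0 <= c^-1 by rewrite invr_ge0 ltW.
pose cn : {nonneg R} := NngNum cinv_ge0.
have [mm mmE] := scaled_law_measure (measurable_pairRV X Y) mQ cn.
have -> : (distribution P X \x distribution P Y)%E B = mm B.
  apply: product_measure_unique => // A1 A2 mA1 mA2.
  rewrite mmE /=.
  have -> : (fun w => (X w, Y w)) @^-1` (A1 `*` A2) = X @^-1` A1 `&` Y @^-1` A2 by [].
  rewrite indepQ// -[P Q]fineK// -/c muleA muleC !muleA -EFinM divff ?mul1e//.
  by rewrite gt_eqF.
by rewrite mmE /= -[P Q]fineK// -/c muleAC -EFinM mulVf ?mul1e// gt_eqF.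
Qed.


Lemma bigcap_seq_cons (I : eqType) (i : I) (J : seq I) (E : I -> set Om) :
  \bigcap_(k in [set` (i :: J)]) E k = E i `&` \bigcap_(k in [set` J]) E k.
Proof.
apply/seteqP; split => w.
  move=> h; split; first by apply: h; rewrite /= mem_head.
  by move=> k kJ; apply: h; rewrite /= in_cons kJ orbT.
move=> [h1 h2] k; rewrite /= in_cons => /orP[/eqP->//|]; exact: h2.
Qed.

Lemma measurable_bigcap_seq (I : eqType) (J : seq I) (E : I -> set Om) :
  (forall i, measurable (E i)) -> measurable (\bigcap_(k in [set` J]) E k).
Proof.
move=> mE; elim: J => [|i J IH].
  by rewrite (_ : [set` [::]] = set0) ?bigcap_set0//; apply/seteqP; split.
by rewrite bigcap_seq_cons; apply: measurableI.
Qed.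

Section family.
Variables (I : choiceType) (e g : I -> {RV P >-> R}).
Hypothesis indep : mutually_independent P
  (fun i : I + I => match i with inl i => (e i : Om -> R) | inr i => g i end).

Let pair_event i (B : set (R * R)) := [set w | B (e i w, g i w)].

Let m_pair_event i B : measurable B -> measurable (pair_event i B).
Proof. exact: measurable_pair_event. Qed.

Lemma indep_rectangles (J : seq I) (C D : I -> set R) : uniq J ->
  (forall i, measurable (C i)) -> (forall i, measurable (D i)) ->
  P (\bigcap_(i in [set` J]) (e i @^-1` C i `&` g i @^-1` D i))
  = (\prod_(i <- J) (P (e i @^-1` C i) * P (g i @^-1` D i)))%E.
Proof.
move=> uJ mC mD.
pose B (k : I + I) := match k with inl i => C i | inr i => D i end.
have /= := @indep (map inl J ++ map inr J) B.
have -> : uniq ([seq inl i | i <- J] ++ [seq inr i | i <- J] : seq (I + I)).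
  rewrite cat_uniq !map_inj_uniq ?uJ /= ?andbT//; try by move=> ? ? [].
  by apply/hasPn => k /mapP[i _ ->]; apply/mapP => -[].
move=> /(_ isT) h; rewrite big_split /=.
move: h; rewrite big_cat !big_map /= => <-; last by case=> i; [exact: mC|exact: mD].
congr (P _); apply/seteqP; split => w.
  move=> h [i|i]; rewrite /= mem_cat => /orP[] /mapP[j jJ] // [->].
    by have [] := h j jJ.
  by have [] := h j jJ.
move=> h i /= iJ; split; [apply: (h (inl i))|apply: (h (inr i))];
  by rewrite /= mem_cat map_f// orbT.
Qed.

Let isrect (B : set (R * R)) :=
  exists C D, [/\ measurable C, measurable D & B = C `*` D].

(** Arbitrary planar sets are allowed on [J1], rectangles elsewhere. Each step of the induction
    frees one index: its rectangles are independent of the event [Q] of all others, and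
    [prob_pair_indep_event] extends this to every measurable set. *)
Let indep_pairs_mixed (J1 J2 : seq I) (B : I -> set (R * R)) :
  uniq (J1 ++ J2) -> (forall i, measurable (B i)) ->
  (forall i, i \notin J1 -> isrect (B i)) ->
  P (\bigcap_(i in [set` (J1 ++ J2)]) pair_event i (B i))
  = (\prod_(i <- J1 ++ J2) P (pair_event i (B i)))%E.
Proof.
elim: J1 J2 B => [|i J1 IH] J2 B.
  move=> /= uJ mB rB.
  have /choice[C hC] i : exists C, exists D, [/\ measurable C, measurable D & B i = C `*` D].
    exact: rB.
  have {hC} /choice[D hCD] i := hC i.
  have hE i : pair_event i (B i) = e i @^-1` C i `&` g i @^-1` D i.
    by have [_ _ BE] := hCD i; rewrite /pair_event BE.
  rewrite (eq_bigcapr (fun i _ => hE i)).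
  rewrite indep_rectangles//; try by move=> j; have [] := hCD j.
  rewrite !big_seq; apply: eq_bigr => j _; rewrite hE.
  rewrite -[in RHS](bigcap_set1 (fun i => e i @^-1` C i `&` g i @^-1` D i) j).
  rewrite -(_ : [set` [:: j]] = [set j]).
    by rewrite indep_rectangles ?big_seq1//; try by move=> k; have [] := hCD k.
  by apply/seteqP; split => k /=; rewrite inE => /eqP.
move=> /= /andP[iJ uJ] mB rB.
rewrite bigcap_seq_cons big_cons.
set Q := \bigcap_(k in _) _.
have mQ : measurable Q by apply: measurable_bigcap_seq => k; exact: m_pair_event.
pose B' A1 A2 k := if k == i then (A1 `*` A2 : set (R * R)) else B k.
have key A1 A2 : measurable A1 -> measurable A2 ->
    P (pair_event i (A1 `*` A2) `&` Q) =
    (P (e i @^-1` A1) * P (g i @^-1` A2) * \prod_(k <- J1 ++ J2) P (pair_event k (B k)))%E.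
  move=> mA1 mA2.
  have := IH (i :: J2) (B' A1 A2).
  have pJ : perm_eq (J1 ++ i :: J2) (i :: J1 ++ J2).
    by rewrite -cat1s perm_catCA.
  rewrite (perm_uniq pJ) /= iJ uJ => /(_ isT) h.
  have mB' k : measurable (B' A1 A2 k).
    by rewrite /B'; case: ifP => _ //; exact: measurableX.
  have rB' k : k \notin J1 -> isrect (B' A1 A2 k).
    rewrite /B' => kJ; have [_|ki] := eqVneq k i; first by exists A1, A2.
    by apply: rB; rewrite in_cons negb_or ki kJ.
  have {h} := h mB' rB'.
  rewrite (perm_big _ pJ) /= big_cons.
  rewrite (_ : [set` (J1 ++ i :: J2)] = [set` i :: J1 ++ J2]); last first.
    by apply/seteqP; split => k /=; rewrite (perm_mem pJ).
  rewrite bigcap_seq_cons [B' A1 A2 i]/B' eqxx.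
  have -> : \bigcap_(k in [set` J1 ++ J2]) pair_event k (B' A1 A2 k) = Q.
    apply: eq_bigcapr => k /= kJ; rewrite /B'; case: eqP => // ki; by move: iJ; rewrite -ki kJ.
  rewrite [X in (_ * X)%E](_ : _ = \prod_(k <- J1 ++ J2) P (pair_event k (B k)))%E; last first.
    rewrite !big_seq; apply: eq_bigr => k kJ; rewrite /B'.
    by case: eqP => // ki; move: iJ; rewrite -ki kJ.
  move=> ->; congr (_ * _)%E.
  have -> : pair_event i (A1 `*` A2) = \bigcap_(k in [set` [:: i]]) (e k @^-1` A1 `&` g k @^-1` A2).
    by rewrite bigcap_seq_cons (_ : [set` [::]] = set0) ?bigcap_set0 ?setIT//; apply/seteqP; split.
  by rewrite (indep_rectangles (C := fun=> A1) (D := fun=> A2))// big_seq1.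
have PQ : P Q = (\prod_(k <- J1 ++ J2) P (pair_event k (B k)))%E.
  have := key setT setT measurableT measurableT.
  rewrite !preimage_setT !probability_setT !mul1e => <-; congr (P _).
  by rewrite setXTT /pair_event (_ : [set w | _] = setT) ?setTI//; apply/seteqP; split.
have ind2 := @prob_pair_indep_event (e i) (g i) Q mQ.
rewrite /pair_event ind2//; last first.
  by move=> A1 A2 mA1 mA2; rewrite PQ -key//; congr (P _).
rewrite PQ; congr (_ * _)%E.
have := @prob_pair_indep_event (e i) (g i) setT measurableT.
move=> /(_ _ (B i) (mB i)); rewrite setIT probability_setT mule1 => -> //.
move=> A1 A2 mA1 mA2; rewrite setIT mule1.
have -> : e i @^-1` A1 `&` g i @^-1` A2
    = \bigcap_(k in [set` [:: i]]) (e k @^-1` A1 `&` g k @^-1` A2).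
  by rewrite bigcap_seq_cons (_ : [set` [::]] = set0) ?bigcap_set0 ?setIT//; apply/seteqP; split.
by rewrite (indep_rectangles (C := fun=> A1) (D := fun=> A2))// big_seq1.
Qed.

Lemma indep_pairs (J : seq I) (B : I -> set (R * R)) :
  uniq J -> (forall i, measurable (B i)) ->
  P (\bigcap_(i in [set` J]) [set w | B i (e i w, g i w)])
  = (\prod_(i <- J) P [set w | B i (e i w, g i w)])%E.
Proof.
move=> uJ mB.
pose B' i := if i \in J then B i else setT `*` setT.
have mB' i : measurable (B' i) by rewrite /B'; case: ifP => // _; exact: measurableX.
have := @indep_pairs_mixed J [::] B'; rewrite cats0 => /(_ uJ mB') h.
transitivity (P (\bigcap_(i in [set` J]) pair_event i (B' i))).
  by congr (P _); apply: eq_bigcapr => i /= iJ; rewrite /B' iJ.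
rewrite h; last by move=> i iJ; rewrite /B' (negbTE iJ); exists setT, setT.
by rewrite !big_seq; apply: eq_bigr => i iJ; rewrite /B' iJ.
Qed.

Lemma law_pair (i : I) (B : set (R * R)) : measurable B ->
  P [set w | B (e i w, g i w)] = (distribution P (e i) \x distribution P (g i))%E B.
Proof.
move=> mB.
have := @prob_pair_indep_event (e i) (g i) setT measurableT.
move=> /(_ _ B mB); rewrite setIT probability_setT mule1 => -> //.
move=> A1 A2 mA1 mA2; rewrite setIT mule1.
have -> : e i @^-1` A1 `&` g i @^-1` A2
    = \bigcap_(k in [set` [:: i]]) (e k @^-1` A1 `&` g k @^-1` A2).
  by rewrite bigcap_seq_cons (_ : [set` [::]] = set0) ?bigcap_set0 ?setIT//; apply/seteqP; split.
by rewrite (indep_rectangles (C := fun=> A1) (D := fun=> A2))// big_seq1.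
Qed.

End family.
End independence_of_pairs.

(** * Crossing a uniform threshold with a noisy predictor *)

Section uniform_threshold.
Context {R : realType}.
Local Notation U := (uniform_prob (@ltr01 R)).

Lemma uniform_prob_unit_interval (A : set R) : measurable A ->
  U A = lebesgue_measure (A `&` `[0, 1]).
Proof.
move=> mA; rewrite /uniform_prob integral_uniform_pdf.
rewrite (eq_integral (cst 1%E)); last first.
  move=> x; rewrite inE => -[_ /=]; rewrite in_itv /= /uniform_pdf => ->.
  by rewrite subr0 invr1.
by rewrite integral_cst ?mul1e//; exact: measurableI.
Qed.

Lemma measurable_le_halfline (z : R) : measurable [set y : R | y <= z].
Proof.
rewrite (_ : [set y | _] = `]-oo, z]%classic); first exact: measurable_itv.
by apply/seteqP; split => y /=; rewrite in_itv.
Qed.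

Lemma uniform_prob_le (z : R) : 0 <= z -> (U [set y | (y <= z)%R] <= z%:E)%E.
Proof.
move=> z0; rewrite uniform_prob_unit_interval; last exact: measurable_le_halfline.
apply: (@le_trans _ _ (lebesgue_measure (`[0, z]%classic : set R))).
  rewrite le_measure ?inE //.
  - by apply: measurableI => //; exact: measurable_le_halfline.
  - by move=> y /= []; rewrite !in_itv /= => yz /andP[-> _].
rewrite lebesgue_measure_itv /= lte_fin; case: ifP => _; last by rewrite lee_fin.
by rewrite sube0.
Qed.

Lemma uniform_prob_ge (z : R) : z <= 1 -> (z%:E <= U [set y | (y <= z)%R])%E.
Proof.
move=> z1; rewrite uniform_prob_unit_interval; last exact: measurable_le_halfline.
have [z0|z0] := leP z 0; first by rewrite (@le_trans _ _ 0%E)// lee_fin.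
apply: (@le_trans _ _ (lebesgue_measure (`[0, z]%classic : set R))).
  by rewrite lebesgue_measure_itv /= lte_fin z0 sube0.
rewrite le_measure ?inE //.
- by apply: measurableI => //; exact: measurable_le_halfline.
- by move=> y /=; rewrite !in_itv /= => /andP[-> yz]; rewrite yz (le_trans yz).
Qed.

End uniform_threshold.

Section threshold_probability.
Context {d : measure_display} {Om : measurableType d} {R : realType}.
Variables (P : probability Om R) (e g : {RV P >-> R}).
Hypothesis law_eg : forall B : set (R * R), measurable B ->
  P [set w | B (e w, g w)] = (distribution P e \x distribution P g)%E B.
Hypothesis g_unif : forall B : set R, measurable B ->
  distribution P g B = uniform_prob (@ltr01 R) B.

Lemma measurable_threshold_pairs (c : R) :
  measurable [set p : R * R | p.2 <= c + p.1].
Proof.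
have mf : measurable_fun setT (fun p : R * R => p.2 <= c + p.1).
  apply: measurable_fun_ler => //.
  by apply: measurable_funD => //.
rewrite (_ : [set p | _] = (fun p : R * R => p.2 <= c + p.1) @^-1` [set true]) //.
by rewrite -[X in measurable X]setTI; apply: mf.
Qed.

Lemma prob_threshold (c : R) :
  P [set w | (g w <= c + e w)%R]
  = (\int[P]_w uniform_prob (@ltr01 R) [set y | (y <= c + e w)%R])%E.
Proof.
pose B := [set p : R * R | p.2 <= c + p.1].
have mB : measurable B := measurable_threshold_pairs c.
rewrite (_ : [set w | _] = [set w | B (e w, g w)])// law_eg//.
rewrite /product_measure1 ge0_integral_distribution//; last first.
  exact: measurable_fun_xsection.
apply: eq_integral => w _ /=; rewrite g_unif; last exact: measurable_xsection.
by congr (uniform_prob _ _); apply/seteqP; split => y; rewrite /xsection /= inE.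
Qed.

Hypothesis e_mean0 : ('E_P[e] = 0)%E.
Variable M : R.
Hypothesis e_bounded : {ae P, forall w, `|e w| <= M}.

Lemma integrable_bounded_noise : P.-integrable setT (fun w => (e w)%:E).
Proof.
apply/integrableP; split; first by apply/measurable_EFinP; exact: measurable_funPT.
apply: (@le_lt_trans _ _ (\int[P]_w (`|M|%:E))%E); last first.
  by rewrite integral_cst//= probability_setT mule1 ltry.
apply: ae_ge0_le_integral => //=.
- by apply/measurable_EFinP; apply: measurableT_comp => //; exact: measurable_funPT.
- by near=> w => _; rewrite lee_fin (@le_trans _ _ M) ?ler_norm//; near: w; exact: e_bounded.
Unshelve. all: by end_near. Qed.

Lemma integral_shifted_noise (c : R) : (\int[P]_w (c + e w)%:E = c%:E)%E.
Proof.
under eq_integral do rewrite EFinD.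
rewrite integralD//=; last 2 first.
- exact: finite_measure_integrable_cst.
- exact: integrable_bounded_noise.
rewrite integral_cst//= probability_setT mule1.
by move: e_mean0; rewrite unlock => ->; rewrite adde0.
Qed.

Lemma measurable_uniform_section (c : R) :
  measurable_fun setT (fun w => uniform_prob (@ltr01 R) [set y | (y <= c + e w)%R]).
Proof.
pose B := [set p : R * R | p.2 <= c + p.1].
have mB : measurable B := measurable_threshold_pairs c.
have -> : (fun w => uniform_prob (@ltr01 R) [set y | (y <= c + e w)%R])
    = (uniform_prob (@ltr01 R) \o xsection B) \o e.
  apply/funext => w /=; congr (uniform_prob _ _).
  by apply/seteqP; split => y; rewrite /xsection /= inE.
apply: measurableT_comp; last exact: measurable_funPT.
exact: measurable_fun_xsection.
Qed.

Let integrable_shift (c : R) : P.-integrable setT (fun w => (c + e w)%:E).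
Proof.
rewrite (_ : (fun w => _) = (fun w => (c%:E + (e w)%:E)%E)); last first.
  by apply/funext => w; rewrite EFinD.
apply: integrableD => //; first exact: finite_measure_integrable_cst.
exact: integrable_bounded_noise.
Qed.

Let measurable_shift (c : R) : measurable_fun setT (fun w => c + e w).
Proof. by apply: measurable_funD => //; exact: measurable_funPT. Qed.

Let mpos (c : R) : measurable_fun setT (fun w => (Num.max 0 (c + e w))%:E).
Proof.
apply/measurable_EFinP; apply: measurable_maxr => //; exact: measurable_shift.
Qed.

(** The upper bound needs only nonnegativity of the noisy predictor, and [prob_threshold_ge] only
    that it is at most 1. They are kept apart because a candidate predictor need not satisfy
    both. *)
Lemma prob_threshold_le (c : R) : {ae P, forall w, 0 <= c + e w} ->
  (P [set w | (g w <= c + e w)%R] <= c%:E)%E.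
Proof.
move=> h; rewrite prob_threshold.
rewrite -[leRHS]integral_shifted_noise.
apply: (@le_trans _ _ (\int[P]_w (Num.max 0 (c + e w))%:E)%E).
  apply: ae_ge0_le_integral => //=.
  - exact: measurable_uniform_section.
  - by move=> w _; rewrite lee_fin le_max lexx.
  - near=> w => _.
    have cw : 0 <= c + e w by near: w; exact: h.
    by rewrite max_r//; exact: uniform_prob_le.
rewrite (@ae_eq_integral _ _ _ P setT (fun w => (c + e w)%:E)) //=.
- by apply/measurable_EFinP; exact: measurable_shift.
- near=> w => _; rewrite max_r//; near: w; exact: h.
Unshelve. all: by end_near. Qed.

Lemma prob_threshold_ge (c : R) : {ae P, forall w, c + e w <= 1} ->
  (c%:E <= P [set w | (g w <= c + e w)%R])%E.
Proof.
move=> h; rewrite prob_threshold.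
rewrite -[leLHS]integral_shifted_noise.
apply: (@le_trans _ _ (\int[P]_w (Num.max 0 (c + e w))%:E)%E).
  apply: le_integral => //.
    rewrite (_ : (fun w => _) = (fun w => (c + e w)%:E)^\+)%E; last first.
      by apply/funext => w; rewrite unlock EFin_max maxC.
    exact: integrable_funepos.
  by move=> w _; rewrite lee_fin le_max lexx orbT.
apply: ae_ge0_le_integral => //=.
- by move=> w _; rewrite lee_fin le_max lexx.
- exact: measurable_uniform_section.
- near=> w => _.
  have cw : c + e w <= 1 by near: w; exact: h.
  have [c0|c0] := leP 0 (c + e w); first exact: uniform_prob_ge.
  by rewrite measure_ge0.
Unshelve. all: by end_near. Qed.

End threshold_probability.

(** * Finite-valued functions of independent noises *)

Section finite_valued.
Context {d : measure_display} {Om : measurableType d} {R : realType}.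
Variable P : probability Om R.

Lemma expectation_finite (F : finType) (Z : Om -> F) (phi : F -> R) :
  (forall a, measurable [set w | Z w = a]) ->
  ('E_P[fun w => phi (Z w)]
   = (\sum_a fine (P [set w | Z w = a]) * phi a)%:E)%E.
Proof.
move=> mZ; rewrite unlock.
transitivity (\int[P]_w (\sum_a (phi a * \1_[set w | Z w = a] w)%:E))%E.
  apply: eq_integral => w _; rewrite sumEFin (bigD1 (Z w))//= indicE mem_set//= mulr1.
  rewrite big1 ?addr0// => a aZ; rewrite indicE memNset ?mulr0//=.
  by move=> ZE; move: aZ; rewrite ZE eqxx.
have ind a : P.-integrable setT (fun w => (phi a * \1_[set w | Z w = a] w)%:E).
  under eq_fun do rewrite EFinM.
  by apply: integrableZl => //; exact: integrable_indic.
rewrite integral_sum// -sumEFin; apply: eq_bigr => a _.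
under eq_integral do rewrite EFinM.
rewrite integralZl//; last exact: integrable_indic.
rewrite integral_indic// setIT EFinM fineK 1?muleC//.
exact: fin_num_measure.
Qed.

Lemma fine_prob_sum1 (F : finType) (Z : Om -> F) :
  (forall a, measurable [set w | Z w = a]) ->
  \sum_a fine (P [set w | Z w = a]) = 1.
Proof.
move=> mZ; have := expectation_finite (fun=> 1) mZ.
rewrite expectation_cst => -[]; under eq_bigr do rewrite mulr1.
by [].
Qed.

Lemma joint_law_finite (K F : finType) (e g : K -> {RV P >-> R})
    (D : K -> R * R -> F) (rho : K -> F) :
  mutually_independent P
    (fun i : K + K => match i with inl i => (e i : Om -> R) | inr i => g i end) ->
  (forall k a, measurable [set p | D k p = a]) ->
  P [set w | forall k, D k (e k w, g k w) = rho k]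
  = (\prod_k P [set w | D k (e k w, g k w) = rho k])%E.
Proof.
move=> ind mD.
have := indep_pairs ind (enum_uniq K) (B := fun k => [set p | D k p = rho k]).
move=> /(_ (fun k => mD k _)); rewrite big_enum /= => <-.
congr (P _); apply/seteqP; split => w h k; first by move=> _; exact: h.
by apply: h; rewrite /= mem_enum.
Qed.

Lemma mutually_independent_inj (I K : choiceType) (f : K -> I) (Z : I -> Om -> R) :
  injective f -> mutually_independent P Z -> mutually_independent P (Z \o f).
Proof.
move=> inj_f ind J B uJ mB.
(* By injectivity the intersection has a single term, so [B' (f j)] is [B j] without an inverse of
   [f]. *)
pose B' i := if i \in map f J then \bigcap_(j in [set j | f j = i]) B j else setT.
have B'f j : j \in J -> B' (f j) = B j.
  move=> jJ; rewrite /B' map_f//; apply/seteqP; split => x; first exact.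
  by move=> Bx k /= /inj_f ->.
have mB' i : measurable (B' i).
  have [iJ|iJ] := boolP (i \in map f J); last by rewrite /B' (negbTE iJ).
  by move/mapP : iJ => [j jJ ->]; rewrite B'f.
have := @ind (map f J) B'; rewrite map_inj_uniq// => /(_ uJ mB').
rewrite big_map big_seq => h.
transitivity (P (\bigcap_(i in [set` [seq f i | i <- J]]) Z i @^-1` B' i)).
  congr (P _); apply/seteqP; split => w H.
    by move=> i /= /mapP[j jJ ->]; rewrite B'f//; exact: H.
  by move=> j jJ; have := H (f j) (map_f f jJ); rewrite B'f.
by rewrite h [RHS]big_seq; apply: eq_bigr => j jJ; rewrite B'f.
Qed.

End finite_valued.

(** * Replacing noise and threshold by a finite rank *)

Section discretization.
Context {R : realType} {V : finType}.
Variable G : blm R V.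

Definition nb_configs : nat := #|{: {ffun V -> bool}}|.

(* The response of a node to its parents is determined by the number of
   configurations whose linear predictor stays below the threshold. *)
Definition disc (v : V) (p : R * R) : 'I_nb_configs.+1 :=
  if v == root G then ord0
  else inord #|[pred y | lin_pred G y v + p.1 < p.2]|.

(** Discrete noises are at most [nb_configs], so the ranks 0 and [nb_configs.+1] force the values 0
    and 1. *)
Definition net_rank (iv : intervention) (v : V) (x : {ffun V -> bool}) : nat :=
  if iv v is Some b then (if b then nb_configs.+1 else 0%N)
  else if v == root G then nb_configs.+1
  else #|[pred y | lin_pred G y v <= lin_pred G x v]|.

(** Both sides count initial segments of the configurations ordered by predictor; [x] lies in the
    second segment, and it lies outside the first exactly when the threshold is met. *)
Lemma disc_lt_rank iv v x p : iv v = None -> v != root G ->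
  (disc v p < net_rank iv v x)%N = (p.2 <= lin_pred G x v + p.1).
Proof.
move=> ivv vr; rewrite /disc /net_rank ivv (negbTE vr).
rewrite inordK ?ltnS ?max_card//.
have [h|h] := leP p.2 (lin_pred G x v + p.1).
  apply: proper_card; apply/fintype.properP; split.
    apply/fintype.subsetP => y; rewrite !inE => hy.
    by have := lt_le_trans hy h; rewrite ltrD2r => /ltW.
  by exists x; rewrite !inE ?lexx// -leNgt.
apply/negbTE; rewrite -leqNgt; apply: subset_leq_card; apply/fintype.subsetP => y.
by rewrite !inE => hy; apply: le_lt_trans h; rewrite lerD2r.
Qed.

Lemma solve_net iv (e g : V -> R) :
  solve G iv e g = net (net_rank iv) [ffun v => disc v (e v, g v)].
Proof.
rewrite /solve /net; elim: #|V| => //= n ->; apply/ffunP => v; rewrite !ffunE.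
case E : (iv v) => [b|].
  by rewrite /net_rank E; case: b {E}; rewrite ?ltn_ord.
have [vr|vr] /= := boolP (v == root G); first by rewrite /net_rank E vr ltn_ord.
by rewrite disc_lt_rank.
Qed.

Lemma net_rank_local iv v (x y : {ffun V -> bool}) :
  (forall z, edge G z v -> x z = y z) -> net_rank iv v x = net_rank iv v y.
Proof.
move=> h; rewrite /net_rank; case: (iv v) => //; case: ifP => // _.
suff -> : lin_pred G x v = lin_pred G y v by [].
by apply: eq_bigr => z ez; rewrite h.
Qed.

Lemma lin_pred_mono (x y : {ffun V -> bool}) v :
  (forall z, edge G z v -> 0 <= weight G z v) ->
  (forall z, x z ==> y z) -> lin_pred G x v <= lin_pred G y v.
Proof.
move=> w0 xy; apply: ler_sum => z ez; apply: ler_wpM2l; first exact: w0.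
by have := xy z; case: (x z); case: (y z).
Qed.

Lemma net_rank_mono iv :
  (forall z v, edge G z v -> 0 <= weight G z v) ->
  forall v (x y : {ffun V -> bool}), (forall z, x z ==> y z) ->
  (net_rank iv v x <= net_rank iv v y)%N.
Proof.
move=> w0 v x y xy; rewrite /net_rank; case: (iv v) => //; case: ifP => // _.
apply: subset_leq_card; apply/fintype.subsetP => z; rewrite !inE => h.
by apply: le_trans h _; apply: lin_pred_mono => // ?; exact: w0.
Qed.

Lemma measurable_disc v b : measurable [set p : R * R | disc v p = b].
Proof.
rewrite /disc; case: eqP => _.
  have [->|b0] := eqVneq ord0 b; last first.
    by rewrite (_ : [set p | _] = set0)//; apply/seteqP; split => // p /= /eqP; rewrite (negbTE b0).
  by rewrite (_ : [set p | _] = setT)//; apply/seteqP; split.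
(* The set of configurations below the threshold takes finitely many values, each on an event cut
   out by finitely many linear inequalities. *)
pose Z (p : R * R) : {set {ffun V -> bool}} := [set y | lin_pred G y v + p.1 < p.2]%SET.
have mZ A : measurable [set p | Z p = A].
  have -> : [set p | Z p = A] = \bigcap_(y in [set` enum {: {ffun V -> bool}}])
      [set p | (lin_pred G y v + p.1 < p.2) = (y \in A)].
    apply/seteqP; split => p /=; first by move=> <- y _ /=; rewrite inE.
    by move=> h; apply/setP => y; rewrite inE; apply: h; rewrite /= mem_enum.
  apply: measurable_bigcap_seq => y.
  rewrite (_ : [set p | _] = (fun p : R * R => lin_pred G y v + p.1 < p.2) @^-1` [set y \in A])//.
  rewrite -[X in measurable X]setTI.
  have : measurable_fun setT (fun p : R * R => lin_pred G y v + p.1 < p.2).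
    by apply: measurable_fun_ltr => //; apply: measurable_funD.
  by apply.
rewrite (_ : [set p | _] = \bigcup_(A in [set A : {set {ffun V -> bool}} | inord #|A| = b]) [set p | Z p = A]).
  by apply: fin_bigcup_measurable => // A _; exact: mZ.
apply/seteqP; split => p /=; last first.
  by move=> [A /= <- <-]; congr inord; apply: eq_card => y; rewrite !inE.
by move=> <-; exists (Z p) => //=; congr inord; apply: eq_card => y; rewrite !inE.
Qed.

End discretization.

Section network_law.
Context {R : realType} {V : finType}.
Context {d : measure_display} {Om : measurableType d}.
Variables (P : probability Om R) (G : blm R V) (e g : V -> {RV P >-> R}).
Hypothesis indep : mutually_independent P
  (fun i : V + V => match i with inl i => (e i : Om -> R) | inr i => g i end).

Definition disc_pmf (v : V) (b : 'I_(@nb_configs V).+1) : R :=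
  fine (P [set w | disc G v (e v w, g v w) = b]).

Lemma measurable_disc_event v b : measurable [set w | disc G v (e v w, g v w) = b].
Proof. exact: (measurable_pair_event (e v) (g v) (measurable_disc G v b)). Qed.

Lemma disc_pmf_ge0 v b : 0 <= disc_pmf v b.
Proof. exact: fine_ge0. Qed.

Lemma disc_pmf_sum1 v : \sum_b disc_pmf v b = 1.
Proof. by rewrite -[RHS](fine_prob_sum1 P (measurable_disc_event v)). Qed.

Definition disc_noise (w : Om) : {ffun V -> 'I_(@nb_configs V).+1} :=
  [ffun v => disc G v (e v w, g v w)].

Lemma disc_noiseE r : [set w | disc_noise w = r]
  = [set w | forall v, disc G v (e v w, g v w) = r v].
Proof.
apply/seteqP; split => w /=; first by move=> <- v; rewrite ffunE.
by move=> h; apply/ffunP => v; rewrite ffunE.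
Qed.

Lemma measurable_disc_noise r : measurable [set w | disc_noise w = r].
Proof.
rewrite disc_noiseE.
rewrite (_ : [set w | _] = \bigcap_(v in [set` enum V]) [set w | disc G v (e v w, g v w) = r v]).
  by apply: measurable_bigcap_seq => v; exact: measurable_disc_event.
apply/seteqP; split => w h v; first by move=> _; exact: h.
by apply: h; rewrite /= mem_enum.
Qed.

Lemma law_disc_noise r : P [set w | disc_noise w = r] = (wt disc_pmf r)%:E.
Proof.
rewrite disc_noiseE (joint_law_finite (D := disc G))//; last first.
  by move=> v b; exact: measurable_disc.
rewrite /wt -prodEFin; apply: eq_bigr => v _.
by rewrite /disc_pmf fineK// fin_num_measure//; exact: measurable_disc_event.
Qed.

Lemma expectation_solve iv (phi : {ffun V -> bool} -> R) :
  ('E_P[fun w => phi (solve G iv (e ^~ w) (g ^~ w))]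
   = (Ex disc_pmf (fun r => phi (net (net_rank G iv) r)))%:E)%E.
Proof.
rewrite (_ : (fun w => _) = (fun w => phi (net (net_rank G iv) (disc_noise w)))).
  rewrite (expectation_finite P (fun r => phi (net (net_rank G iv) r)) measurable_disc_noise).
  by congr EFin; apply: eq_bigr => r _; rewrite law_disc_noise.
by apply/funext => w; rewrite solve_net.
Qed.

Lemma mean_net iv v :
  mean P G iv (fun v => e v) (fun v => g v) v
  = Ex disc_pmf (fun r => (net (net_rank G iv) r v)%:R).
Proof. by rewrite /mean (expectation_solve iv (fun x => (x v)%:R)). Qed.

Lemma kernel_prob iv v x : iv v = None -> v != root G ->
  kernel (net_rank G iv) disc_pmf v x
  = fine (P [set w | g v w <= lin_pred G x v + e v w]).
Proof.
move=> ivv vr; rewrite /kernel.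
have := expectation_finite P (fun b : 'I__ => (b < net_rank G iv v x)%N%:R : R)
   (measurable_disc_event v).
move=> /(congr1 fine) /= <-; congr fine.
rewrite -expectation_indic; last first.
  exact: (measurable_pair_event (e v) (g v) (measurable_threshold_pairs (lin_pred G x v))).
congr expectation; apply/funext => w; rewrite disc_lt_rank//= indicE.
by congr (_%:R); congr nat_of_bool; apply/idP/idP => [h|/set_mem//]; exact: mem_set.
Qed.

End network_law.

(** * Observed law of a model with hidden variables *)

Section bounded_sequences.
Context {R : nmodType} {H : finType}.

(** A recursive enumeration, so that sums over bounded sequences can be split on the first
    element. *)
Fixpoint seqs_upto (n : nat) : seq (seq H) :=
  if n is n'.+1 then [::] :: [seq u :: p | u <- enum H, p <- seqs_upto n'] else [:: [::]].

Lemma mem_seqs_upto n (p : seq H) : (p \in seqs_upto n) = (size p <= n)%N.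
Proof.
elim: n p => [|n IH] [|u p] //=.
rewrite in_cons /= ltnS -IH; apply/allpairsP/idP => [[[v q] /= [_ qn [_ ->]]]//|pn].
by exists (u, p); rewrite mem_enum.
Qed.

Lemma uniq_seqs_upto n : uniq (seqs_upto n).
Proof.
elim: n => //= n IH; apply/andP; split; first by apply/negP => /allpairsP[[u p] []].
by apply: allpairs_uniq; rewrite ?enum_uniq// => -[u p] [v q] _ _ /= [-> ->].
Qed.

Lemma sum_bseq n (A : pred (seq H)) (F : seq H -> R) :
  \sum_(p : n.-bseq H | A p) F p = \sum_(p <- seqs_upto n | A p) F p.
Proof.
rewrite -(big_map (fun p : n.-bseq H => val p) A F) /=.
apply: perm_big; apply: uniq_perm; rewrite ?uniq_seqs_upto//.
  by rewrite map_inj_uniq ?index_enum_uniq//; exact: val_inj.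
move=> p; rewrite mem_seqs_upto; apply/mapP/idP => [[q _ ->]|pn]; first exact: size_bseq.
by exists (Bseq pn); rewrite ?mem_index_enum.
Qed.

End bounded_sequences.

(** * Weights of hidden paths *)

Section hidden_paths.
Context {R : realType} {H X : finType}.
Local Notation node := (H + option X)%type.
Variable G : blm R node.

(** Total weight of the paths from [z] to [o] with exactly [l] intermediate nodes, all hidden: in
    matrix form, a power of the hidden block applied to the edges into [o]. *)
Fixpoint hidden_weight (o : option X) (l : nat) (z : node) : R :=
  if l is l'.+1 then
    \sum_(u | edge G z (inl u)) weight G z (inl u) * hidden_weight o l' (inl u)
  else if edge G z (inr o) then weight G z (inr o) else 0.

Lemma sum_hidden_paths n z o :
  \sum_(p : n.-bseq H | hidden_path (edge G) z p o)
     path_weight G z (rcons (map inl p) (inr o))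
  = \sum_(l < n.+1) hidden_weight o l z.
Proof.
rewrite (sum_bseq n (fun p => hidden_path (edge G) z p o)
  (fun p => path_weight G z (rcons (map inl p) (inr o)))).
elim: n z => [|n IH] z.
  rewrite big_ord1 /= big_cons big_nil /hidden_path /= andbT.
  by case: ifP => _; rewrite ?mulr1 ?addr0.
rewrite big_ord_recl /= big_cons [X in if _ then _ + X else X]big_mkcond.
rewrite big_allpairs_dep /= {1}/hidden_path /= andbT.
under [X in if _ then _ + X else X]eq_bigr do rewrite -big_mkcond.
have -> : \sum_(u <- enum H) \sum_(p <- seqs_upto n | hidden_path (edge G) z (u :: p) o)
      (weight G z (inl u) * path_weight G (inl u) (rcons (map inl p) (inr o)))
    = \sum_(i < n.+1) hidden_weight o i.+1 z.
  rewrite big_enum /= [RHS]exchange_big /= [LHS](bigID (fun u => edge G z (inl u))) /=.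
  rewrite [X in _ + X]big1 ?addr0; last first.
    by move=> u /negbTE zu; rewrite big1_seq// => p; rewrite /hidden_path /= zu.
  apply: eq_bigr => u zu; rewrite -[RHS]mulr_sumr -IH mulr_sumr.
  by apply: eq_bigl => p; rewrite /hidden_path /= zu.
by case: ifP => _; rewrite ?mulr1 ?add0r.
Qed.

Lemma hidden_weight_path o l z : hidden_weight o l z != 0 ->
  exists2 p : seq H, size p = l & hidden_path (edge G) z p o.
Proof.
elim: l z => [|l IH] z /=.
  by case: ifP => zo; rewrite ?eqxx// => _; exists [::]; rewrite /hidden_path /= ?zo.
move=> /eqP h; have [u zu /IH[p ps pp]] : exists2 u, edge G z (inl u) & hidden_weight o l (inl u) != 0.
  apply/exists_inP; apply: contra_notT h => /exists_inPn h.
  rewrite big1// => u zu; have := h u zu; rewrite negbK => /eqP->; by rewrite mulr0.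
by exists (u :: p); rewrite /= ?ps// /hidden_path /= zu.
Qed.

Lemma hidden_weight_ge0 o l z :
  (forall z v, edge G z v -> 0 <= weight G z v) -> 0 <= hidden_weight o l z.
Proof.
move=> w0; elim: l z => [|l IH] z /=; first by case: ifP => // /w0.
by apply: sumr_ge0 => u zu; rewrite mulr_ge0// w0.
Qed.

Lemma path_connect_last (e : rel node) z p : path e z p ->
  forall y, y \in z :: p -> connect e z y /\ connect e y (last z p).
Proof.
elim: p z => [|w p IH] z /=.
  by move=> _ y; rewrite inE => /eqP->; rewrite connect0.
move=> /andP[zw pw] y; rewrite inE => /orP[/eqP->|yp].
  split; first exact: connect0.
  by apply: connect_trans (connect1 zw) _; have [] := IH w pw w (mem_head _ _).
by have [wy yl] := IH w pw y yp; split=> //; apply: connect_trans (connect1 zw) wy.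
Qed.

Lemma hidden_path_connect z p o : hidden_path (edge G) z p o ->
  connect (edge G) z (inr o).
Proof.
move=> h; have [_] := path_connect_last h (mem_head _ _).
by rewrite last_rcons.
Qed.

Hypothesis acyc : acyclic (edge G).

Lemma path_uniq_acyclic z p : path (edge G) z p -> uniq (z :: p).
Proof.
elim: p z => //= w p IH z /andP[zw pw]; rewrite IH//= andbT.
apply/negP => zp; have /negP := acyc zw; apply.
by have [] := path_connect_last pw zp.
Qed.

(** Starting from a hidden node, such a path would visit more than [#|H|] hidden nodes, hence repeat
    one. *)
Lemma hidden_weight_long o l u : (#|H| <= l)%N -> hidden_weight o l (inl u) = 0.
Proof.
move=> Hl; apply/eqP; apply: contraTT Hl => /hidden_weight_path[p ps hp].
have := path_uniq_acyclic hp.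
rewrite -rcons_cons rcons_uniq => /andP[_].
rewrite -(map_cons inl) map_inj_uniq => [up|? ? []//].
by rewrite -ltnNge -ps -[(size p).+1]/(size (u :: p)) -(card_uniqP up) max_card.
Qed.

(* Repeatedly substituting the linear equations of the hidden nodes. *)
Lemma hidden_path_expansion (u0 : H) (o : option X) (m : node -> R) :
  (forall v, ~~ edge G v (inl u0)) ->
  m (inr o) = \sum_(z | edge G z (inr o)) weight G z (inr o) * m z ->
  (forall u, u != u0 -> (exists p, hidden_path (edge G) (inl u) p o) ->
    m (inl u) = \sum_(z | edge G z (inl u)) weight G z (inl u) * m z) ->
  m (inr o) = \sum_i (\sum_(l < #|H|.+1) hidden_weight o l (inr i)) * m (inr i)
     + (\sum_(l < #|H|.+1) hidden_weight o l (inl u0)) * m (inl u0).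
Proof.
move=> u0_src mo mu.
(* [src l] collects the terms that stop after [l] hidden nodes, at an observed node or at [u0];
   [rem l] collects those still to be expanded and vanishes at [l = #|H|]. *)
pose src l := \sum_i hidden_weight o l (inr i) * m (inr i)
  + hidden_weight o l (inl u0) * m (inl u0).
pose rem l := \sum_(u | u != u0) hidden_weight o l (inl u) * m (inl u).
have split l : \sum_z hidden_weight o l z * m z = src l + rem l.
  rewrite big_sumType /= addrC /src /rem -addrA; congr (_ + _).
  by rewrite (bigD1 u0).
have step l : rem l = src l.+1 + rem l.+1.
  rewrite -split /rem /=.
  under [RHS]eq_bigr do rewrite mulr_suml.
  rewrite (exchange_big_dep xpredT) //=.
  rewrite [RHS](bigD1 u0)//= [X in _ = X + _]big_pred0 ?add0r; last first.
    by move=> z; exact/negbTE/u0_src.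
  apply: eq_bigr => u uu0.
  have [h|h] := eqVneq (hidden_weight o l (inl u)) 0.
    by rewrite h mul0r big1// => z _; rewrite mulr0 mul0r.
  have [p _ hp] := hidden_weight_path h.
  rewrite mu//; last by exists p.
  by rewrite mulr_sumr; apply: eq_bigr => z _; rewrite mulrCA mulrA.
have iterate n : m (inr o) = \sum_(l < n.+1) src l + rem n.
  elim: n => [|n IH].
    rewrite big_ord1 -split mo [LHS]big_mkcond; apply: eq_bigr => z _ /=.
    by case: ifP; rewrite ?mul0r.
  by rewrite IH [in RHS]big_ord_recr -addrA -step.
rewrite (iterate #|H|) [rem _]big1 ?addr0; last first.
  by move=> u _; rewrite hidden_weight_long// mul0r.
rewrite /src big_split /=; congr (_ + _); last by rewrite mulr_suml.
by rewrite exchange_big; apply: eq_bigr => i _; rewrite mulr_suml.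
Qed.

End hidden_paths.

(** * Consequences of the noise assumptions *)

Section blm_noise_theory.
Context {R : realType} {V : finType}.
Context {d : measure_display} {Om : measurableType d}.
Variables (P : probability Om R) (G : blm R V).
Variables eps gam : nat -> V -> {RV P >-> R}.
Hypothesis noiseP : blm_noise G eps gam.

Lemma noise_family_indep (K : choiceType) (f : K -> nat * V) : injective f ->
  mutually_independent P (fun i : K + K =>
    match i with inl k => (eps (f k).1 (f k).2 : Om -> R)
               | inr k => gam (f k).1 (f k).2 end).
Proof.
move=> inj_f.
pose f' (i : K + K) : (nat * V) + (nat * V) :=
  match i with inl k => inl (f k) | inr k => inr (f k) end.
have inj_f' : injective f' by move=> [x|x] [y|y] //= [] /inj_f ->.
have := mutually_independent_inj inj_f' (noise_indep noiseP).
congr mutually_independent; apply/funext => -[k|k] /=; by case: (f k).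
Qed.

Lemma noise_law_pair t v (B : set (R * R)) : measurable B ->
  P [set w | B (eps t v w, gam t v w)]
  = (distribution P (eps t v) \x distribution P (gam t v))%E B.
Proof.
exact: (law_pair (noise_family_indep (@inj_id (nat * V)%type)) (t, v)).
Qed.

Lemma noise_ae_bounded t v : v != root G ->
  exists M, {ae P, forall w, `|eps t v w| <= M}.
Proof.
move=> vr; pose x : {ffun V -> bool} := [ffun=> true].
have xr : x (root G) by rewrite ffunE.
exists (1 + `|lin_pred G x v|); near=> w.
have /andP[h0 h1] : 0 <= lin_pred G x v + eps t v w <= 1.
  by near: w; exact: (noise_range noiseP).
have -> : eps t v w = (lin_pred G x v + eps t v w) - lin_pred G x v by ring.
by rewrite (le_trans (ler_normB _ _))// lerD2r ger0_norm.
Unshelve. all: by end_near. Qed.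

Lemma noise_threshold_le t v c : v != root G ->
  {ae P, forall w, 0 <= c + eps t v w} ->
  (P [set w | (gam t v w <= c + eps t v w)%R] <= c%:E)%E.
Proof.
move=> vr h; have [M hM] := noise_ae_bounded t vr.
apply: (prob_threshold_le (noise_law_pair t v) _ _ hM) => //.
- exact: (threshold_unif noiseP).
- exact: (noise_mean0 noiseP).
Qed.

Lemma noise_threshold_ge t v c : v != root G ->
  {ae P, forall w, c + eps t v w <= 1} ->
  (c%:E <= P [set w | (gam t v w <= c + eps t v w)%R])%E.
Proof.
move=> vr h; have [M hM] := noise_ae_bounded t vr.
apply: (prob_threshold_ge (noise_law_pair t v) _ _ hM) => //.
- exact: (threshold_unif noiseP).
- exact: (noise_mean0 noiseP).
Qed.

Lemma kernel_lin t iv v (x : {ffun V -> bool}) : iv v = None -> v != root G -> x (root G) ->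
  kernel (net_rank G iv) (disc_pmf G (eps t) (gam t)) v x = lin_pred G x v.
Proof.
move=> ivv vr xr; rewrite kernel_prob//.
have h : {ae P, forall w, 0 <= lin_pred G x v + eps t v w <= 1} by exact: (noise_range noiseP).
suff -> : P [set w | gam t v w <= lin_pred G x v + eps t v w] = (lin_pred G x v)%:E by [].
apply/eqP; rewrite eq_le; apply/andP; split.
  apply: noise_threshold_le => //; by near=> w; have /andP[] : 0 <= lin_pred G x v + eps t v w <= 1 by near: w.
apply: noise_threshold_ge => //; by near=> w; have /andP[] : 0 <= lin_pred G x v + eps t v w <= 1 by near: w.
Unshelve. all: by end_near. Qed.

Lemma noise_pair_law_ident t v (B : set (R * R)) : measurable B ->
  P [set w | B (eps t v w, gam t v w)] = P [set w | B (eps 0%N v w, gam 0%N v w)].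
Proof.
move=> mB; rewrite !noise_law_pair//.
apply: (product_measure_unique (m1 := distribution P (eps t v))
  (m2 := distribution P (gam t v))) => // A1 A2 mA1 mA2.
transitivity (distribution P (eps 0%N v) A1 * distribution P (gam 0%N v) A2)%E.
  exact: product_measure1E.
congr (_ * _)%E; first exact: esym (noise_ident noiseP t v mA1).
exact: etrans (threshold_unif noiseP 0%N v mA2) (esym (threshold_unif noiseP t v mA2)).
Qed.

Lemma disc_pmf_ident t v b :
  disc_pmf G (eps t) (gam t) v b = disc_pmf G (eps 0%N) (gam 0%N) v b.
Proof. by rewrite /disc_pmf (noise_pair_law_ident t v (measurable_disc G v b)). Qed.

End blm_noise_theory.

Lemma connect_antisym (V : finType) (e : rel V) : acyclic e ->
  forall u v, connect e u v -> connect e v u -> u = v.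
Proof.
move=> acyc u v uv vu; apply/eqP; apply: contraT => neq.
have := nb_anc_lt acyc uv neq; rewrite eq_sym in neq.
by have := nb_anc_lt acyc vu neq; case: ltngtP.
Qed.

Lemma first_observed (H X : finType) (e : rel (H + option X)) (u : H) (i : option X) :
  connect e (inl u) (inr i) ->
  exists j p, hidden_path e (inl u) p j /\ connect e (inr j) (inr i).
Proof.
case/connectP => p; elim: p u => [|[w|j] p IH] u //= /andP[uw pw] lst.
  have [j [q [hq cji]]] := IH w pw lst; exists j, (w :: q); split=> //.
  by rewrite /hidden_path /= uw.
exists j, [::]; split; first by rewrite /hidden_path /= uw.
by apply/connectP; exists p.
Qed.

(** * Averaging over the cone of an observed node *)

Section observed_law.
Context {R : realType} {H X : finType}.
Local Notation node := (H + option X)%type.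
Variables (G : blm R node) (u0 : H).
Hypothesis adm : admissible G u0.
Variable pi : node -> 'I_(@nb_configs node).+1 -> R.
Hypothesis pi_ge0 : forall v b, 0 <= pi v b.
Hypothesis pi_sum1 : forall v, \sum_b pi v b = 1.
Hypothesis kernelE : forall iv v (x : {ffun node -> bool}),
  iv v = None -> v != root G -> x (root G) ->
  kernel (net_rank G iv) pi v x = lin_pred G x v.

Let acyc := adm_acyclic adm.
Let w_ge0 z v : edge G z v -> 0 <= weight G z v.
Proof. by move=> /(adm_weight adm) /andP[]. Qed.

Definition hidden_coef (o i : option X) : R :=
  \sum_(l < #|H|.+1) hidden_weight G o l (inr i).

Definition hidden_base (o : option X) : R :=
  \sum_(l < #|H|.+1) hidden_weight G o l (inl u0).

Definition obs_pred (o : option X) (x : {ffun option X -> bool}) : R :=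
  hidden_base o + \sum_i hidden_coef o i * (x i)%:R.

Definition cone (o : option X) : {set node} :=
  [set v | match v with
           | inl u => (u != u0) && `[< exists p, hidden_path (edge G) (inl u) p o >]
           | inr i => i == o
           end]%SET.

Lemma hidden_coef_ge0 o i : 0 <= hidden_coef o i.
Proof. by apply: sumr_ge0 => l _; exact: hidden_weight_ge0. Qed.

Lemma hidden_base_ge0 o : 0 <= hidden_base o.
Proof. by apply: sumr_ge0 => l _; exact: hidden_weight_ge0. Qed.

Lemma hidden_coef_path o i : hidden_coef o i != 0 ->
  exists p, hidden_path (edge G) (inr i) p o.
Proof.
move=> h; have [l hl] : exists l : 'I_#|H|.+1, hidden_weight G o l (inr i) != 0.
  apply/existsP; apply: contra_neqT h => /existsPn h.
  by rewrite /hidden_coef big1// => l _; apply/eqP; rewrite -[_ == _]negbK; exact: h.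
by have [p _] := hidden_weight_path hl; exists p.
Qed.

Lemma obs_edgeP (i o : option X) :
  reflect (exists p, hidden_path (edge G) (inr i) p o) (edge' G (Some i) (Some o)).
Proof.
apply: (iffP existsP) => [[p hp]|[p hp]]; first by exists p.
have := path_uniq_acyclic acyc hp.
rewrite /= rcons_uniq => /andP[_] /andP[_].
rewrite map_inj_uniq => [up|? ? []//].
have sp : (size p <= #|H|)%N by rewrite -(card_uniqP up) max_card.
by exists (Bseq sp).
Qed.

Lemma obs_edge_connect (i o : option X) : edge' G (Some i) (Some o) ->
  connect (edge G) (inr i) (inr o).
Proof. by move=> /obs_edgeP[p]; exact: hidden_path_connect. Qed.

Lemma obs_edge_irrefl (o : option X) : edge' G (Some o) (Some o) = false.
Proof.
apply: contraFF (erefl false) => oo; have [p] := elimT (obs_edgeP o o) oo.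
case: p => [|u p]; rewrite /hidden_path /=.
  by rewrite andbT => /acyc; rewrite connect0.
move=> /andP[ou hp]; have := acyc ou; rewrite (_ : connect _ _ _ = true)//.
exact: (@hidden_path_connect _ _ _ G (inl u) p o hp).
Qed.

Lemma hidden_coef_edge o i : ~~ edge' G (Some i) (Some o) -> hidden_coef o i = 0.
Proof.
by move=> h; apply/eqP; apply: contraNT h => /hidden_coef_path ?; exact/obs_edgeP.
Qed.

Section intervention.
Variable iv : @intervention node.
Hypothesis iv_hidden : forall u, iv (inl u) = None.
Local Notation rk := (net_rank G iv).
Local Notation noise := {ffun node -> 'I_(@nb_configs node).+1}.

Let rk_local v (x y : {ffun node -> bool}) :
  (forall z, edge G z v -> x z = y z) -> rk v x = rk v y.
Proof. exact: net_rank_local. Qed.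

Lemma net_root (r : noise) : net rk r (root G).
Proof.
rewrite (net_fix acyc rk_local) /net_rank (adm_root adm) iv_hidden -(adm_root adm) eqxx.
exact: ltn_ord.
Qed.

Lemma avg_net_lin (C : {set node}) v (r : noise) : v \in C -> iv v = None -> v != root G ->
  avg pi C (fun r : noise => (net rk r v)%:R) r
  = \sum_(z | edge G z v) weight G z v * avg pi C (fun r : noise => (net rk r z)%:R) r.
Proof.
move=> vC ivv vr; rewrite (avg_net_kernel acyc rk_local pi_sum1)// /avg.
under eq_Ex do rewrite (kernelE ivv vr (net_root _)).
by rewrite /lin_pred Ex_sum; apply: eq_bigr => z _; rewrite ExZ.
Qed.

(** After averaging over the cone, the means satisfy the linear equation at every node of the cone,
    while the observed parents of [o] are not affected; expanding along hidden paths gives the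
    predictor of the transformed model. *)
Lemma avg_cone (o : option X) (r : noise) : iv (inr o) = None ->
  (forall i, edge' G (Some i) (Some o) ->
    indep_of (cone o) (fun r : noise => net rk r (inr i))) ->
  avg pi (cone o) (fun r : noise => (net rk r (inr o))%:R) r
  = obs_pred o [ffun i => net rk r (inr i)].
Proof.
move=> ivo ind.
pose m v := avg pi (cone o) (fun r : noise => (net rk r v)%:R) r.
have u0r : inl u0 = root G by rewrite (adm_root adm).
transitivity (m (inr o)); first by [].
rewrite (@hidden_path_expansion _ _ _ G acyc u0 o m (adm_U0_source adm)); last 2 first.
- by apply: avg_net_lin => //; rewrite ?finset.inE//= -u0r.
- move=> u uu0 hp; apply: avg_net_lin => //; last by rewrite -u0r; apply/eqP => -[] /eqP; rewrite (negbTE uu0).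
  by rewrite finset.inE /= uu0; apply/asboolP.
rewrite addrC /obs_pred; congr (_ + _).
  rewrite -[RHS]mulr1; congr (_ * _); rewrite /m u0r -[RHS](Ex_cst pi_sum1).
  by apply: eq_Ex => s; rewrite net_root.
apply: eq_bigr => i _; rewrite -/(hidden_coef o i) ffunE.
have [->|/hidden_coef_path/obs_edgeP oi] := eqVneq (hidden_coef o i) 0; first by rewrite !mul0r.
congr (_ * _); rewrite /m (@avg_id _ _ _ _ pi_sum1 _ (fun r : noise => (net rk r (inr i))%:R))//.
by move=> s t; rewrite (ind i oi s t).
Qed.

(** If a hidden node of the cone led to [i], let [j] be the first observed node on the way. It is
    not [o], by acyclicity, and [o] is one of its descendants: this is the excluded confounding
    configuration. *)
Lemma net_obs_indep (o i : option X) : i != o ->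
  connect (edge G) (inr i) (inr o) ->
  indep_of (cone o) (fun r : noise => net rk r (inr i)).
Proof.
move=> io cio; apply: (net_indep acyc rk_local) => -[u|j]; rewrite finset.inE.
  move=> /andP[uu0 /asboolP[p hp]]; apply/negP => /first_observed[j [q [hq cji]]].
  have [jo|jo] := eqVneq j o.
    by move: io; have := connect_antisym acyc cio; rewrite -jo => /(_ cji) [->]; rewrite eqxx.
  apply: (adm_confounding adm uu0 jo (connect_trans cji cio)).
  by split; [exists q|exists p].
move=> /eqP ->; apply/negP => coi.
by move: io; have [->] := connect_antisym acyc cio coi; rewrite eqxx.
Qed.

Lemma net_parent_indep (o i : option X) : edge' G (Some i) (Some o) ->
  indep_of (cone o) (fun r : noise => net rk r (inr i)).
Proof.
move=> io; apply: net_obs_indep; last exact: obs_edge_connect.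
by apply/eqP => E; move: io; rewrite E obs_edge_irrefl.
Qed.

Definition obs (r : noise) : {ffun option X -> bool} := [ffun i => net rk r (inr i)].

Lemma obs_pred_indep o : indep_of (cone o) (fun r => obs_pred o (obs r)).
Proof.
move=> s r; rewrite /obs_pred; congr (_ + _); apply: eq_bigr => i _.
have [->|/hidden_coef_path/obs_edgeP oi] := eqVneq (hidden_coef o i) 0; first by rewrite !mul0r.
by rewrite !ffunE (net_parent_indep oi).
Qed.

Lemma Ex_obs_mul (o : option X) (f : {ffun option X -> bool} -> R) :
  iv (inr o) = None ->
  (forall x y : {ffun option X -> bool},
     (forall i, edge' G (Some i) (Some o) -> x i = y i) -> f x = f y) ->
  Ex pi (fun r => (obs r o)%:R * f (obs r)) = Ex pi (fun r => obs_pred o (obs r) * f (obs r)).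
Proof.
move=> ivo f_local; rewrite -(Ex_avg pi_sum1 (cone o)); apply: eq_Ex => r.
rewrite avg_mulr; last first.
  move=> s t; apply: f_local => i io; rewrite !ffunE.
  exact: (net_parent_indep io).
congr (_ * _); rewrite -avg_cone//; last by move=> i; exact: net_parent_indep.
by apply: eq_Ex => s; rewrite ffunE.
Qed.

Lemma Ex_obs_increasing (o : option X) (g : {ffun option X -> bool} -> R) :
  iv (inr o) = None ->
  (forall x y : {ffun option X -> bool}, (forall i, x i ==> y i) -> g x <= g y) ->
  Ex pi (fun r => obs_pred o (obs r) * g (obs r)) <= Ex pi (fun r => (obs r o)%:R * g (obs r)).
Proof.
move=> ivo g_incr.
have anti := net_antitone acyc rk_local (net_rank_mono iv w_ge0).
rewrite -(Ex_avg pi_sum1 (cone o)) -[leRHS](Ex_avg pi_sum1 (cone o)).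
apply: le_Ex => // r.
rewrite [leLHS](_ : _ = obs_pred o (obs r) * avg pi (cone o) (fun r => g (obs r)) r); last first.
  rewrite mulrC -(@avg_mulr _ _ _ pi _ (fun r => g (obs r)) _ r (@obs_pred_indep o)).
  by apply: eq_Ex => s; rewrite mulrC.
rewrite -avg_cone//; last by move=> i; exact: net_parent_indep.
rewrite [X in X * _](_ : _ = avg pi (cone o) (fun r => (obs r o)%:R) r); last first.
  by apply: eq_Ex => s; rewrite ffunE.
apply: harris_avg => // a b ab.
  rewrite !ffunE; have := anti _ a b ab (inr o).
  by case: (net _ b _); case: (net _ a _) => //= _; rewrite ler01.
by apply: g_incr => i; rewrite !ffunE; exact: anti.
Qed.

End intervention.

Definition do_others (x : {ffun option X -> bool}) (o : option X) : @intervention node :=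
  fun v => if v is inr o' then (if o' == o then None else Some (x o')) else None.

Lemma do_others0E o : do_others [ffun=> false] o = do_others0 o.
Proof. by apply/funext => -[u|o'] //=; case: eqP => // _; rewrite ffunE. Qed.

(** Forcing all other observed nodes to [x] exhibits the predictor as a probability. Hence its
    bounds, the value of the base rate, and, through [obs_pred_lin], the range of predictor plus
    noise. *)
Lemma obs_pred_do_others x o :
  obs_pred o x = Ex pi (fun r => (net (net_rank G (do_others x o)) r (inr o))%:R).
Proof.
rewrite -(Ex_avg pi_sum1 (cone o)) -[LHS](Ex_cst pi_sum1); apply: eq_Ex => r.
rewrite avg_cone//=; last 2 first.
- by rewrite eqxx.
- by move=> i; exact: net_parent_indep.
rewrite /obs_pred; congr (_ + _); apply: eq_bigr => i _.
have [->|io] := eqVneq i o; first by rewrite hidden_coef_edge ?obs_edge_irrefl// !mul0r.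
congr (_ * _%:R); rewrite ffunE (net_fix acyc (@net_rank_local _ _ G _)).
by rewrite /net_rank /= (negbTE io); case: (x i); rewrite ?ltn_ord ?ltn0.
Qed.

Lemma obs_pred_lin x o :
  obs_pred o x = Ex pi (fun r => lin_pred G (net (net_rank G (do_others x o)) r) (inr o)).
Proof.
rewrite obs_pred_do_others.
have := @Ex_net_kernel _ _ _ (edge G) (net_rank G (do_others x o)) pi acyc
  (@net_rank_local _ _ G _) pi_sum1 (inr o) (fun=> 1) (fun _ _ => erefl).
under eq_Ex do rewrite mulr1.
move=> ->; apply: eq_Ex => r; rewrite mulr1 kernelE//=.
- by rewrite eqxx.
- by rewrite (adm_root adm).
- exact: net_root.
Qed.

Lemma obs_pred01 x o : 0 <= obs_pred o x <= 1.
Proof.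
rewrite obs_pred_do_others; apply/andP; split.
  by rewrite -[leLHS](Ex_cst pi_sum1); apply: le_Ex => // r; rewrite ler0n.
by rewrite -[leRHS](Ex_cst pi_sum1); apply: le_Ex => // r; case: (net _ _ _) => /=; rewrite ?lexx ?ler01.
Qed.

Lemma hidden_base_do_others0 o :
  hidden_base o = Ex pi (fun r => (net (net_rank G (do_others0 o)) r (inr o))%:R).
Proof.
rewrite -do_others0E -obs_pred_do_others /obs_pred big1 ?addr0// => i _.
by rewrite ffunE mulr0.
Qed.

Lemma hidden_coef_le1 o i : hidden_coef o i <= 1.
Proof.
have /andP[_] := obs_pred01 [ffun j => j == i] o; apply: le_trans.
rewrite /obs_pred (bigD1 i)//= ffunE eqxx mulr1 addrCA lerDl addr_ge0//.
  exact: hidden_base_ge0.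
by apply: sumr_ge0 => j _; rewrite mulr_ge0// hidden_coef_ge0.
Qed.

End observed_law.

Lemma sum_option (R : nmodType) (I : finType) (F : option I -> R) :
  \sum_z F z = F None + \sum_i F (Some i).
Proof.
rewrite (bigD1 None)//=; congr (_ + _).
rewrite (reindex_omap Some id) /=; last by case.
by apply: eq_bigl => i; rewrite eqxx.
Qed.

(** * The transformed model and the two comparisons of means *)

Section transformed_model.
Context {R : realType} {H X : finType}.
Local Notation node := (H + option X)%type.
Local Notation node' := (option (option X)).
Variables (G : blm R node) (u0 : H).
Hypothesis adm : admissible G u0.
Context {d : measure_display} {Om : measurableType d}.
Variables (P : probability Om R) (eps gam : nat -> node -> {RV P >-> R}).
Hypothesis noiseP : blm_noise G eps gam.

Let G' := transformed P G (eps 0%N) (gam 0%N).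
Let pi := disc_pmf G (eps 0%N) (gam 0%N).
Let pi_ge0 := disc_pmf_ge0 G (eps 0%N) (gam 0%N).
Let pi_sum1 : forall v, \sum_b pi v b = 1 := disc_pmf_sum1 G (eps 0%N) (gam 0%N).
Let kernelE := @kernel_lin _ _ _ _ _ _ _ _ noiseP 0%N.
Let acyc := adm_acyclic adm.

Let family_indep : mutually_independent P (fun i : node + node =>
  match i with inl v => (eps 0%N v : Om -> R) | inr v => gam 0%N v end).
Proof.
by apply: (noise_family_indep noiseP (f := fun v => (0%N, v))) => u v [].
Qed.

Lemma transformed_weight (i o : option X) : weight G' (Some i) (Some o) = hidden_coef G o i.
Proof. by rewrite /= sum_hidden_paths. Qed.

Lemma transformed_weight_root (o : option X) : weight G' None (Some o) = hidden_base G u0 o.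
Proof.
rewrite (hidden_base_do_others0 adm pi_sum1 kernelE) /=.
have := expectation_solve G family_indep (do_others0 o) (fun x => (x (inr o))%:R).
move=> /(congr1 fine) /= <-; congr fine.
rewrite -expectation_indic.
  congr expectation; apply/funext => w; rewrite indicE; congr (_%:R); congr nat_of_bool.
  by apply/idP/idP => [/set_mem//|h]; exact: mem_set.
have -> : [set w | solve G (do_others0 o) ((eps 0%N)^~ w) ((gam 0%N)^~ w) (inr o)]
  = \bigcup_(r in [set r | net (net_rank G (do_others0 o)) r (inr o)])
      [set w | disc_noise G (eps 0%N) (gam 0%N) w = r].
  apply/seteqP; split => w /=; rewrite solve_net.
    by move=> h; exists (disc_noise G (eps 0%N) (gam 0%N) w).
  by move=> [r /= hr wr]; rewrite -wr in hr.
by apply: fin_bigcup_measurable => // r _; exact: measurable_disc_noise.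
Qed.

(** The new predictor is an average of predictors of [o] in [G] over configurations with the root at
    1, so the range condition passes to it by convexity. *)
Lemma obs_pred_noise_range t (o : option X) x :
  {ae P, forall w, 0 <= obs_pred G u0 o x + eps t (inr o) w <= 1}.
Proof.
have root_o : inr o != root G by rewrite (adm_root adm).
(* A single null set serves all configurations, which are finitely many. *)
have ae_all : {ae P, forall w, forall y : {ffun node -> bool}, y (root G) ->
    0 <= lin_pred G y (inr o) + eps t (inr o) w <= 1}.
  apply: filter_forall => y; have [yr|yr] := boolP (y (root G)); last exact: nearW.
  have := noise_range noiseP t root_o yr; apply: filterS => w h _; exact: h.
have hidden_free (u : H) : do_others x o (inl u) = None by [].
apply: filterS ae_all => w hw.
rewrite (obs_pred_lin adm pi_sum1 kernelE).
rewrite -(Ex_cst pi_sum1 (eps t (inr o) w)) -ExD.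
apply/andP; split.
  rewrite -[leLHS](Ex_cst pi_sum1); apply: le_Ex => // r.
  by have /andP[] := hw _ (net_root adm hidden_free r).
rewrite -[leRHS](Ex_cst pi_sum1); apply: le_Ex => // r.
by have /andP[] := hw _ (net_root adm hidden_free r).
Qed.

Definition obs_edge : rel (option X) := fun i o => edge' G (Some i) (Some o).

Lemma obs_edge_connect_G (i j : option X) : connect obs_edge i j ->
  connect (edge G) (inr i) (inr j).
Proof.
case/connectP => p; elim: p i => [|k p IH] i /=; first by move=> _ ->; exact: connect0.
move=> /andP[ik kp] lst; apply: connect_trans (IH k kp lst).
exact: (obs_edge_connect adm ik).
Qed.

Lemma obs_edge_acyclic : acyclic obs_edge.
Proof.
move=> i j ij; apply/negP => /obs_edge_connect_G ji.
have [E] := connect_antisym acyc (obs_edge_connect adm ij) ji.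
by move: ij; rewrite /obs_edge E (obs_edge_irrefl adm).
Qed.

Lemma connect_edge' (i : option X) (v : node') : connect (edge' G) (Some i) v ->
  exists2 j, v = Some j & connect obs_edge i j.
Proof.
case/connectP => p; elim: p i => [|[k|] p IH] i //=.
  by move=> _ ->; exists i => //; exact: connect0.
move=> /andP[ik kp] lst; have [j vj kj] := IH k kp lst.
by exists j => //; apply: connect_trans kj; exact: connect1.
Qed.

Lemma edge'_acyclic : acyclic (edge' G).
Proof.
move=> [i|] [j|] //= ij; apply/negP => /connect_edge'[k // [<-]].
by apply/negP; exact: obs_edge_acyclic.
Qed.

Definition obs_pmf (S : {set X}) (x : {ffun option X -> bool}) : R :=
  Ex pi (fun r => (obs G (do_obs S) r == x)%:R).

Lemma sum_indicator (F : finType) (f : F -> R) (a : F) :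
  \sum_x (a == x)%:R * f x = f a.
Proof.
rewrite (bigD1 a)//= eqxx mul1r big1 ?addr0// => x /negbTE xa.
by rewrite eq_sym xa mul0r.
Qed.

Lemma Epmf_obs (S : {set X}) f : Epmf (obs_pmf S) f = Ex pi (fun r => f (obs G (do_obs S) r)).
Proof.
rewrite /Epmf /obs_pmf; under eq_bigr do rewrite -ExZr.
by rewrite -Ex_sum; apply: eq_Ex => r; exact: sum_indicator.
Qed.

Lemma obs_pmf_ge0 (S : {set X}) x : 0 <= obs_pmf S x.
Proof.
by rewrite -(Ex_cst pi_sum1 0); apply: le_Ex => // r.
Qed.

Lemma obs_pmf_sum1 (S : {set X}) : \sum_x obs_pmf S x = 1.
Proof.
have := Epmf_obs S (fun=> 1); rewrite Ex_cst// /Epmf => <-.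
by apply: eq_bigr => x _; rewrite mulr1.
Qed.

Let do_obs_hidden (S : {set X}) (u : H) : do_obs S (inl u) = None.
Proof. by []. Qed.

Lemma do_obs_free (S : {set X}) (o : option X) : o \notin Some @: S ->
  do_obs S (inr o : node) = None.
Proof. by case: o => //= x; rewrite mem_imset ?(can_inj (g := odflt x))// => /negbTE->. Qed.

Lemma obs_pmf_forced (S : {set X}) (x : {ffun option X -> bool}) o : obs_pmf S x != 0 -> o \in Some @: S -> x o.
Proof.
move=> nx /imsetP[i iS ->]; apply: contraNT nx => xi.
rewrite /obs_pmf -[X in _ == X](Ex_cst pi_sum1 0); apply/eqP/eq_Ex => r.
case: eqP => // E; move: xi; rewrite -E ffunE.
rewrite (net_fix acyc (@net_rank_local _ _ G _)) /net_rank /= iS.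
by rewrite ltn_ord.
Qed.

Lemma Epmf_obs_mul (S : {set X}) o (f : {ffun option X -> bool} -> R) : o \notin Some @: S ->
  (forall x y : {ffun option X -> bool},
     (forall i, obs_edge i o -> x i = y i) -> f x = f y) ->
  Epmf (obs_pmf S) (fun x => (x o)%:R * f x)
  = Epmf (obs_pmf S) (fun x => obs_pred G u0 o x * f x).
Proof.
move=> oS fl; rewrite !Epmf_obs.
exact: (Ex_obs_mul adm pi_sum1 kernelE (do_obs_hidden S) (do_obs_free oS) fl).
Qed.

Lemma Epmf_obs_increasing (S : {set X}) o (g : {ffun option X -> bool} -> R) : o \notin Some @: S ->
  (forall x y : {ffun option X -> bool}, (forall i, x i ==> y i) -> g x <= g y) ->
  Epmf (obs_pmf S) (fun x => obs_pred G u0 o x * g x)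
  <= Epmf (obs_pmf S) (fun x => (x o)%:R * g x).
Proof.
move=> oS gi; rewrite !Epmf_obs.
exact: (Ex_obs_increasing adm pi_ge0 pi_sum1 kernelE (do_obs_hidden S) (do_obs_free oS) gi).
Qed.

Lemma reward_obs (S : {set X}) :
  reward P G (eps 0%N) (gam 0%N) S = Epmf (obs_pmf S) (fun x => (x None)%:R).
Proof.
rewrite Epmf_obs /reward (mean_net G family_indep).
by apply: eq_Ex => r; rewrite ffunE.
Qed.

Section parameters.
Variables (th : node' -> node' -> R) (S : {set X}).

Let Gth : blm R node' := {| edge := edge' G; weight := th; root := None |}.

(* The value of the noise at the constant node is irrelevant; [1] is a round
   distinct from round [0], which keeps the family independent. *)
Let noise_index (v : node') : nat * node :=
  if v is Some o then (0%N, inr o) else (1%N, inl u0).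

Let eps' (v : node') : {RV P >-> R} := eps (noise_index v).1 (noise_index v).2.
Let gam' (v : node') : {RV P >-> R} := gam (noise_index v).1 (noise_index v).2.

Let family_indep' : mutually_independent P (fun i : node' + node' =>
  match i with inl v => (eps' v : Om -> R) | inr v => gam' v end).
Proof.
apply: (noise_family_indep noiseP (f := noise_index)).
by move=> [u|] [v|] //= [->].
Qed.

Let pi' := disc_pmf Gth eps' gam'.
Let pi'_ge0 : forall v b, 0 <= pi' v b := disc_pmf_ge0 Gth eps' gam'.
Let pi'_sum1 : forall v, \sum_b pi' v b = 1 := disc_pmf_sum1 Gth eps' gam'.
Local Notation rk' := (net_rank Gth (do_obs' S)).
Local Notation noise' := {ffun node' -> 'I_(@nb_configs node').+1}.

Let rk'_local v (x y : {ffun node' -> bool}) :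
  (forall z, edge' G z v -> x z = y z) -> rk' v x = rk' v y.
Proof. exact: (@net_rank_local _ _ Gth). Qed.

Definition obs' (r : noise') : {ffun option X -> bool} := [ffun i => net rk' r (Some i)].

Definition obs'_pmf (x : {ffun option X -> bool}) : R := Ex pi' (fun r => (obs' r == x)%:R).

Lemma Epmf_obs' f : Epmf obs'_pmf f = Ex pi' (fun r => f (obs' r)).
Proof.
rewrite /Epmf /obs'_pmf; under eq_bigr do rewrite -ExZr.
by rewrite -Ex_sum; apply: eq_Ex => r; exact: sum_indicator.
Qed.

Definition with_root (x : {ffun option X -> bool}) : {ffun node' -> bool} :=
  [ffun v => if v is Some o then x o else true].

Lemma net_with_root r : net rk' r = with_root (obs' r).
Proof.
apply/ffunP => -[k|]; rewrite !ffunE//.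
by rewrite (net_fix edge'_acyclic rk'_local) /net_rank /= ltn_ord.
Qed.

Definition kernel' (k : option X) (x : {ffun option X -> bool}) : R :=
  kernel rk' pi' (Some k) (with_root x).

Lemma do_obs'_free (o : option X) : o \notin Some @: S -> do_obs' S (Some o) = None.
Proof. by case: o => //= x; rewrite mem_imset ?(can_inj (g := odflt x))// => /negbTE->. Qed.

Definition par_pred (k : option X) (x : {ffun option X -> bool}) : R :=
  th None (Some k) + \sum_i (if obs_edge i k then th (Some i) (Some k) else 0) * (x i)%:R.

Lemma lin_pred_with_root k x : lin_pred Gth (with_root x) (Some k) = par_pred k x.
Proof.
rewrite /lin_pred big_mkcond sum_option; congr (_ + _); first by rewrite /= ffunE mulr1.
apply: eq_bigr => i _; rewrite ffunE (_ : edge Gth (Some i) (Some k) = obs_edge i k)//.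
by case: ifP; rewrite ?mul0r.
Qed.

Lemma kernel'E k x : k \notin Some @: S ->
  kernel' k x = fine (P [set w | gam 0%N (inr k) w <= par_pred k x + eps 0%N (inr k) w]).
Proof.
by move=> kS; rewrite /kernel' kernel_prob ?do_obs'_free//= lin_pred_with_root.
Qed.

Lemma sigma'_obs' :
  sigma' P G' (eps 0%N) (gam 0%N) S th = Epmf obs'_pmf (fun x => (x None)%:R).
Proof.
rewrite Epmf_obs' /sigma' /mean -/Gth.
transitivity (fine ('E_P[fun w => (solve Gth (do_obs' S) (eps' ^~ w) (gam' ^~ w) (Some None))%:R])%E).
  congr fine; congr expectation; apply/funext => w; congr (_%:R); congr nat_of_bool.
  rewrite /solve; congr (fun_of_fin _ _); elim: #|_| => //= n ->.
  apply/ffunP => -[k|]; rewrite !ffunE //=.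
rewrite (expectation_solve Gth family_indep' (do_obs' S) (fun x => (x (Some None))%:R)) /=.
by apply: eq_Ex => r; rewrite ffunE.
Qed.

Lemma obs'_pmf_ge0 x : 0 <= obs'_pmf x.
Proof.
by rewrite -(Ex_cst pi'_sum1 0); apply: le_Ex => // r.
Qed.

Lemma obs'_pmf_sum1 : \sum_x obs'_pmf x = 1.
Proof.
have := Epmf_obs' (fun=> 1); rewrite Ex_cst// /Epmf => <-.
by apply: eq_bigr => x _; rewrite mulr1.
Qed.

Lemma obs'_pmf_forced (x : {ffun option X -> bool}) o :
  obs'_pmf x != 0 -> o \in Some @: S -> x o.
Proof.
move=> nx /imsetP[i iS ->]; apply: contraNT nx => xi.
rewrite /obs'_pmf -[X in _ == X](Ex_cst pi'_sum1 0); apply/eqP/eq_Ex => r.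
case: eqP => // E; move: xi; rewrite -E ffunE.
rewrite (net_fix edge'_acyclic rk'_local) /net_rank /= iS.
by rewrite ltn_ord.
Qed.

Lemma obs'_markov k (A : {set option X}) (f : {ffun option X -> bool} -> R) :
  k \notin Some @: S ->
  (forall j, j \in A -> ~~ connect obs_edge k j) ->
  (forall x y : {ffun option X -> bool}, (forall i, i \in A -> x i = y i) -> f x = f y) ->
  Epmf obs'_pmf (fun x => (x k)%:R * f x) = Epmf obs'_pmf (fun x => kernel' k x * f x).
Proof.
move=> kS kA fA; rewrite !Epmf_obs'.
rewrite (@eq_Ex _ _ _ _ _ (fun r => (net rk' r (Some k))%:R * f (obs' r))); last first.
  by move=> r; rewrite ffunE.
rewrite (Ex_net_kernel edge'_acyclic rk'_local pi'_sum1).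
  by apply: eq_Ex => r; rewrite net_with_root.
move=> s r; apply: fA => j jA; rewrite !ffunE.
apply: (net_indep edge'_acyclic rk'_local) => u; rewrite finset.in_set1 => /eqP ->.
by apply/negP => /connect_edge'[j' [<-]]; apply/negP; exact: kA.
Qed.

Lemma kernel'01 k x : 0 <= kernel' k x <= 1.
Proof. by rewrite /kernel' kernel_ge0// kernel_le1. Qed.

Let event_measurable k c :
  measurable [set w | gam 0%N (inr k : node) w <= c + eps 0%N (inr k) w].
Proof.
exact: (measurable_pair_event (eps 0%N (inr k)) (gam 0%N (inr k)) (measurable_threshold_pairs c)).
Qed.

Let root_obs k : inr k != root G.
Proof. by rewrite (adm_root adm). Qed.

(** A candidate predictor may be so low that adding the noise makes it negative. The base rate plus
    noise is almost surely nonnegative, being the case where all observed nodes are 0, so raising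
    the predictor to the base rate restores the bound. *)
Lemma kernel'_le k x : k \notin Some @: S ->
  kernel' k x <= Num.max (hidden_base G u0 k) (par_pred k x).
Proof.
move=> kS; rewrite kernel'E//.
set m := Num.max _ _.
rewrite -lee_fin fineK; last exact: fin_num_measure.
apply: (@le_trans _ _ (P [set w | (gam 0%N (inr k) w <= m + eps 0%N (inr k) w)%R])).
  apply: le_measure.
  - exact/mem_set/event_measurable.
  - exact/mem_set/event_measurable.
  - by move=> w /= h; apply: le_trans h _; rewrite lerD2r le_max lexx orbT.
apply: (noise_threshold_le noiseP) => //.
apply: filterS (obs_pred_noise_range 0 k [ffun=> false]) => w /andP[h _].
apply: le_trans h _; rewrite lerD2r le_max /obs_pred big1 ?addr0 ?lexx// => i _.
by rewrite ffunE mulr0.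
Qed.

Lemma kernel'_ge k x : k \notin Some @: S -> par_pred k x = obs_pred G u0 k x ->
  obs_pred G u0 k x <= kernel' k x.
Proof.
move=> kS E; rewrite kernel'E//.
rewrite -lee_fin fineK; last exact: fin_num_measure.
rewrite -E; apply: (noise_threshold_ge noiseP) => //.
by apply: filterS (obs_pred_noise_range 0 k x) => w; rewrite E => /andP[].
Qed.

Lemma sigma'_le_reward : (forall z o, edge' G z (Some o) -> 0 <= th z (Some o)) ->
  sigma' P G' (eps 0%N) (gam 0%N) S th <= reward P G (eps 0%N) (gam 0%N) S
   + \sum_(k | k \notin Some @: S)
       Epmf (obs_pmf S) (fun x => `|par_pred k x - obs_pred G u0 k x|).
Proof.
move=> th0; rewrite sigma'_obs' reward_obs.
apply: (@comparison_bound _ _ obs_edge (Some @: S) (obs_pmf S) obs'_pmf kernel'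
  (hidden_base G u0) (fun k => th None (Some k)) (hidden_coef G)
  (fun k i => if obs_edge i k then th (Some i) (Some k) else 0)).
- exact: obs_edge_acyclic.
- exact: obs_pmf_ge0.
- exact: obs'_pmf_ge0.
- exact: obs_pmf_sum1.
- exact: obs'_pmf_sum1.
- by move=> x k; exact: obs_pmf_forced.
- by move=> x k; exact: obs'_pmf_forced.
- by move=> k; apply: th0.
- by move=> k i; case: ifP => // ik; apply: th0.
- by move=> k i; exact: hidden_coef_ge0 adm _ _.
- by move=> k i /negbTE->.
- exact: kernel'01.
- by move=> k x; exact: kernel'_le.
- by move=> k x; have /andP[] := obs_pred01 adm pi_ge0 pi_sum1 kernelE x k.
- by move=> k g; exact: Epmf_obs_increasing.
- by move=> k A f; exact: obs'_markov.
Qed.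

Lemma reward_le_sigma' :
  (forall k x, par_pred k x = obs_pred G u0 k x) ->
  reward P G (eps 0%N) (gam 0%N) S <= sigma' P G' (eps 0%N) (gam 0%N) S th.
Proof.
move=> thE; rewrite sigma'_obs' reward_obs.
have linE (nu : {ffun option X -> bool} -> R) k : \sum_x nu x = 1 ->
    Epmf nu (obs_pred G u0 k) = hidden_base G u0 k
      + \sum_i hidden_coef G k i * Epmf nu (fun x => (x i)%:R).
  move=> nu1; rewrite EpmfD Epmf_cst//; congr (_ + _).
  rewrite /Epmf; under eq_bigr do rewrite mulr_sumr.
  rewrite exchange_big; apply: eq_bigr => i _; rewrite mulr_sumr.
  by apply: eq_bigr => x _; rewrite mulrCA.
apply: (net_ind obs_edge_acyclic (Q := fun o => Epmf (obs_pmf S) (fun x => (x o)%:R)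
   <= Epmf obs'_pmf (fun x => (x o)%:R))) => o IH.
have [oS|oS] := boolP (o \in Some @: S).
  rewrite (@eq_Epmf _ _ (obs_pmf S) _ (fun=> 1)); last first.
    by move=> x nx; rewrite (obs_pmf_forced nx oS).
  rewrite (@eq_Epmf _ _ obs'_pmf _ (fun=> 1)); last first.
    by move=> x nx; rewrite (obs'_pmf_forced nx oS).
  by rewrite !Epmf_cst ?obs_pmf_sum1 ?obs'_pmf_sum1.
have mul1 (nu : {ffun option X -> bool} -> R) f : Epmf nu f = Epmf nu (fun x => f x * 1).
  by apply: eq_Epmf => x _; rewrite mulr1.
rewrite mul1 Epmf_obs_mul// -mul1 linE ?obs_pmf_sum1//.
rewrite [leRHS]mul1 (obs'_markov (A := finset.set0))//; last by move=> j; rewrite finset.in_set0.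
rewrite -mul1; apply: (@le_trans _ _ (Epmf obs'_pmf (obs_pred G u0 o))); last first.
  by apply: le_Epmf; [exact: obs'_pmf_ge0|move=> x _; exact: kernel'_ge].
rewrite linE ?obs'_pmf_sum1// lerD2l; apply: ler_sum => i _.
have [io|io] := boolP (obs_edge i o); last by rewrite (hidden_coef_edge adm io) !mul0r.
by rewrite ler_wpM2l ?(hidden_coef_ge0 adm)// IH.
Qed.

End parameters.
End transformed_model.

(** * Regret *)

Section law_of_run.
Context {R : realType} {H X : finType}.
Local Notation node := (H + option X)%type.
Variables (G : blm R node) (u0 : H).
Hypothesis adm : admissible G u0.
Context {d : measure_display} {Om : measurableType d}.
Variables (P : probability Om R) (eps gam : nat -> node -> {RV P >-> R}).
Hypothesis noiseP : blm_noise G eps gam.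
Variable pol : policy R X.

Let pi := disc_pmf G (eps 0%N) (gam 0%N).
Let pi_ge0 := disc_pmf_ge0 G (eps 0%N) (gam 0%N).
Let pi_sum1 : forall v, \sum_b pi v b = 1 := disc_pmf_sum1 G (eps 0%N) (gam 0%N).
Local Notation noise := {ffun node -> 'I_(@nb_configs node).+1}.
Local Notation hist := (history X).

(** The law of the history as iterated finite sums: the innermost one is the conditional law of the
    next observation given the past, so supermartingale arguments reduce to inductions on [t]. *)
Fixpoint hist_expect (t : nat) (phi : hist -> R) : R :=
  if t is t'.+1 then
    hist_expect t' (fun h => Epmf (obs_pmf G eps gam (pol h).1)
      (fun x => phi (((pol h).1, x) :: h)))
  else phi [::].

Fixpoint run_noise (z : nat -> noise) (t : nat) : hist :=
  if t is t'.+1 then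
    let h := run_noise z t' in
    ((pol h).1, obs G (do_obs (pol h).1) (z t')) :: h
  else [::].

(** The shift by one is that of the rounds: position [s] of the noise sequence drives round
    [s.+1]. *)
Lemma run_runnoise w t :
  run G eps gam pol w t
  = run_noise (fun s => disc_noise G (eps s.+1) (gam s.+1) w) t.
Proof.
elim: t => //= t ->; congr ((_, _) :: _); apply/ffunP => o.
by rewrite !ffunE solve_net.
Qed.

Lemma eq_run_noise z z' t : (forall s, (s < t)%N -> z s = z' s) ->
  run_noise z t = run_noise z' t.
Proof.
elim: t => //= t IH zz; rewrite IH ?zz// => s st; apply: zz.
exact: ltn_trans st _.
Qed.

Section rounds.
Variable T : nat.

(** The default value for [s >= T] is never read in histories of at most [T] rounds. *)
Let at_round (rho : {ffun 'I_T -> noise}) (s : nat) : noise :=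
  if insub s is Some i then rho i else [ffun=> ord0].

Let block_pmf (s : 'I_T) (r : noise) : R := wt pi r.

Let block_sum1 s : \sum_r block_pmf s r = 1.
Proof. exact: wt_sum1. Qed.

(** A history of [t] rounds reads only the blocks before [t]; redrawing block [t] alone keeps the
    past and samples the next observation. *)
Lemma Ex_run_noise t phi : (t <= T)%N ->
  Ex block_pmf (fun rho => phi (run_noise (at_round rho) t)) = hist_expect t phi.
Proof.
elim: t phi => [|t IH] phi tT /=; first by rewrite (Ex_cst block_sum1).
rewrite -IH; last exact: ltnW.
pose i := Ordinal tT.
rewrite -(Ex_avg block_sum1 [set i]); apply: eq_Ex => rho.
rewrite Epmf_obs; set h := run_noise (at_round rho) t.
transitivity (Ex block_pmf (fun s : {ffun 'I_T -> noise} =>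
    phi (((pol h).1, obs G (do_obs (pol h).1) (s i)) :: h))).
  apply: eq_Ex => s.
  have -> : run_noise (at_round (mix [set i]%SET s rho)) t = h.
    apply: eq_run_noise => j jt; rewrite /at_round; case: insubP => // k _ kj.
    rewrite ffunE finset.in_set1; case: eqP => // ki.
    by move: jt; rewrite -kj ki ltnn.
  rewrite /at_round insubT /= ffunE finset.in_set1.
  by rewrite (_ : (Sub t tT : 'I_T) = i) ?eqxx//; exact: val_inj.
exact: (Ex_marginal block_sum1 i (fun r : noise => phi (((pol h).1, obs G (do_obs (pol h).1) r) :: h))).
Qed.

Let block_noise (w : Om) : {ffun 'I_T -> noise} :=
  [ffun s : 'I_T => disc_noise G (eps s.+1) (gam s.+1) w].

Let block_noiseE rho : [set w | block_noise w = rho]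
  = [set w | forall k : 'I_T * node,
       disc G k.2 (eps k.1.+1 k.2 w, gam k.1.+1 k.2 w) = rho k.1 k.2].
Proof.
apply/seteqP; split => w /=; first by move=> <- k; rewrite !ffunE.
by move=> h; apply/ffunP => s; apply/ffunP => v; rewrite !ffunE (h (s, v)).
Qed.

Let measurable_block_noise rho : measurable [set w | block_noise w = rho].
Proof.
rewrite block_noiseE.
rewrite (_ : [set w | _] = \bigcap_(k in [set` enum {: 'I_T * node}])
   [set w | disc G k.2 (eps k.1.+1 k.2 w, gam k.1.+1 k.2 w) = rho k.1 k.2]).
  by apply: measurable_bigcap_seq => k; exact: measurable_disc_event.
apply/seteqP; split => w h k; first by move=> _; exact: h.
by apply: h; rewrite /= mem_enum.
Qed.

Let law_block_noise rho : fine (P [set w | block_noise w = rho]) = wt block_pmf rho.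
Proof.
rewrite block_noiseE.
pose f (k : 'I_T * node) : nat * node := ((val k.1).+1, k.2).
have inj_f : injective f by move=> [s v] [s' v'] [] /val_inj -> ->.
have ind := noise_family_indep noiseP inj_f.
rewrite (joint_law_finite (D := fun k : 'I_T * node => disc G k.2) (fun k => rho k.1 k.2) ind); last first.
  by move=> k b; exact: measurable_disc.
rewrite /wt /block_pmf /wt pair_bigA /=.
transitivity (fine (\prod_(k : 'I_T * node) (pi k.2 (rho k.1 k.2))%:E)%E); last by rewrite prodEFin.
congr fine; apply: eq_bigr => k _.
rewrite /pi -(disc_pmf_ident noiseP k.1.+1) /disc_pmf fineK// fin_num_measure//.
exact: measurable_disc_event.
Qed.

Lemma expectation_run phi :
  ('E_P[fun w => phi (run G eps gam pol w T)] = (hist_expect T phi)%:E)%E.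
Proof.
rewrite (_ : (fun w => _) = (fun w => phi (run_noise (at_round (block_noise w)) T))); last first.
  apply/funext => w; rewrite run_runnoise; congr phi; apply: eq_run_noise => s sT.
  by rewrite /at_round insubT /= ffunE.
rewrite (expectation_finite P (fun rho => phi (run_noise (at_round rho) T)) measurable_block_noise).
rewrite -(Ex_run_noise phi (leqnn T)); congr EFin.
by apply: eq_bigr => rho _; rewrite law_block_noise.
Qed.

End rounds.
End law_of_run.

Lemma EpmfZ (R : realFieldType) (I : finType) (nu f : {ffun I -> bool} -> R) c :
  Epmf nu (fun x => c * f x) = c * Epmf nu f.
Proof. by rewrite /Epmf mulr_sumr; apply: eq_bigr => x _; rewrite mulrCA. Qed.

Lemma Epmf_sum (R : realFieldType) (I J : finType) (nu : {ffun I -> bool} -> R)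
    (Q : pred J) (f : J -> {ffun I -> bool} -> R) :
  Epmf nu (fun x => \sum_(j | Q j) f j x) = \sum_(j | Q j) Epmf nu (f j).
Proof. by rewrite /Epmf; under eq_bigr do rewrite mulr_sumr; rewrite exchange_big. Qed.

(** * Confidence event and summation of the gaps *)

Section regret_bound.
Context {R : realType} {H X : finType}.
Local Notation node := (H + option X)%type.
Local Notation node' := (option (option X)).
Local Notation hist := (history X).
Variables (G : blm R node) (u0 : H).
Hypothesis adm : admissible G u0.
Context {d : measure_display} {Om : measurableType d}.
Variables (P : probability Om R) (eps gam : nat -> node -> {RV P >-> R}).
Hypothesis noiseP : blm_noise G eps gam.

Section expectation.
Variable pol : policy R X.
Local Notation HE := (hist_expect G eps gam pol).

Lemma le_hist_expect t (f g : hist -> R) : (forall h, size h = t -> f h <= g h) ->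
  HE t f <= HE t g.
Proof.
elim: t f g => [|t IH] f g fg /=; first exact: fg.
apply: IH => h ht; apply: le_Epmf => [x|x _]; first exact: obs_pmf_ge0.
by apply: fg; rewrite /= ht.
Qed.

Lemma eq_hist_expect t (f g : hist -> R) : (forall h, f h = g h) -> HE t f = HE t g.
Proof. by move=> fg; apply/le_anti; rewrite !le_hist_expect// => h _; rewrite fg. Qed.

Lemma hist_expectD t (f g : hist -> R) : HE t (fun h => f h + g h) = HE t f + HE t g.
Proof.
elim: t f g => //= t IH f g; rewrite -IH; apply: eq_hist_expect => h.
exact: EpmfD.
Qed.

Lemma hist_expectZ t c (f : hist -> R) : HE t (fun h => c * f h) = c * HE t f.
Proof.
elim: t f => //= t IH f; rewrite -IH; apply: eq_hist_expect => h.
exact: EpmfZ.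
Qed.

Lemma hist_expect_cst t c : HE t (fun=> c) = c.
Proof.
elim: t => //= t IH; rewrite -[RHS]IH; apply: eq_hist_expect => h.
exact/Epmf_cst/obs_pmf_sum1.
Qed.

Lemma hist_expect_sum t (J : finType) (f : J -> hist -> R) :
  HE t (fun h => \sum_j f j h) = \sum_j HE t (f j).
Proof.
elim: t f => //= t IH f; rewrite -IH; apply: eq_hist_expect => h.
exact: Epmf_sum.
Qed.

End expectation.

Local Notation G' := (transformed P G (eps 0%N) (gam 0%N)).
Local Notation ths := (weight G').

Lemma par_weights_qf (th : node' -> node' -> R) (o : option X) (x : {ffun option X -> bool}) :
  qf 1%:M (par_weights G' th o) (par_values G' x o) = par_pred G th o x.
Proof.
rewrite qf_par_values big_mkcond sum_option /= mulr1; congr (_ + _).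
by apply: eq_bigr => i _; rewrite /obs_edge /=; case: ifP; rewrite ?mul0r.
Qed.

Lemma par_pred_weight (o : option X) (x : {ffun option X -> bool}) :
  par_pred G ths o x = obs_pred G u0 o x.
Proof.
rewrite /par_pred (transformed_weight_root adm noiseP); congr (_ + _).
apply: eq_bigr => i _; rewrite transformed_weight; case: ifP => // /negbT h.
by rewrite (hidden_coef_edge adm).
Qed.

Lemma obs_pred_bounds (o : option X) (x : {ffun option X -> bool}) : 0 <= obs_pred G u0 o x <= 1.
Proof.
exact: (obs_pred01 adm (disc_pmf_ge0 G (eps 0%N) (gam 0%N))
  (disc_pmf_sum1 G (eps 0%N) (gam 0%N)) (kernel_lin noiseP 0%N)).
Qed.

Lemma transformed_weight01 z (o : option X) : 0 <= ths z (Some o) <= 1.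
Proof.
case: z => [i|].
  rewrite transformed_weight (hidden_coef_ge0 adm)/=.
  exact: (hidden_coef_le1 adm (disc_pmf_ge0 G (eps 0%N) (gam 0%N))
    (disc_pmf_sum1 G (eps 0%N) (gam 0%N)) (kernel_lin noiseP 0%N)).
rewrite (transformed_weight_root adm noiseP).
have := obs_pred_bounds o [ffun=> false]; rewrite /obs_pred big1 ?addr0// => i _.
by rewrite ffunE mulr0.
Qed.

Lemma par_weights01 (o : option X) k : 0 <= par_weights G' ths o k ord0 <= 1.
Proof. by rewrite mxE transformed_weight01. Qed.

Lemma reward01 (S : {set X}) : 0 <= reward P G (eps 0%N) (gam 0%N) S <= 1.
Proof.
rewrite (reward_obs noiseP); apply/andP; split.
  rewrite -[leLHS](Epmf_cst _ (obs_pmf_sum1 G eps gam S)).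
  by apply: le_Epmf => [x|x _]; [exact: obs_pmf_ge0|rewrite ler0n].
rewrite -[leRHS](Epmf_cst _ (obs_pmf_sum1 G eps gam S)).
by apply: le_Epmf => [x|x _]; [exact: obs_pmf_ge0|rewrite lern1 leq_b1].
Qed.

Variables (pol : policy R X) (K T : nat) (Sopt : {set X}).
Hypothesis algo : BLM_LR G' P (eps 0%N) (gam 0%N) K T pol.
Hypothesis Sopt_card : (#|Sopt| <= K)%N.
Hypothesis T_gt0 : (0 < T)%N.

Local Notation n := (@nb_nodes X).
Local Notation D := (max_in_degree G').
Local Notation HE := (hist_expect G eps gam pol).
Local Notation del := (@delta R X T).

Lemma nb_nodes_gt0 : (0 < n)%N. Proof. by apply/card_gt0P; exists None. Qed.

Lemma card_parents_le (o : option X) : (#|parents' G' o| <= n)%N.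
Proof. exact: max_card. Qed.

Lemma card_parents_le_degree (o : option X) : (#|parents' G' o| <= D)%N.
Proof. exact: (leq_bigmax o). Qed.

Lemma max_in_degree_le : (D <= n)%N.
Proof. by apply/bigmax_leqP => o _; exact: card_parents_le. Qed.

Lemma max_in_degree_gt0 : (0 < D)%N.
Proof.
apply: leq_trans (card_parents_le_degree None); apply/card_gt0P.
by exists None; rewrite finset.inE.
Qed.

Lemma delta_gt0 : 0 < del.
Proof.
by rewrite /delta invr_gt0 mulr_gt0// ?sqrtr_gt0 ltr0n// nb_nodes_gt0.
Qed.

Lemma rho_mono t : (t <= T)%N -> @rho R X T t <= @rho R X T T.
Proof.
move=> tT; rewrite /rho lerD2r ler_wsqrtr// lerD2r ler_wpM2l//.
rewrite ler_ln ?posrE ?ltr_wpDr ?mulr_ge0//.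
by rewrite lerD2l ler_wpM2r// ler_nat.
Qed.

Lemma rho_ge0 t : 0 <= @rho R X T t.
Proof. by rewrite addr_ge0 ?sqrtr_ge0. Qed.

Lemma ln_gram_det_le (h : hist) (o : option X) :
  ln (\det (gram G' h o)) <= #|parents' G' o|%:R * ln (1 + (size h)%:R).
Proof.
have /andP[d0 d1] := gram_det_le G' o h.
by rewrite mulr_natl -lnXn ?ltr_wpDr// ler_ln ?posrE// exprn_gt0 ?ltr_wpDr.
Qed.

Lemma ln_gram_det_ge0 (h : hist) (o : option X) : 0 <= ln (\det (gram G' h o)).
Proof.
elim: h => [|[A x] h IH]; first by rewrite /= det1 ln1.
have [oA|oA] := boolP (o \in Some @: A); first by rewrite /= oA.
rewrite ln_det_cons// addr_ge0// ln_ge0// lerDl.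
exact/posdef_ge0/posdef_inv/gram_posdef.
Qed.

(* Stopping [mixture] at [delta^-1] turns Markov's inequality into Ville's
   maximal inequality over all rounds. *)
Fixpoint stopped (o : option X) (h : hist) : R :=
  if h is _ :: h' then
    if del^-1 <= stopped o h' then stopped o h' else mixture G' ths o h
  else mixture G' ths o h.

Definition bad (h : hist) : bool := [exists o, del^-1 <= stopped o h].

Lemma stopped_ge0 o h : 0 <= stopped o h.
Proof. by elim: h => [|a h IH] /=; [|case: ifP => // _]; exact: mixture_ge0. Qed.

Lemma stopped_lt o h : stopped o h < del^-1 -> stopped o h = mixture G' ths o h.
Proof. by case: h => //= a h; case: ifP => // h1; rewrite ltNge h1. Qed.

Lemma bad_cons a h : bad h -> bad (a :: h).
Proof. by move=> /existsP[k hk]; apply/existsP; exists k; rewrite /= hk. Qed.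

(** The value is frozen once it reaches the threshold, and before that the mixture is a
    supermartingale started at 1. *)
Lemma hist_expect_stopped o t : HE t (stopped o) <= 1.
Proof.
elim: t => [|t IH]; first by rewrite /= mixture_nil.
apply: le_trans IH; rewrite [HE t.+1 _]/=; apply: le_hist_expect => h _ /=.
have [h1|h1] := leP del^-1 (stopped o h).
  by rewrite Epmf_cst ?obs_pmf_sum1.
rewrite stopped_lt//; apply: mixture_supermartingale.
- exact: obs_pmf_ge0.
- exact: obs_pmf_sum1.
- by move=> x; rewrite par_weights_qf par_pred_weight obs_pred_bounds.
- move=> oS f fl; rewrite (Epmf_obs_mul adm noiseP oS fl).
  by apply: eq_Epmf => x _; rewrite par_weights_qf par_pred_weight.
Qed.

(** Markov's inequality for each stopped process, and a union bound over the [n - 1] observed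
    nodes. *)
Lemma hist_expect_bad t : HE t (fun h => (bad h)%:R) <= n%:R * del.
Proof.
apply: (@le_trans _ _ (HE t (fun h => \sum_o del * stopped o h))).
  apply: le_hist_expect => h _; case: (boolP (bad h)) => [/existsP[k hk]|_]; last first.
    by apply: sumr_ge0 => o _; rewrite mulr_ge0 ?stopped_ge0 ?ltW ?delta_gt0.
  rewrite (bigD1 k)//= -[leLHS]addr0 lerD//; last first.
    by apply: sumr_ge0 => o' _; rewrite mulr_ge0 ?stopped_ge0 ?ltW ?delta_gt0.
  by rewrite -ler_pdivrMl ?delta_gt0// mulr1.
rewrite hist_expect_sum; apply: (@le_trans _ _ (\sum_(o : option X) del)).
  apply: ler_sum => o _; rewrite hist_expectZ -[leRHS]mulr1.
  by rewrite ler_wpM2l ?hist_expect_stopped ?ltW ?delta_gt0.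
rewrite sumr_const -[leLHS]mulr_natl; apply: ler_wpM2r; first exact/ltW/delta_gt0.
by rewrite ler_nat /nb_nodes [leqRHS]card_option.
Qed.

(** [ln (\det M)] is at most [dim * ln (1 + t)], hence at most the first term under the root in
    [rho]; the threshold [del^-1] yields the second. *)
Lemma good_conf_region h o : ~~ bad h ->
  conf_region T h (par_weights G' ths o).
Proof.
move=> /existsPn /(_ o); rewrite -ltNge => h1; split; first exact: par_weights01.
move: (h1); rewrite stopped_lt// => {}h1.
have c0 : 0 < del^-1 by rewrite invr_gt0 delta_gt0.
apply: le_trans (mixture_lt_conf c0 (@par_weights01 o) h1) _.
have dn : #|parents' G' o|%:R <= n%:R :> R by rewrite ler_nat card_parents_le.
rewrite /rho lerD ?ler_wsqrtr// lerD2r.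
apply: le_trans (ln_gram_det_le h o) _; apply: ler_pM => //.
  by rewrite ln_ge0// lerDl.
rewrite ler_ln ?posrE ?ltr_wpDr ?mulr_ge0// lerD2l.
by rewrite ler_peMr// ler1n nb_nodes_gt0.
Qed.

Definition gap (h : hist) : R :=
  reward P G (eps 0%N) (gam 0%N) Sopt - reward P G (eps 0%N) (gam 0%N) (pol h).1.

Definition width (o : option X) (h : hist) (x : {ffun option X -> bool}) : R :=
  `|qf 1%:M (par_weights G' (pol h).2 o - par_weights G' ths o) (par_values G' x o)|.

Lemma gap_le1 h : gap h <= 1.
Proof.
have /andP[_ r1] := reward01 Sopt; have /andP[r0 _] := reward01 (pol h).1.
rewrite /gap; lra.
Qed.

Lemma good_candidate h : ~~ bad h -> candidate G' K T h (pol h) /\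
  reward P G (eps 0%N) (gam 0%N) Sopt
  <= sigma' P G' (eps 0%N) (gam 0%N) (pol h).1 (pol h).2.
Proof.
move=> gh; have cand : candidate G' K T h (Sopt, ths).
  by split => //= o; exact: good_conf_region.
have [_ /(_ (ex_intro _ _ cand))[pc pmax]] := algo h; split => //.
apply: le_trans (pmax _ cand); apply: (reward_le_sigma' adm noiseP) => k x.
exact: par_pred_weight.
Qed.

Lemma good_gap_le h : ~~ bad h ->
  gap h <= Epmf (obs_pmf G eps gam (pol h).1)
    (fun x => \sum_(o | o \notin Some @: (pol h).1) width o h x).
Proof.
move=> gh; have [[_ conf] opt] := good_candidate gh.
rewrite lerBlDl; apply: le_trans opt _; rewrite Epmf_sum.
apply: le_trans (sigma'_le_reward adm noiseP (pol h).1 _) _.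
  move=> z o zo; have [/(_ (enum_rank_in _ z)) + _] := conf o.
  have zP : z \in parents' G' o by rewrite finset.inE.
  by move=> /(_ z zP); rewrite mxE enum_rankK_in// => /andP[].
rewrite lerD2l; apply: ler_sum => o _; apply: le_Epmf => [x|x _]; first exact: obs_pmf_ge0.
by rewrite /width qfDl qfNl !par_weights_qf par_pred_weight.
Qed.

Fixpoint cum_gap (h : hist) : R := if h is _ :: h' then cum_gap h' + gap h' else 0.

(** Rounds with a failed confidence region contribute 0 here, their gap being charged separately; a
    forced node contributes 0, as in the comparison of means. *)
Fixpoint cum_width (o : option X) (h : hist) : R :=
  if h is (A, x) :: h' then
    cum_width o h' + (if bad h' || (o \in Some @: A) then 0 else width o h' x)
  else 0.

(** The increments of [ln (\det M)] in [width_step] telescope. A forced round leaves the determinant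
    unchanged and only increases the count of rounds. *)
Lemma cum_width_le o b h : 0 < b -> (size h <= T)%N ->
  cum_width o h <= 2 * @rho R X T T * (b * ln (\det (gram G' h o)) + (size h)%:R / (2 * b))
    + 2 * #|parents' G' o|%:R * ln (\det (gram G' h o)).
Proof.
move=> b0; elim: h => [|[A x] h IH] hT.
  by rewrite /= det1 ln1 !mulr0 mul0r !addr0 mulr0.
have {IH} := IH (ltnW hT).
have -> : (size ((A, x) :: h))%:R = (size h)%:R + 1 :> R by rewrite -natr1.
have -> : cum_width o ((A, x) :: h) = cum_width o h
  + (if bad h || (o \in Some @: A) then 0 else width o h x) by [].
set c := cum_width _ _; set t := (size h)%:R.
have bb0 : 0 <= (2 * b)^-1 by rewrite invr_ge0 mulr_ge0// ltW.
have rb0 : 0 <= 2 * @rho R X T T * (2 * b)^-1 by rewrite !mulr_ge0 ?rho_ge0.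
have [oA|oA] := boolP (o \in Some @: A).
  have -> : gram G' ((A, x) :: h) o = gram G' h o by rewrite /= oA.
  by rewrite orbT; lra.
rewrite orbF (ln_det_cons _ _ _ oA).
set y := ln (1 + _); set l := ln _ => IH.
have y0 : 0 <= y by rewrite ln_ge0// lerDl; apply/posdef_ge0/posdef_inv/gram_posdef.
case: (boolP (bad h)) => [_|gh].
  have h1 : 0 <= 2 * @rho R X T T * (b * y) by rewrite !mulr_ge0 ?rho_ge0// ltW.
  have h2 : 0 <= 2 * #|parents' G' o|%:R * y by rewrite !mulr_ge0.
  lra.
have w : width o h x <= 2 * @rho R X T T * (b * y + (2 * b)^-1) + 2 * #|parents' G' o|%:R * y.
  apply: width_step => //; first exact: rho_ge0.
    move=> k; rewrite !mxE; have [[_ conf] _] := good_candidate gh.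
    have /andP[a0 a1] := transformed_weight01 (enum_val k) o.
    have [/(_ k) + _] := conf o; rewrite mxE => /andP[c0 c1].
    by rewrite ler_norml; apply/andP; split; lra.
  have [[_ conf] _] := good_candidate gh.
  have [_ m1] := conf o; have [_ m2] := good_conf_region o gh.
  (* Candidate and true weights lie in the same region, so their distance is at most twice its
     radius. *)
  have -> : par_weights G' (pol h).2 o - par_weights G' ths o
     = (par_weights G' (pol h).2 o - theta_hat G' h o)
       - (par_weights G' ths o - theta_hat G' h o) by rewrite opprB subrKA.
  apply: le_trans (ler_mnormD _ _ (gram_posdef _ _ _)) _; rewrite mnormN.
  by have := rho_mono (ltnW hT); lra.
lra.
Qed.

(** A bad history stays bad, so each of the [t] rounds costs at most the final probability of being
    bad, the gap being at most 1. *)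
Lemma hist_expect_gap t :
  HE t cum_gap <= HE t (fun h => \sum_o cum_width o h) + t%:R * HE t (fun h => (bad h)%:R).
Proof.
elim: t => [|t IH]; first by rewrite /= mul0r addr0 big1.
apply: (@le_trans _ _ (HE t (fun h => cum_gap h + gap h))).
  rewrite [HE t.+1 _]/=; apply: le_hist_expect => h _ /=.
  by rewrite Epmf_cst ?obs_pmf_sum1.
rewrite hist_expectD; apply: le_trans (lerD IH (lexx _)) _.
pose bad_next : R := HE t.+1 (fun h => (bad h)%:R).
pose step (h : hist) : R := if bad h then 0 else Epmf (obs_pmf G eps gam (pol h).1)
    (fun x => \sum_(o | o \notin Some @: (pol h).1) width o h x).
have bad_le : HE t (fun h => (bad h)%:R) <= bad_next.
  rewrite /bad_next [HE t.+1 _]/=; apply: le_hist_expect => h _; rewrite -[leLHS](Epmf_cst _ (obs_pmf_sum1 G eps gam (pol h).1)).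
  apply: le_Epmf => [x|x _]; first exact: obs_pmf_ge0.
  case: (boolP (bad h)) => [/bad_cons->//|_]; exact: ler0n.
have gap_step : HE t gap <= HE t step + HE t (fun h => (bad h)%:R).
  rewrite -hist_expectD; apply: le_hist_expect => h _; rewrite /step.
  by case: (boolP (bad h)) => [_|gh]; rewrite ?add0r ?gap_le1// addr0 good_gap_le.
have width_next : HE t.+1 (fun h => \sum_o cum_width o h)
    = HE t (fun h => \sum_o cum_width o h) + HE t step.
  rewrite [HE t.+1 _]/= -hist_expectD; apply: eq_hist_expect => h; rewrite /step.
  transitivity (Epmf (obs_pmf G eps gam (pol h).1) (fun x => \sum_o cum_width o h
      + (if bad h then 0 else \sum_(o | o \notin Some @: (pol h).1) width o h x))).
    apply: eq_Epmf => x _; rewrite big_split; congr (_ + _).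
    case: (bad h) => /=; first by rewrite big1.
    by rewrite [RHS]big_mkcond; apply: eq_bigr => o _; rewrite if_neg.
  rewrite EpmfD Epmf_cst ?obs_pmf_sum1//; congr (_ + _).
  by case: (bad h) => //; rewrite Epmf_cst ?obs_pmf_sum1.
have : t%:R * HE t (fun h => (bad h)%:R) <= t%:R * bad_next by rewrite ler_wpM2l.
by rewrite width_next -natr1 mulrDl mul1r -/bad_next; lra.
Qed.

Lemma hist_expect_gap_le t : HE t cum_gap <= t%:R.
Proof.
rewrite -[leRHS](hist_expect_cst pol t); apply: le_hist_expect => h <-.
elim: h => //= _ h IH; rewrite -natr1; exact: lerD IH (gap_le1 h).
Qed.

Lemma regret_hist_expect : regret G eps gam pol Sopt T = (HE T cum_gap)%:E.
Proof.
rewrite -(expectation_run noiseP); congr expectation; apply/funext => w.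
elim: T => [|t IH]; first by rewrite big_ord0.
by rewrite big_ord_recr /= IH.
Qed.

Lemma hist_expect_width b : 0 < b ->
  HE T (fun h => \sum_o cum_width o h)
  <= n%:R * (2 * @rho R X T T * (b * (D%:R * ln (1 + T%:R)) + T%:R / (2 * b))
             + 2 * D%:R * (D%:R * ln (1 + T%:R))).
Proof.
move=> b0; set l := D%:R * ln _.
rewrite -[leRHS](hist_expect_cst pol T); apply: le_hist_expect => h hT.
have l0 : 0 <= l by rewrite mulr_ge0// ln_ge0// lerDl.
set B := 2 * _ * _ + _.
have B0 : 0 <= B.
  have b1 := ltW b0; rewrite /B; apply: addr_ge0; last by rewrite mulr_ge0// mulr_ge0.
  apply: mulr_ge0; first by rewrite mulr_ge0 ?rho_ge0.
  by apply: addr_ge0; [exact: mulr_ge0|apply: divr_ge0 => //; exact: mulr_ge0].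
apply: (@le_trans _ _ (\sum_(o : option X) B)); last first.
  rewrite sumr_const -[leLHS]mulr_natl; apply: ler_wpM2r => //.
  by rewrite ler_nat /nb_nodes [leqRHS]card_option.
apply: ler_sum => o _; apply: le_trans (cum_width_le o b0 _) _; first by rewrite hT.
have dD : #|parents' G' o|%:R <= D%:R :> R by rewrite ler_nat card_parents_le_degree.
have Ll : ln (\det (gram G' h o)) <= l.
  apply: le_trans (ln_gram_det_le h o) _; rewrite hT ler_wpM2r// ln_ge0// lerDl.
  exact: ler0n.
have L0 := ln_gram_det_ge0 h o.
rewrite hT /B lerD//.
  rewrite ler_wpM2l ?mulr_ge0 ?rho_ge0// lerD2r ler_wpM2l// ltW//.
by apply: ler_pM => //; rewrite ?mulr_ge0// ler_wpM2l.
Qed.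

End regret_bound.

Theorem theorem3 (R : realType) :
  exists2 C : R, 0 < C &
  forall (H X : finType) (u0 : H) (G : blm R (H + option X)%type)
    (d : measure_display) (Omega : measurableType d)
    (P : probability Omega R)
    (eps gam : nat -> (H + option X)%type -> {RV P >-> R})
    (K T : nat) (pol : policy R X) (Sopt : {set X}),
  let G' := transformed P G (eps 0%N) (gam 0%N) in
  let n := @nb_nodes X in
  let D := max_in_degree G' in
  admissible G u0 ->
  blm_noise G eps gam ->
  BLM_LR G' P (eps 0%N) (gam 0%N) K T pol ->
  is_optimal P G (eps 0%N) (gam 0%N) K Sopt ->
  (2 <= T)%N ->
  (regret G eps gam pol Sopt T
   <= (C * n%:R ^+ 2 * Num.sqrt (D%:R * T%:R) * ln T%:R)%:E)%E.
Proof.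
exists 100; first by [].
move=> H X u0 G d Om P eps gam K T pol Sopt G' n D adm noiseP algo [Sopt_card _] T2.
have T_gt0 : (0 < T)%N by apply: leq_trans T2.
have SK : (#|Sopt| <= K)%N by rewrite Sopt_card.
rewrite (regret_hist_expect noiseP) lee_fin.
have D_gt0 : (0 < D)%N by exact: max_in_degree_gt0.
have D_le : (D <= n)%N by exact: max_in_degree_le.
apply: (@regret_rate R n D T D_gt0 D_le T2 (@rho R X T T) (D%:R * ln (1 + T%:R))).
- by move=> nT; rewrite /rho /delta invrK; exact: (rho_le D_gt0).
(* Since T >= 2, 1 + T is at most the square of T, whence the factor 2. *)
- rewrite mulrCA; apply: ler_wpM2l => //; apply: (ln_le_mul D_gt0 D_le T2).
    by rewrite ltr_wpDr.
  rewrite -natrX nat1r ler_nat expnS expn1; apply: leq_trans (leq_mul T2 (leqnn T)).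
  by rewrite mul2n -addnn -add1n leq_add2r.
- exact: rho_ge0.
- exact: (hist_expect_gap_le noiseP).
- move=> b b0; apply: le_trans (hist_expect_gap adm noiseP algo SK T_gt0 T) _.
  apply: lerD; first exact: (hist_expect_width adm noiseP algo SK T_gt0 b0).
  apply: le_trans (ler_wpM2l _ (hist_expect_bad adm noiseP pol T_gt0 T)) _ => //.
  (* It remains to see that T n delta is sqrt T. *)
  have sT : 0 < Num.sqrt T%:R :> R by rewrite sqrtr_gt0 ltr0n.
  rewrite /delta invfM mulVKf ?pnatr_eq0 -?lt0n ?nb_nodes_gt0//.
  by rewrite -[X in X / _]sqr_sqrtr// expr2 mulfK// gt_eqF.
Qed.
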